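(* Let $k>0$ and $\mathbf{d}_0\in\mathbb{S}$ be fixed. Then the phaseless data $\{|u^\infty(\hat{\mathbf{x}};\mathbf{Z},\mathbf{d}_0,\mathbf{d},k)|:\ \hat{\mathbf{x}}\in\mathbb{S},\ \mathbf{d}\in\mathbb{S}\}$ uniquely determine a sound-soft disk, that is, its center and radius. Explicitly: if two sound-soft disks in $\mathbb{R}^2$ with centers $x^{(1)},x^{(2)}\in\mathbb{R}^2$ and radii $r_1,r_2>0$, with parameters $\mathbf{Z}^{(1)},\mathbf{Z}^{(2)}$, satisfy $$|u^\infty(\hat{\mathbf{x}};\mathbf{Z}^{(1)},\mathbf{d}_0,\mathbf{d},k)|=|u^\infty(\hat{\mathbf{x}};\mathbf{Z}^{(2)},\mathbf{d}_0,\mathbf{d},k)|\quad\text{for all }\hat{\mathbf{x}},\mathbf{d}\in\mathbb{S},$$ then $x^{(1)}=x^{(2)}$ and $r_1=r_2$.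
   Context: $\mathbb{S}=\{x\in\mathbb{R}^2:|x|=1\}$. The parameter $\mathbf{Z}$ encodes the center $(x_1,x_2)^\top\in\mathbb{R}^2$ and radius $r>0$ of a disk $D\subset\mathbb{R}^2$. For $\mathbf{d}_0,\mathbf{d}\in\mathbb{S}$, the incident field is the superposition of two plane waves $u^{in}(x)=e^{ikx\cdot\mathbf{d}_0}+e^{ikx\cdot\mathbf{d}}$ (equal to $2e^{ikx\cdot\mathbf{d}_0}$ when $\mathbf{d}=\mathbf{d}_0$). Sound-soft means that the scattered field $u^{sc}$ solves $\Delta u^{sc}+k^2u^{sc}=0$ in $\mathbb{R}^2\setminus\bar D$, $u^{sc}=-u^{in}$ on $\partial D$, and satisfies the Sommerfeld radiation condition $\lim_{\rho\to\infty}\sqrt{\rho}\,(\partial_\rho u^{sc}-iku^{sc})=0$, $\rho=|x|$, uniformly in all directions $\hat{\mathbf{x}}=x/|x|$. The far-field pattern $u^\infty(\hat{\mathbf{x}};\mathbf{Z},\mathbf{d}_0,\mathbf{d},k)\in\mathbb{C}$ is defined by $u^{sc}(x)=\frac{e^{ik|x|}}{\sqrt{|x|}}\{u^\infty(\hat{\mathbf{x}};\mathbf{Z},\mathbf{d}_0,\mathbf{d},k)+\mathcal{O}(|x|^{-1/2})\}$ as $|x|\to\infty$. *)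

(* Defs.v *)
From Stdlib Require Import Reals.
From Coquelicot Require Import Coquelicot.
Open Scope R_scope.

Definition dot (x y : R * R) : R := fst x * fst y + snd x * snd y.

Definition enorm (x : R * R) : R := sqrt (fst x ^ 2 + snd x ^ 2).

Definition edist (x y : R * R) : R := enorm (fst x - fst y, snd x - snd y).

Definition dilate (t : R) (x : R * R) : R * R := (t * fst x, t * snd x).

Definition unit_vector (x : R * R) : Prop := enorm x = 1.

(* e^{it} *)
Definition expi (t : R) : C := (cos t, sin t).

Definition partial1 (f : R * R -> R) (p : R * R) : R :=
  Derive (fun t => f (t, snd p)) (fst p).

Definition partial2 (f : R * R -> R) (p : R * R) : R :=
  Derive (fun t => f (fst p, t)) (snd p).

(* [C1_on] and [C2_on] are the usual classes when [U] is open. [Derive] and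
   hence [partial1], [partial2] are total, so existence of the partial
   derivatives is required separately. *)
Definition C1_on (U : R * R -> Prop) (f : R * R -> R) : Prop :=
  forall p, U p ->
    ex_derive (fun t => f (t, snd p)) (fst p) /\
    ex_derive (fun t => f (fst p, t)) (snd p) /\
    continuous (partial1 f) p /\
    continuous (partial2 f) p.

Definition C2_on (U : R * R -> Prop) (f : R * R -> R) : Prop :=
  C1_on U f /\ C1_on U (partial1 f) /\ C1_on U (partial2 f).

Definition laplacian (f : R * R -> R) (p : R * R) : R :=
  partial1 (partial1 f) p + partial2 (partial2 f) p.

Definition C2_onC (U : R * R -> Prop) (u : R * R -> C) : Prop :=
  C2_on U (fun x => Re (u x)) /\ C2_on U (fun x => Im (u x)).

Definition laplacianC (u : R * R -> C) (p : R * R) : C :=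
  (laplacian (fun x => Re (u x)) p, laplacian (fun x => Im (u x)) p).

(* The derivative of u along the ray through xhat, at the point rho * xhat. *)
Definition radial_derivative (u : R * R -> C) (rho : R) (xhat : R * R) : C :=
  (Derive (fun t => Re (u (dilate t xhat))) rho,
   Derive (fun t => Im (u (dilate t xhat))) rho).

Record disk : Type := Disk { center : R * R; radius : R }.

Definition on_boundary (Z : disk) (x : R * R) : Prop :=
  edist x (center Z) = radius Z.

Definition exterior (Z : disk) (x : R * R) : Prop :=
  radius Z < edist x (center Z).

Definition closed_exterior (Z : disk) (x : R * R) : Prop :=
  radius Z <= edist x (center Z).

Definition incident_field (k : R) (d0 d x : R * R) : C :=
  (expi (k * dot x d0) + expi (k * dot x d))%C.

Definition sommerfeld (k : R) (u : R * R -> C) : Prop :=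
  forall eps : R, 0 < eps ->
  exists M : R, forall (rho : R) (xhat : R * R),
    M < rho -> unit_vector xhat ->
    Cmod (sqrt rho * (radial_derivative u rho xhat
                      - Ci * k * u (dilate rho xhat)))%C < eps.

(* Classical solution: C^2 outside the closed disk and continuous up to the
   boundary circle. The values of u inside the disk are irrelevant. *)
Definition is_scattered_field (k : R) (Z : disk) (d0 d : R * R)
    (u : R * R -> C) : Prop :=
  C2_onC (exterior Z) u /\
  (forall x, closed_exterior Z x ->
     filterlim u (within (closed_exterior Z) (locally x)) (locally (u x))) /\
  (forall x, exterior Z x -> (laplacianC u x + k ^ 2 * u x)%C = 0%C) /\
  (forall x, on_boundary Z x -> u x = (- incident_field k d0 d x)%C) /\
  sommerfeld k u.

(* u(x) = e^{ik|x|} / sqrt|x| * (uinf(x/|x|) + O(|x|^{-1/2})) as |x| -> oo.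
   Only the values of uinf on the unit circle matter. *)
Definition has_far_field (k : R) (u uinf : R * R -> C) : Prop :=
  exists (E : R * R -> C) (K M : R),
    0 < M /\
    forall x, M < enorm x ->
      u x = (expi (k * enorm x) / sqrt (enorm x)
             * (uinf (dilate (/ enorm x) x) + E x))%C /\
      Cmod (E x) <= K / sqrt (enorm x).

Definition is_far_field_pattern (k : R) (Z : disk) (d0 d : R * R)
    (uinf : R * R -> C) : Prop :=
  exists u : R * R -> C,
    is_scattered_field k Z d0 d u /\ has_far_field k u uinf.

(* Main.v *)
Require Import Defs.
From Stdlib Require Import Reals ZArith Lra Lia Psatz Classical.
From Coquelicot Require Import Coquelicot.
Open Scope R_scope.

(** A disk is symmetric about its centre, and everything separates there. The
   Fourier modes of a scattered field, in the angle about the centre [c], obey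
   Bessel's equation. The far field expansion about the origin, moved to [c],
   makes each mode outgoing, that is, asymptotic to a multiple of [exp (i k rho)
   / sqrt rho]; the squared modulus of this amplitude is proportional to the
   Wronskian of the mode with its conjugate, so a mode that is zero on the
   circle has amplitude zero. Thus the amplitudes depend linearly on the boundary values, which are
   Bessel functions because the incident waves are plane. As Fourier
   coefficients determine continuous functions, the pattern at angle [t], for
   incidence at the angles [ph0] and [ph], is, up to a factor of modulus one,
   [exp (i k c.d0) f (t - ph0) + exp (i k c.d) f (t - ph)], with an even profile
   [f] whose coefficients [t_n] depend on [k] and the radius only (lemma
   [far_field_structure]).

   The data therefore amount to [|f|] and, for all angles [s] and [t], to the
   real part of [exp (i g) f s conj (f t)], where [g] is the phase [k c.(d0 -
   d)], a trigonometric polynomial of [s - t] with coefficients given by [c].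
   Suppose two disks have the same data.

   - For [t = - s] the product [f s conj (f t)] is [|f s|^2], so the phases have
     the same cosine, and the centres are equal or opposite
     ([phases_equal_or_opposite]).
   - As [f] is even, replacing [t] by [- t] changes the phase and nothing else,
     and comparing the two equations shows that the real parts of [f s conj (f
     t)] agree ([gram_equal]); hence so do the [|t_n|]. For high [n] this forces
     equal radii ([mode_response_radius]): between two circles, the modulus of
     an outgoing high mode decreases and that of its boundary data increases.
   - Now the profiles are equal. If the centres were opposite and distinct, [f s
     conj (f t)] would be real throughout, and the [t_n] real multiples of one
     another; this would make a Wronskian zero ([mode_response_consecutive]).

   Complex-valued functions are treated as pairs of real ones, as the
   differential equations and the weights [cos (n t + s)] are real. *)

(** * Derivatives and limits at infinity *)

(** The derivation rules with every type equal to [R], so that the equations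
   between derivatives to which they lead are equations of real numbers. *)
Lemma is_derive_Rplus (f g : R -> R) (x df dg : R) :
  is_derive f x df -> is_derive g x dg ->
  is_derive (fun t => f t + g t) x (df + dg).
Proof. exact (@is_derive_plus R_AbsRing R_NormedModule f g x df dg). Qed.

Lemma is_derive_Rminus (f g : R -> R) (x df dg : R) :
  is_derive f x df -> is_derive g x dg ->
  is_derive (fun t => f t - g t) x (df - dg).
Proof. exact (@is_derive_minus R_AbsRing R_NormedModule f g x df dg). Qed.

Lemma is_derive_Rconst (c x : R) : is_derive (fun _ : R => c) x 0.
Proof. exact (@is_derive_const R_AbsRing R_NormedModule c x). Qed.

Lemma is_derive_Rscal (f : R -> R) (x c df : R) :
  is_derive f x df -> is_derive (fun t => c * f t) x (c * df).
Proof. exact (@is_derive_scal f x c df). Qed.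

Lemma is_derive_Rmult (f g : R -> R) (x df dg : R) :
  is_derive f x df -> is_derive g x dg ->
  is_derive (fun t => f t * g t) x (df * g x + f x * dg).
Proof. intros hf hg. apply (@is_derive_mult R_AbsRing f g x df dg hf hg). exact Rmult_comm. Qed.

Lemma is_derive_eq (f : R -> R) (x l l' : R) : is_derive f x l -> l = l' -> is_derive f x l'.
Proof. now intros h <-. Qed.

Lemma mean_value (f f' : R -> R) (a b : R) :
  a < b -> (forall x, a <= x <= b -> is_derive f x (f' x)) ->
  exists c, a < c < b /\ f b - f a = f' c * (b - a).
Proof.
  intros hab hd.
  destruct (MVT_cor2 f f' a b hab) as [c [hc1 hc2]].
  { intros c hc; apply is_derive_Reals; now apply hd. }
  exists c; split; [exact hc2 | exact hc1].
Qed.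

Lemma nondecreasing_of_derive (f f' : R -> R) (a b : R) :
  a <= b -> (forall x, a <= x <= b -> is_derive f x (f' x)) ->
  (forall x, a < x < b -> 0 <= f' x) -> f a <= f b.
Proof.
  intros hab hd hp.
  destruct (Req_dec a b) as [->|hne]; [lra|].
  destruct (mean_value f f' a b) as [c [hc1 hc2]]; [lra|exact hd|].
  pose proof (hp c hc1). nra.
Qed.

Lemma constant_of_derive (f : R -> R) (r x y : R) :
  (forall t, r < t -> is_derive f t 0) -> r < x -> r < y -> f x = f y.
Proof.
  intros hd hx hy.
  assert (H : forall u v, r < u -> u <= v -> f u = f v).
  { intros u v hu huv.
    destruct (Req_dec u v) as [->|hne]; [easy|].
    destruct (mean_value f (fun _ => 0) u v) as [c [_ hc]]; [lra| |lra].
    intros t ht; apply hd; lra. }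
  destruct (Rle_dec x y); [now apply H | symmetry; apply H; lra].
Qed.

Definition vanishes (f : R -> R) : Prop :=
  forall eps, 0 < eps -> exists M, forall x, M < x -> Rabs (f x) < eps.

Lemma vanishes_plus f g : vanishes f -> vanishes g -> vanishes (fun x => f x + g x).
Proof.
  intros hf hg eps heps.
  destruct (hf (eps/2)) as [M1 h1]; [lra|].
  destruct (hg (eps/2)) as [M2 h2]; [lra|].
  exists (Rmax M1 M2). intros x hx.
  pose proof (Rmax_l M1 M2); pose proof (Rmax_r M1 M2).
  pose proof (h1 x ltac:(lra)); pose proof (h2 x ltac:(lra)).
  pose proof (Rabs_triang (f x) (g x)); lra.
Qed.

Lemma vanishes_bounded_mult f g B M0 :
  vanishes f -> (forall x, M0 < x -> Rabs (g x) <= B) ->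
  vanishes (fun x => g x * f x).
Proof.
  intros hf hg eps heps.
  assert (hB : 0 <= Rabs B) by apply Rabs_pos.
  destruct (hf (eps / (Rabs B + 1))) as [M1 h1].
  { apply Rdiv_lt_0_compat; lra. }
  exists (Rmax M0 M1). intros x hx.
  pose proof (Rmax_l M0 M1); pose proof (Rmax_r M0 M1).
  pose proof (h1 x ltac:(lra)) as hx1; pose proof (hg x ltac:(lra)) as hx2.
  rewrite Rabs_mult.
  pose proof (Rle_abs B).
  pose proof (Rabs_pos (f x)); pose proof (Rabs_pos (g x)).
  apply Rle_lt_trans with ((Rabs B + 1) * Rabs (f x)); [nra|].
  apply Rlt_le_trans with ((Rabs B + 1) * (eps / (Rabs B + 1))).
  - apply Rmult_lt_compat_l; lra.
  - right; field; lra.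
Qed.

Lemma vanishes_scal f c : vanishes f -> vanishes (fun x => c * f x).
Proof.
  intros hf. apply (vanishes_bounded_mult f (fun _ => c) (Rabs c) 0 hf).
  intros; lra.
Qed.

Lemma vanishes_ext f g M0 :
  (forall x, M0 < x -> f x = g x) -> vanishes f -> vanishes g.
Proof.
  intros he hf eps heps. destruct (hf eps heps) as [M h].
  exists (Rmax M0 M). intros x hx.
  pose proof (Rmax_l M0 M); pose proof (Rmax_r M0 M).
  rewrite <- he by lra. apply h; lra.
Qed.

Lemma vanishes_const c : vanishes (fun _ => c) -> c = 0.
Proof.
  intros h. destruct (Req_dec c 0) as [|hne]; [easy|exfalso].
  destruct (h (Rabs c)) as [M hM]; [now apply Rabs_pos_lt|].
  specialize (hM (M + 1) ltac:(lra)). lra.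
Qed.

Lemma vanishes_inv : vanishes (fun x => / x).
Proof.
  intros eps heps. exists (1 + / eps). intros x hx.
  assert (0 < / eps) by now apply Rinv_0_lt_compat.
  rewrite Rabs_pos_eq by (apply Rlt_le, Rinv_0_lt_compat; nra).
  rewrite <- (Rinv_inv eps). apply Rinv_lt_contravar; [|lra].
  apply Rmult_lt_0_compat; lra.
Qed.

Lemma vanishes_inv_sq : vanishes (fun x => / x ^ 2).
Proof.
  apply (vanishes_ext (fun x => / x * / x) _ 0); [intros x hx; field; lra|].
  apply (vanishes_bounded_mult _ _ 1 1 vanishes_inv). intros x hx.
  rewrite Rabs_pos_eq by (apply Rlt_le, Rinv_0_lt_compat; lra).
  rewrite <- Rinv_1. apply Rinv_le_contravar; lra.
Qed.

Lemma bounded_of_vanishes f g B :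
  vanishes (fun x => f x - g x) -> (forall x, Rabs (g x) <= B) ->
  exists M, forall x, M < x -> Rabs (f x) <= B + 1.
Proof.
  intros hv hg. destruct (hv 1 ltac:(lra)) as [M hM].
  exists M; intros x hx. specialize (hM x hx); specialize (hg x).
  replace (f x) with ((f x - g x) + g x) by ring.
  pose proof (Rabs_triang (f x - g x) (g x)). lra.
Qed.

(** Landau's interpolation: by the mean value theorem, [w1] at some point of [x,
   x + 1] is a difference of values of [w], and it differs from [w1 x] by at
   most a value of [w2]. *)
Lemma vanishes_derive (w w1 w2 : R -> R) (r : R) :
  (forall x, r < x -> is_derive w x (w1 x)) ->
  (forall x, r < x -> is_derive w1 x (w2 x)) ->
  vanishes w -> vanishes w2 -> vanishes w1.
Proof.
  intros hd1 hd2 hw hw2 eps heps.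
  destruct (hw (eps/4)) as [M1 h1]; [lra|].
  destruct (hw2 (eps/4)) as [M2 h2]; [lra|].
  exists (Rmax r (Rmax M1 M2)). intros x hx.
  pose proof (Rmax_l r (Rmax M1 M2)); pose proof (Rmax_r r (Rmax M1 M2)).
  pose proof (Rmax_l M1 M2); pose proof (Rmax_r M1 M2).
  destruct (mean_value w w1 x (x+1)) as [c [hc1 hc2]]; [lra|intros; apply hd1; lra|].
  destruct (mean_value w1 w2 x c) as [c' [hc1' hc2']]; [lra|intros; apply hd2; lra|].
  pose proof (h1 x ltac:(lra)) as e1; pose proof (h1 (x+1) ltac:(lra)) as e2.
  pose proof (h2 c' ltac:(lra)) as e3.
  apply Rabs_def2 in e1; apply Rabs_def2 in e2; apply Rabs_def2 in e3.
  assert (w1 x = w (x+1) - w x - w2 c' * (c - x)) by lra.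
  assert (Rabs (w2 c' * (c - x)) < eps / 4).
  { rewrite Rabs_mult. rewrite (Rabs_pos_eq (c - x)) by lra.
    pose proof (h2 c' ltac:(lra)). pose proof (Rabs_pos (w2 c')). nra. }
  apply Rabs_def2 in H4. apply Rabs_def1; lra.
Qed.

(** * Outgoing solutions of the radial equation *)

Lemma vanishes_mult_approx f g h l B C :
  vanishes (fun x => f x - g x) -> vanishes (fun x => h x - l x) ->
  (forall x, Rabs (g x) <= B) -> (forall x, Rabs (l x) <= C) ->
  vanishes (fun x => f x * h x - g x * l x).
Proof.
  intros hf hh hg hl.
  destruct (bounded_of_vanishes _ _ _ hh hl) as [M hM].
  apply (vanishes_ext (fun x => h x * (f x - g x) + g x * (h x - l x)) _ 0).
  { intros; ring. }
  apply vanishes_plus.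
  - now apply (vanishes_bounded_mult _ _ (C+1) M).
  - apply (vanishes_bounded_mult _ _ B 0); auto.
Qed.

Lemma trig_bound al be x : Rabs (al * cos x + be * sin x) <= Rabs al + Rabs be.
Proof.
  eapply Rle_trans; [apply Rabs_triang|]. rewrite !Rabs_mult.
  assert (Rabs (cos x) <= 1) by (apply Rabs_le, COS_bound).
  assert (Rabs (sin x) <= 1) by (apply Rabs_le, SIN_bound).
  pose proof (Rabs_pos al); pose proof (Rabs_pos be). nra.
Qed.

(** Liouville's form [y'' + potential y = 0] of Bessel's equation of order [n],
   obeyed by [sqrt rho] times a radial mode; hence the quarter. *)
Definition potential (k n rho : R) : R := k ^ 2 - (n ^ 2 - / 4) / rho ^ 2.

Lemma potential_vanishes k n : vanishes (fun x => potential k n x - k^2).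
Proof.
  apply (vanishes_ext (fun x => (- (n^2 - /4)) * / x^2) _ 1).
  - intros x hx. unfold potential. field. lra.
  - apply vanishes_scal, vanishes_inv_sq.
Qed.

Lemma potential_bounded k n r x :
  0 < r -> r <= x -> Rabs (potential k n x) <= k^2 + Rabs (n^2 - /4) / r^2.
Proof.
  intros hr hx. unfold potential.
  eapply Rle_trans; [apply Rabs_triang|]. rewrite Rabs_Ropp.
  rewrite (Rabs_pos_eq (k^2)) by nra. apply Rplus_le_compat_l.
  unfold Rdiv. rewrite Rabs_mult. apply Rmult_le_compat_l; [apply Rabs_pos|].
  rewrite Rabs_pos_eq by (apply Rlt_le, Rinv_0_lt_compat; nra).
  apply Rinv_le_contravar; nra.
Qed.

Definition solves (k n r : R) (y y1 : R -> R) : Prop :=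
  forall rho, r < rho ->
    is_derive y rho (y1 rho) /\ is_derive y1 rho (- potential k n rho * y rho).

(** [a + i b] is asymptotic to [(fr + i fi) exp (i k rho)]. The derivatives [a1],
   [b1] are kept because the invariants below, Wronskian and energy, involve
   them. *)
Record outgoing (k n r : R) (a a1 b b1 : R -> R) (fr fi : R) : Prop := {
  og_re : solves k n r a a1;
  og_im : solves k n r b b1;
  og_lim_re : vanishes (fun x => a x - (fr * cos (k * x) - fi * sin (k * x)));
  og_lim_im : vanishes (fun x => b x - (fr * sin (k * x) + fi * cos (k * x))) }.

(** The asymptotics can be differentiated: the remainder satisfies [w'' = - k^2 w
   + O(rho^-2)], so [vanishes_derive] applies to it. *)
Lemma solves_asymptotic_derive k n r y y1 al be :
  0 <= r -> solves k n r y y1 ->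
  vanishes (fun x => y x - (al * cos (k * x) + be * sin (k * x))) ->
  vanishes (fun x => y1 x - k * (be * cos (k * x) - al * sin (k * x))).
Proof.
  intros hr hs hv.
  apply (vanishes_derive (fun x => y x - (al * cos (k * x) + be * sin (k * x)))
    (fun x => y1 x - k * (be * cos (k * x) - al * sin (k * x)))
    (fun x => - potential k n x * y x + k^2 * (al * cos (k * x) + be * sin (k * x))) r).
  - intros x hx. destruct (hs x hx) as [h1 _].
    apply is_derive_Rminus; [exact h1|].
    auto_derive; [easy|]. ring.
  - intros x hx. destruct (hs x hx) as [_ h2].
    eapply is_derive_eq.
    + apply is_derive_Rminus; [exact h2|]. auto_derive; [easy|reflexivity].
    + ring.
  - exact hv.
  - destruct (bounded_of_vanishes _ _ _ hv (fun x => trig_bound al be (k * x))) as [M hM].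
    apply (vanishes_ext (fun x => (-k^2) * (y x - (al * cos (k * x) + be * sin (k * x)))
             + y x * ((n^2 - /4) * / x^2)) _ r).
    { intros x hx. unfold potential. field. lra. }
    apply vanishes_plus; [now apply vanishes_scal|].
    apply (vanishes_bounded_mult _ _ (Rabs al + Rabs be + 1) M); [|exact hM].
    apply vanishes_scal, vanishes_inv_sq.
Qed.

Lemma outgoing_lim_re1 k n r a a1 b b1 fr fi :
  0 <= r -> outgoing k n r a a1 b b1 fr fi ->
  vanishes (fun x => a1 x - - k * (fr * sin (k * x) + fi * cos (k * x))).
Proof.
  intros hr [h1 _ h3 _].
  apply (vanishes_ext (fun x => a1 x - k * ((-fi) * cos (k*x) - fr * sin (k * x))) _ 0).
  { intros; ring. }
  apply (solves_asymptotic_derive k n r a a1 fr (- fi)); auto.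
  refine (vanishes_ext _ _ 0 _ h3); intros; simpl; ring.
Qed.

Lemma outgoing_lim_im1 k n r a a1 b b1 fr fi :
  0 <= r -> outgoing k n r a a1 b b1 fr fi ->
  vanishes (fun x => b1 x - k * (fr * cos (k * x) - fi * sin (k * x))).
Proof.
  intros hr [_ h2 _ h4].
  apply (solves_asymptotic_derive k n r b b1 fi fr); auto.
  refine (vanishes_ext _ _ 0 _ h4); intros; simpl; ring.
Qed.

(** The equation is real, so complex combinations of solutions, with coefficients
   [x + i y] and [x' + i y'], are again solutions. *)
Lemma outgoing_lin k n r a a1 b b1 fr fi a' a1' b' b1' fr' fi' x y x' y' :
  outgoing k n r a a1 b b1 fr fi -> outgoing k n r a' a1' b' b1' fr' fi' ->
  outgoing k n r
    (fun t => (x * a t - y * b t) + (x' * a' t - y' * b' t))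
    (fun t => (x * a1 t - y * b1 t) + (x' * a1' t - y' * b1' t))
    (fun t => (x * b t + y * a t) + (x' * b' t + y' * a' t))
    (fun t => (x * b1 t + y * a1 t) + (x' * b1' t + y' * a1' t))
    ((x * fr - y * fi) + (x' * fr' - y' * fi'))
    ((x * fi + y * fr) + (x' * fi' + y' * fr')).
Proof.
  assert (L4 : forall f g h l f' g' h' l' u v w z t, 
    is_derive f t f' -> is_derive g t g' -> is_derive h t h' -> is_derive l t l' ->
    is_derive (fun t => (u * f t + v * g t) + (w * h t + z * l t)) t
      ((u * f' + v * g') + (w * h' + z * l'))).
  { intros. apply is_derive_Rplus; apply is_derive_Rplus; now apply is_derive_Rscal. }
  assert (S4 : forall f g h l f' g' h' l' u v w z, 
    solves k n r f f' -> solves k n r g g' -> solves k n r h h' -> solves k n r l l' ->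
    solves k n r (fun t => (u * f t + v * g t) + (w * h t + z * l t)) 
      (fun t => (u * f' t + v * g' t) + (w * h' t + z * l' t))).
  { intros f g h l f' g' h' l' u v w z h1 h2 h3 h4 t ht.
    destruct (h1 t ht), (h2 t ht), (h3 t ht), (h4 t ht). split; [now apply L4|].
    replace (- _ * _) with ((u * (- potential k n t * f t) + v * (- potential k n t * g t)) +
       (w * (- potential k n t * h t) + z * (- potential k n t * l t))) by ring.
    now apply L4. }
  assert (V4 : forall f g h l u v w z, vanishes f -> vanishes g -> vanishes h -> vanishes l ->
    vanishes (fun t => (u * f t + v * g t) + (w * h t + z * l t))).
  { intros. apply vanishes_plus; apply vanishes_plus; now apply vanishes_scal. }
  assert (SE : forall f f' g g', (forall t, f t = f' t) -> (forall t, g t = g' t) -> 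
     solves k n r f g -> solves k n r f' g').
  { intros f f' g g' h1 h2 hs t ht. destruct (hs t ht) as [e1 e2]. split.
    - rewrite <- h2. eapply is_derive_ext; [exact h1|exact e1].
    - rewrite <- h1. eapply is_derive_ext; [exact h2|exact e2]. }
  intros [r1 i1 lr1 li1] [r2 i2 lr2 li2].
  split.
  - eapply (SE _ _ _ _); [| |exact (S4 a b a' b' a1 b1 a1' b1' x (-y) x' (-y') r1 i1 r2 i2)]; intros; simpl; ring.
  - eapply (SE _ _ _ _); [| |exact (S4 b a b' a' b1 a1 b1' a1' x y x' y' i1 r1 i2 r2)]; intros; simpl; ring.
  - eapply (vanishes_ext _ _ 0); [|exact (V4 _ _ _ _ x (-y) x' (-y') lr1 li1 lr2 li2)]; intros; simpl; ring.
  - eapply (vanishes_ext _ _ 0); [|exact (V4 _ _ _ _ x y x' y' li1 lr1 li2 lr2)]; intros; simpl; ring.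
Qed.

Lemma wave_bounds k fr fi x :
  let B := Rabs fr + Rabs fi in
  Rabs (fr * cos (k * x) - fi * sin (k * x)) <= B /\ Rabs (fr * sin (k * x) + fi * cos (k * x)) <= B /\
  Rabs (k * (fr * cos (k * x) - fi * sin (k * x))) <= Rabs k * B /\
  Rabs (- k * (fr * sin (k * x) + fi * cos (k * x))) <= Rabs k * B.
Proof.
  intros B.
  pose proof (trig_bound fr (- fi) (k * x)) as h. rewrite Rabs_Ropp in h.
  pose proof (trig_bound fi fr (k * x)) as h'.
  replace (fr * cos (k * x) + - fi * sin (k * x)) with (fr * cos (k * x) - fi * sin (k * x)) in h by ring.
  rewrite (Rplus_comm (fi * _)) in h'.
  assert (h'' : Rabs (fr * sin (k * x) + fi * cos (k * x)) <= B) by (unfold B; lra).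
  rewrite !Rabs_mult, Rabs_Ropp.
  repeat split; auto; apply Rmult_le_compat_l; auto using Rabs_pos.
Qed.

(** The Wronskian of [a + i b] with its conjugate is constant, and its value can
   be read off at infinity: it is the flux carried by the amplitude. *)
Lemma outgoing_wronskian k n r a a1 b b1 fr fi rho :
  0 <= r -> outgoing k n r a a1 b b1 fr fi -> r < rho ->
  a rho * b1 rho - a1 rho * b rho = k * (fr ^ 2 + fi ^ 2).
Proof.
  intros hr ho hrho.
  pose proof (outgoing_lim_re1 _ _ _ _ _ _ _ _ _ hr ho) as l1.
  pose proof (outgoing_lim_im1 _ _ _ _ _ _ _ _ _ hr ho) as l2.
  destruct ho as [sa sb la lb].
  set (W := fun t => a t * b1 t - a1 t * b t).
  assert (hW : forall t, r < t -> is_derive W t 0).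
  { intros t ht. destruct (sa t ht) as [p1 p2], (sb t ht) as [p3 p4]. unfold W.
    eapply is_derive_eq; [apply is_derive_Rminus; apply is_derive_Rmult;
      [exact p1|exact p4|exact p2|exact p3]|].
    ring. }
  assert (hl : vanishes (fun t => W t - k * (fr ^2 + fi^2))).
  { pose proof (wave_bounds k fr fi) as B. cbv zeta in B.
    pose proof (fun x => proj1 (B x)) as B1. pose proof (fun x => proj1 (proj2 (B x))) as B2.
    pose proof (fun x => proj1 (proj2 (proj2 (B x)))) as B3. pose proof (fun x => proj2 (proj2 (proj2 (B x)))) as B4.
    pose proof (vanishes_mult_approx _ _ _ _ _ _ la l2 B1 B3) as v1.
    pose proof (vanishes_mult_approx _ _ _ _ _ _ l1 lb B4 B2) as v2.
    eapply (vanishes_ext _ _ 0); [|exact (vanishes_plus _ _ v1 (vanishes_scal _ (-1) v2))].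
    intros x _. unfold W. cbv beta.
    pose proof (sin2_cos2 (k * x)) as e. unfold Rsqr in e.
    replace (fr^2 + fi^2) with ((fr^2 + fi^2) * (sin (k * x) * sin (k * x) + cos (k * x) * cos (k * x)))
      by (rewrite e; ring). ring. }
  change (W rho = k * (fr^2 + fi^2)).
  assert (W rho - k * (fr^2 + fi^2) = 0); [|lra].
  apply vanishes_const.
  eapply (vanishes_ext _ _ r); [|exact hl]. intros x hx. cbv beta. f_equal.
  now apply (constant_of_derive W r).
Qed.

(** The modes solve their equation outside the disk only; their boundary values
   are one-sided limits. *)
Definition right_continuous (f : R -> R) (r : R) : Prop :=
  forall eps, 0 < eps -> exists delta, 0 < delta /\
    forall x, r < x < r + delta -> Rabs (f x - f r) < eps.

(** The equation bounds the second derivative near the boundary, so the first one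
   cannot blow up there. *)
Lemma derive_bounded_near k n r y y1 :
  0 < r -> solves k n r y y1 -> right_continuous y r ->
  exists delta C, 0 < delta /\ forall x, r < x < r + delta -> Rabs (y1 x) <= C.
Proof.
  intros hr hs hc.
  destruct (hc 1 ltac:(lra)) as [d [hd hy]].
  set (Q := k^2 + Rabs (n^2 - /4) / r^2).
  assert (hQ : forall x, r < x -> Rabs (potential k n x) <= Q).
  { intros x hx. apply potential_bounded; lra. }
  assert (hQ0 : 0 <= Q).
  { eapply Rle_trans; [apply Rabs_pos|apply (hQ (r+1)); lra]. }
  exists (d/2), (Rabs (y1 (r + d/2)) + Q * (Rabs (y r) + 1) * d). split; [lra|].
  intros x hx.
  destruct (mean_value y1 (fun t => - potential k n t * y t) x (r + d/2)) as [c [hc1 hc2]]; [lra| |].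
  { intros t ht. apply hs; lra. }
  assert (hyc : Rabs (y c) <= Rabs (y r) + 1).
  { replace (y c) with ((y c - y r) + y r) by ring.
    eapply Rle_trans; [apply Rabs_triang|]. pose proof (hy c ltac:(lra)). lra. }
  replace (y1 x) with (y1 (r + d/2) + potential k n c * y c * (r + d/2 - x)) by lra.
  eapply Rle_trans; [apply Rabs_triang|]. apply Rplus_le_compat_l.
  rewrite !Rabs_mult. rewrite (Rabs_pos_eq (r + d/2 - x)) by lra.
  apply Rmult_le_compat; try lra.
  - apply Rmult_le_pos; apply Rabs_pos.
  - apply Rmult_le_compat; auto using Rabs_pos. apply hQ; lra.
Qed.

(** Uniqueness for the exterior Dirichlet problem, one mode at a time: as the
   solution tends to zero at the boundary and its derivative stays bounded, the
   Wronskian, which is the flux, is zero. *)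
Lemma far_zero_of_boundary_zero k n r a a1 b b1 fr fi :
  0 < k -> 0 < r -> outgoing k n r a a1 b b1 fr fi ->
  right_continuous a r -> right_continuous b r -> a r = 0 -> b r = 0 ->
  fr = 0 /\ fi = 0.
Proof.
  intros hk hr ho ca cb ha hb.
  assert (hW : fr^2 + fi^2 = 0); [|split; nra].
  destruct (Req_dec (fr^2 + fi^2) 0) as [|hne]; [easy|exfalso].
  set (W := k * (fr^2+fi^2)).
  assert (hW : 0 < W) by (unfold W; nra).
  destruct (derive_bounded_near _ _ _ _ _ hr (og_re _ _ _ _ _ _ _ _ _ ho) ca) as [d1 [C1 [hd1 h1]]].
  destruct (derive_bounded_near _ _ _ _ _ hr (og_im _ _ _ _ _ _ _ _ _ ho) cb) as [d2 [C2 [hd2 h2]]].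
  set (C := Rabs C1 + Rabs C2 + 1).
  assert (hC : 0 < C) by (unfold C; pose proof (Rabs_pos C1); pose proof (Rabs_pos C2); lra).
  set (eps := W / (2 * C)).
  assert (heps : 0 < eps) by (apply Rdiv_lt_0_compat; lra).
  destruct (ca eps heps) as [d3 [hd3 h3]]. destruct (cb eps heps) as [d4 [hd4 h4]].
  set (d := Rmin (Rmin d1 d2) (Rmin d3 d4)).
  assert (0 < d) by (unfold d; repeat apply Rmin_pos; lra).
  assert (d <= d1 /\ d <= d2 /\ d <= d3 /\ d <= d4) as (e1 & e2 & e3 & e4).
  { unfold d. pose proof (Rmin_l (Rmin d1 d2) (Rmin d3 d4)); pose proof (Rmin_r (Rmin d1 d2) (Rmin d3 d4)).
    pose proof (Rmin_l d1 d2); pose proof (Rmin_r d1 d2);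
    pose proof (Rmin_l d3 d4); pose proof (Rmin_r d3 d4). lra. }
  set (x := r + d/2).
  pose proof (outgoing_wronskian _ _ _ _ _ _ _ _ _ x (Rlt_le _ _ hr) ho ltac:(unfold x; lra)) as w.
  fold W in w.
  specialize (h1 x ltac:(unfold x; lra)); specialize (h2 x ltac:(unfold x; lra)).
  specialize (h3 x ltac:(unfold x; lra)); specialize (h4 x ltac:(unfold x; lra)).
  rewrite ha, Rminus_0_r in h3; rewrite hb, Rminus_0_r in h4.
  assert (Rabs (a x * b1 x - a1 x * b x) < W); [|rewrite w, Rabs_pos_eq in H0; lra].
  eapply Rle_lt_trans; [apply Rabs_triang|]. rewrite Rabs_Ropp, !Rabs_mult.
  assert (W = eps * C + eps * C) by (unfold eps; field; lra).
  assert (Rabs (b1 x) < C) by (unfold C; pose proof (Rle_abs C2); pose proof (Rabs_pos C1); lra).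
  assert (Rabs (a1 x) < C) by (unfold C; pose proof (Rle_abs C1); pose proof (Rabs_pos C2); lra).
  pose proof (Rabs_pos (a x)); pose proof (Rabs_pos (b x));
  pose proof (Rabs_pos (a1 x)); pose proof (Rabs_pos (b1 x)). nra.
Qed.

(** * Energy, and decay of high modes *)

Lemma le_of_vanishes f l c M0 :
  (forall x, M0 < x -> c <= f x) -> vanishes (fun x => f x - l) -> c <= l.
Proof.
  intros h hv. apply Rnot_lt_le; intros hlt.
  destruct (hv (c - l)) as [M hM]; [lra|].
  pose proof (Rmax_l M0 M); pose proof (Rmax_r M0 M).
  specialize (hM (Rmax M0 M + 1) ltac:(lra)). specialize (h (Rmax M0 M + 1) ltac:(lra)).
  apply Rabs_def2 in hM. lra.
Qed.

Definition energy (k n : R) (y y1 : R -> R) (x : R) : R :=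
  y1 x ^ 2 + potential k n x * y x ^ 2.

(** The potential increases with the radius, so the energy of a solution does;
   the potential of mode zero decreases, hence the bound on [n]. *)
Lemma energy_nondecreasing k n r y y1 s t :
  0 <= r -> 1 <= n -> solves k n r y y1 -> r < s -> s <= t ->
  energy k n y y1 s <= energy k n y y1 t.
Proof.
  intros hr hn hs hrs hst.
  apply (nondecreasing_of_derive _ (fun x => 2 * (n^2 - /4) / x^3 * y x ^ 2)); [exact hst| |].
  - intros x hx. destruct (hs x ltac:(lra)) as [d1 d2]. unfold energy.
    eapply is_derive_eq.
    + apply is_derive_Rplus.
      * apply (is_derive_ext (fun x => y1 x * y1 x)); [intros; simpl; ring|].
        apply is_derive_Rmult; exact d2.
      * apply is_derive_Rmult.
        -- unfold potential. auto_derive; [|reflexivity]. nra.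
        -- apply (is_derive_ext (fun x => y x * y x)); [intros; simpl; ring|].
           apply is_derive_Rmult; exact d1.
    + unfold potential. field. lra.
  - intros x hx. apply Rmult_le_pos; [|nra]. apply Rmult_le_pos; [nra|].
    apply Rlt_le, Rinv_0_lt_compat, pow_lt; lra.
Qed.

(** Uniqueness for the Cauchy problem towards smaller radii, by Gronwall. *)
Lemma solves_zero_backward k n r y y1 t :
  0 <= r -> solves k n r y y1 -> r < t -> y t = 0 -> y1 t = 0 ->
  forall x, r < x -> x <= t -> y x = 0.
Proof.
  intros hr hs hrt h0 h1 s hrs hst.
  set (Q := k^2 + Rabs (n^2 - /4) / s^2).
  set (L := 1 + Q).
  set (S := fun x => (y x ^2 + y1 x ^2) * exp (L * x)).
  assert (hS : S s <= S t).
  { apply (nondecreasing_of_derive S (fun x =>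
      (2 * y x * y1 x + 2 * y1 x * (- potential k n x * y x) + L * (y x ^2 + y1 x ^2)) * exp (L * x)));
      [exact hst| |].
    - intros x hx. destruct (hs x ltac:(lra)) as [d1 d2]. unfold S.
      eapply is_derive_eq.
      + apply is_derive_Rmult.
        * apply is_derive_Rplus.
          -- apply (is_derive_ext (fun x => y x * y x)); [intros; simpl; ring|].
             apply is_derive_Rmult; exact d1.
          -- apply (is_derive_ext (fun x => y1 x * y1 x)); [intros; simpl; ring|].
             apply is_derive_Rmult; exact d2.
        * auto_derive; [easy|reflexivity].
      + cbv beta. ring.
    - intros x hx. apply Rmult_le_pos; [|apply Rlt_le, exp_pos].
      pose proof (potential_bounded k n s x ltac:(lra) ltac:(lra)) as hq. fold Q in hq.
      apply Rabs_le_between in hq.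
      set (p := potential k n x) in *. unfold L.
      set (u := y x) in *. set (v := y1 x) in *.
      assert (0 <= (u + v)^2) by apply pow2_ge_0.
      assert (0 <= (u - v)^2) by apply pow2_ge_0.
      assert (0 <= Q) by lra.
      assert (0 <= (Q - p) * (u+v)^2) by (apply Rmult_le_pos; lra).
      assert (0 <= (Q + p) * (u-v)^2) by (apply Rmult_le_pos; lra).
      nra. }
  unfold S in hS. rewrite h0, h1 in hS.
  pose proof (exp_pos (L * s)). 
  assert (y s ^2 + y1 s ^2 <= 0); [|nra].
  apply Rnot_lt_le; intro. assert (0 < (y s ^ 2 + y1 s ^ 2) * exp (L * s)) by now apply Rmult_lt_0_compat.
  nra.
Qed.

(** Rellich's lemma for a single mode: the nondecreasing energy tends to zero,
   hence is nonpositive; where the potential is positive this forces the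
   solution to vanish. *)
Lemma solves_zero_of_vanishes k n r y y1 :
  0 < k -> 0 <= r -> 1 <= n -> solves k n r y y1 -> vanishes y ->
  forall x, r < x -> y x = 0.
Proof.
  intros hk hr hn hs hv.
  assert (hv1 : vanishes y1).
  { refine (vanishes_ext _ _ 0 _ (solves_asymptotic_derive k n r y y1 0 0 hr hs _)).
    - intros; simpl; ring.
    - refine (vanishes_ext _ _ 0 _ hv). intros; ring. }
  assert (hE : vanishes (fun x => energy k n y y1 x - 0)).
  { refine (vanishes_ext _ _ 0 _ (vanishes_plus _ _ 
      (vanishes_mult_approx y1 (fun _ => 0) y1 (fun _ => 0) 0 0 _ _ _ _)
      (vanishes_bounded_mult _ (potential k n) _ 1 
      (vanishes_mult_approx y (fun _ => 0) y (fun _ => 0) 0 0 _ _ _ _) _)));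
    try (intros; rewrite Rabs_R0; lra); try (refine (vanishes_ext _ _ 0 _ hv1); intros; ring);
    try (refine (vanishes_ext _ _ 0 _ hv); intros; ring).
    - intros; unfold energy; ring.
    - intros x hx. apply (potential_bounded k n 1); lra. }
  assert (hle : forall x, r < x -> energy k n y y1 x <= 0).
  { intros x hx. apply (le_of_vanishes (energy k n y y1) 0 _ x); [|exact hE].
    intros t ht. apply (energy_nondecreasing k n r); auto; lra. }
  assert (hz : forall x, r < x -> n / k < x -> y x = 0 /\ y1 x = 0).
  { intros x hx1 hx2. specialize (hle x hx1). unfold energy in hle.
    assert (hx0 : 0 < x) by lra.
    assert (hq : 0 < potential k n x).
    { unfold potential. apply (Rmult_lt_reg_r (x^2)); [nra|].
      replace ((k ^ 2 - (n ^ 2 - / 4) / x ^ 2) * x^2) with ((k * x) ^2 - n^2 + / 4) by (field; lra).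
      assert (n < k * x). { apply (Rmult_lt_compat_l k) in hx2; [|easy]. replace (k * (n / k)) with n in hx2 by (field; lra). easy. }
      nra. }
    assert (0 <= y x ^2) by apply pow2_ge_0.
    assert (0 <= y1 x ^2) by apply pow2_ge_0.
    assert (y x ^2 = 0) by nra. split; nra. }
  intros x hx.
  set (t := Rmax x (n / k) + 1).
  assert (x < t /\ n / k < t) as [e1 e2].
  { unfold t. pose proof (Rmax_l x (n/k)); pose proof (Rmax_r x (n/k)). lra. }
  destruct (hz t ltac:(lra) e2) as [z1 z2].
  apply (solves_zero_backward k n r y y1 t); auto; lra.
Qed.

Lemma zero_of_far_zero k n r a a1 b b1 :
  0 < k -> 0 <= r -> 1 <= n -> outgoing k n r a a1 b b1 0 0 ->
  forall x, r < x -> a x = 0 /\ b x = 0.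
Proof.
  intros hk hr hn [sa sb la lb] x hx. split.
  - apply (solves_zero_of_vanishes k n r a a1); auto.
    refine (vanishes_ext _ _ 0 _ la). intros; ring.
  - apply (solves_zero_of_vanishes k n r b b1); auto.
    refine (vanishes_ext _ _ 0 _ lb). intros; ring.
Qed.

(** The energy increases to its limit, that of [exp (i k rho)]. *)
Lemma outgoing_energy_le k n r a a1 b b1 fr fi x :
  0 <= r -> 1 <= n -> outgoing k n r a a1 b b1 fr fi -> r < x ->
  energy k n a a1 x + energy k n b b1 x <= 2 * k^2 * (fr^2 + fi^2).
Proof.
  intros hr hn ho hx.
  pose proof (outgoing_lim_re1 _ _ _ _ _ _ _ _ _ hr ho) as l1.
  pose proof (outgoing_lim_im1 _ _ _ _ _ _ _ _ _ hr ho) as l2.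
  destruct ho as [sa sb la lb].
  apply (le_of_vanishes (fun t => energy k n a a1 t + energy k n b b1 t) _ _ x).
  { intros t ht. apply Rplus_le_compat; apply (energy_nondecreasing k n r); auto; lra. }
  set (B := Rabs fr + Rabs fi). pose proof (wave_bounds k fr fi) as W. cbv zeta in W. fold B in W.
  pose proof (fun x => proj1 (W x)) as B1. pose proof (fun x => proj1 (proj2 (W x))) as B2.
  pose proof (fun x => proj1 (proj2 (proj2 (W x)))) as B3. pose proof (fun x => proj2 (proj2 (proj2 (W x)))) as B4.
  pose proof (vanishes_mult_approx _ _ _ _ _ _ l1 l1 B4 B4) as v1.
  pose proof (vanishes_mult_approx _ _ _ _ _ _ l2 l2 B3 B3) as v2.
  pose proof (vanishes_mult_approx _ _ _ _ _ _ la la B1 B1) as v3.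
  pose proof (vanishes_mult_approx _ _ _ _ _ _ lb lb B2 B2) as v4.
  assert (K1 : forall x, Rabs ((fun _ : R => k^2) x) <= k^2).
  { intros _; rewrite Rabs_pos_eq; nra. }
  assert (K2 : forall x, Rabs ((fr * cos (k * x) - fi * sin (k * x)) * (fr * cos (k * x) - fi * sin (k * x))) <= B * B).
  { intros t. rewrite Rabs_mult. apply Rmult_le_compat; auto using Rabs_pos. }
  assert (K3 : forall x, Rabs ((fr * sin (k * x) + fi * cos (k * x)) * (fr * sin (k * x) + fi * cos (k * x))) <= B * B).
  { intros t. rewrite Rabs_mult. apply Rmult_le_compat; auto using Rabs_pos. }
  pose proof (vanishes_mult_approx _ (fun _ : R => k^2) _ _ _ _ (potential_vanishes k n) v3 K1 K2) as v5.
  pose proof (vanishes_mult_approx _ (fun _ : R => k^2) _ _ _ _ (potential_vanishes k n) v4 K1 K3) as v6.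
  refine (vanishes_ext _ _ 0 _ (vanishes_plus _ _ (vanishes_plus _ _ v1 v2) (vanishes_plus _ _ v5 v6))).
  intros t _. unfold energy. cbv beta.
  pose proof (sin2_cos2 (k * t)) as e. unfold Rsqr in e.
  replace (2 * k^2 * (fr^2 + fi^2)) with (2 * k^2 * (fr^2 + fi^2) * (sin (k * t) * sin (k * t) + cos (k * t) * cos (k * t)))
    by (rewrite e; ring). ring.
Qed.

Definition sqmod (a b : R -> R) (x : R) : R := a x ^ 2 + b x ^ 2.

Lemma convex_step p p1 p2 x M :
  (forall t, x <= t <= x + 1 -> is_derive p t (p1 t)) ->
  (forall t, x <= t <= x + 1 -> is_derive p1 t (p2 t)) ->
  (forall t, x <= t <= x + 1 -> M <= p2 t) -> 0 <= p1 x ->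
  p x + M / 2 <= p (x + 1) /\ M <= p1 (x + 1).
Proof.
  intros h1 h2 hM h0.
  assert (A : forall t, x <= t <= x + 1 -> M * (t - x) <= p1 t).
  { intros t ht.
    assert (p1 x - M * (x - x) <= p1 t - M * (t - x)); [|lra].
    apply (nondecreasing_of_derive (fun s => p1 s - M * (s - x)) (fun s => p2 s - M)); [lra| |].
    - intros s hs. apply is_derive_Rminus; [apply h2; lra|].
      auto_derive; [easy|ring].
    - intros s hs. specialize (hM s ltac:(lra)). lra. }
  split.
  - assert (p x - M * (x - x)^2 / 2 <= p (x+1) - M * (x + 1 - x)^2 / 2); [|lra].
    apply (nondecreasing_of_derive (fun s => p s - M * (s - x)^2 / 2) (fun s => p1 s - M * (s - x))); [lra| |].
    + intros s hs. apply is_derive_Rminus; [apply h1; lra|].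
      auto_derive; [easy|field].
    + intros s hs. specialize (A s ltac:(lra)). lra.
  - specialize (A (x+1) ltac:(lra)). lra.
Qed.

(** The squared modulus [p] of an outgoing mode is convex up to the turning point
   [T], the zero of the potential. It is shown that a high mode decreases near
   the disk: if [p] had begun to increase at [R], then at [T] it would exceed a
   multiple of [n^3] (lemma [sqmod_grows]), but it is at most a multiple of
   [n^2] (lemma [sqmod_turning_le]). *)
Section SquaredModulus.
Variables (k n r : R) (a a1 b b1 : R -> R) (fr fi : R).
Hypothesis hk : 0 < k.
Hypothesis hr : 0 <= r.
Hypothesis hn : 1 <= n.
Hypothesis ho : outgoing k n r a a1 b b1 fr fi.

Let p := sqmod a b.
Let p1 x := 2 * (a x * a1 x + b x * b1 x).
Let p2 x := 2 * (a1 x ^ 2 + b1 x ^ 2) - 2 * potential k n x * p x.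
Let F := fr ^ 2 + fi ^ 2.

Lemma sqmod_derive x : r < x -> is_derive p x (p1 x).
Proof.
  intros hx. destruct (og_re _ _ _ _ _ _ _ _ _ ho x hx) as [d1 _].
  destruct (og_im _ _ _ _ _ _ _ _ _ ho x hx) as [d2 _].
  apply (is_derive_ext (fun x => a x * a x + b x * b x)); [intros; unfold p, sqmod; simpl; ring|].
  eapply is_derive_eq.
  - apply is_derive_Rplus; apply is_derive_Rmult; eassumption.
  - unfold p1; ring.
Qed.

Lemma sqmod_derive2 x : r < x -> is_derive p1 x (p2 x).
Proof.
  intros hx. destruct (og_re _ _ _ _ _ _ _ _ _ ho x hx) as [d1 d2].
  destruct (og_im _ _ _ _ _ _ _ _ _ ho x hx) as [d3 d4].
  eapply is_derive_eq.
  - apply is_derive_Rscal. apply is_derive_Rplus; apply is_derive_Rmult; eassumption.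
  - unfold p2, p, sqmod; ring.
Qed.

Let T := sqrt (n^2 - /4) / k.

Lemma turning_sq : T ^ 2 = (n^2 - /4) / k^2.
Proof.
  unfold T. replace ((sqrt (n ^ 2 - / 4) / k) ^ 2) with ((sqrt (n ^ 2 - / 4))^2 / k^2) by (field; lra).
  rewrite pow2_sqrt; [easy|nra].
Qed.

Lemma turning_pos : 0 < T.
Proof. apply Rdiv_lt_0_compat; [apply sqrt_lt_R0; nra|easy]. Qed.

Lemma potential_turning x : 0 < x -> potential k n x = k^2 * (1 - T^2 / x^2).
Proof. intros hx. rewrite turning_sq. unfold potential. field. lra. Qed.

Lemma le_turning (R : R) : 0 < R -> 2 * k * R <= n -> R <= T.
Proof.
  intros hR hnR. apply Rnot_lt_le; intro hlt.
  pose proof turning_pos as hT. pose proof turning_sq as hT2.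
  assert (h : k^2 * T^2 < k^2 * R^2) by (apply Rmult_lt_compat_l; nra).
  rewrite hT2 in h. replace (k^2 * ((n^2 - /4)/k^2)) with (n^2 - /4) in h by (field; lra).
  assert (0 < k * R) by nra.
  assert ((2 * k * R)^2 <= n^2) by (apply pow_incr; lra).
  nra.
Qed.

Lemma sqmod_derive_nondecreasing s t : r < s -> s <= t -> t <= T -> p1 s <= p1 t.
Proof.
  intros hs hst ht.
  apply (nondecreasing_of_derive p1 p2); [easy|intros; apply sqmod_derive2; lra|].
  intros x hx. unfold p2. rewrite potential_turning by lra.
  assert (0 <= p x) by (unfold p, sqmod; nra).
  assert (1 <= T^2 / x^2).
  { apply (Rmult_le_reg_r (x^2)); [nra|]. unfold Rdiv. rewrite Rmult_assoc, Rinv_l by nra. nra. }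
  assert (0 <= k^2 * (T^2/x^2 - 1) * p x).
  { apply Rmult_le_pos; [apply Rmult_le_pos; nra|easy]. }
  nra.
Qed.

(** Beyond the turning point the energy bounds the derivatives, and at twice its
   radius the potential is [3 k^2 / 4], so that the energy also bounds the
   function. Going back from [2 T] to [T] costs [T] times the bound on the
   derivative, and [T] is of order [n]. *)
Lemma sqmod_turning_le : r < T -> p T <= 14 * n^2 * F.
Proof.
  intros hrT. pose proof turning_pos as hT. pose proof turning_sq as hT2.
  assert (hF : 0 <= F) by (unfold F; nra).
  assert (E : forall x, T <= x -> a1 x ^2 + b1 x ^2 + k^2 * (1 - T^2/x^2) * p x <= 2 * k^2 * F).
  { intros x hx. pose proof (outgoing_energy_le _ _ _ _ _ _ _ _ _ x hr hn ho ltac:(lra)) as h.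
    unfold energy in h. rewrite potential_turning in h by lra. unfold p, sqmod, F. lra. }
  assert (D : forall x, T <= x -> a1 x ^2 <= 2 * k^2 * F /\ b1 x ^2 <= 2 * k^2 * F).
  { intros x hx. specialize (E x hx).
    assert (0 <= p x) by (unfold p, sqmod; nra).
    assert (T^2 / x^2 <= 1).
    { apply (Rmult_le_reg_r (x^2)); [nra|]. unfold Rdiv. rewrite Rmult_assoc, Rinv_l by nra. nra. }
    assert (0 <= k^2 * (1 - T^2/x^2) * p x).
    { apply Rmult_le_pos; [apply Rmult_le_pos; nra|easy]. }
    nra. }
  assert (P2 : p (2 * T) <= 8 / 3 * F).
  { specialize (E (2 * T) ltac:(lra)).
    replace (T^2 / (2 * T)^2) with (/4) in E by (field; lra).
    assert (0 <= a1 (2 * T) ^ 2) by nra. assert (0 <= b1 (2 * T) ^ 2) by nra.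
    assert (hk2 : 0 < k^2) by nra.
    assert (k^2 * (3/4 * p (2 * T)) <= k^2 * (2 * F)) by lra.
    apply Rmult_le_reg_l in H1; lra. }
  assert (A : forall y y1, solves k n r y y1 -> (forall x, T <= x -> y1 x ^2 <= 2 * k^2 * F) ->
    y T ^2 <= 2 * y (2 * T) ^2 + 4 * (n^2 - /4) * F).
  { intros y y1 hs hy.
    destruct (mean_value y y1 T (2 * T)) as [c [hc1 hc2]]; [lra|intros; apply hs; lra|].
    specialize (hy c ltac:(lra)).
    replace (2 * T - T) with T in hc2 by ring.
    assert (hd : (y (2 * T) - y T)^2 <= 2 * (n^2 - /4) * F).
    { rewrite hc2. replace ((y1 c * T)^2) with (y1 c ^2 * T^2) by ring.
      replace (2 * (n^2 - /4) * F) with (2 * k^2 * F * T^2) by (rewrite hT2; field; lra).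
      apply Rmult_le_compat_r; nra. }
    pose proof (pow2_ge_0 (2 * y (2 * T) - y T)). nra. }
  pose proof (A a a1 (og_re _ _ _ _ _ _ _ _ _ ho) (fun x hx => proj1 (D x hx))) as A1.
  pose proof (A b b1 (og_im _ _ _ _ _ _ _ _ _ ho) (fun x hx => proj2 (D x hx))) as A2.
  assert (0 <= (n^2 - 1) * F) by (apply Rmult_le_pos; [nra|easy]). unfold p, sqmod in *. lra.
Qed.

(** The Wronskian keeps [p] and the squared derivative from being small together:
   their product is at least [(k F)^2], and the inequality between arithmetic
   and geometric means makes [p''] at least [4 k F m], with [m] a lower bound
   for the rate of growth on [R, R + 2]. So [p] is of order [m] at [R + 1], and
   on the second unit interval [p'' >= 2 m^2 p] raises this to order [m^3]. *)
Lemma sqmod_grows (R : R) :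
  r < R -> 2 * k * (R + 2) <= n -> 0 < F -> 0 <= p1 R ->
  2 * k * F * (n / (2 * (R + 2))) ^ 3 <= p T.
Proof.
  intros hrR hnR hF hp1.
  assert (hT : R + 2 <= T) by (apply le_turning; lra).
  (* half of n / (R + 2), to absorb the term k^2 and the quarter of the potential *)
  set (m := n / (2 * (R + 2))).
  assert (hm : 0 < m) by (apply Rdiv_lt_0_compat; lra).
  assert (hq : forall x, R <= x <= R + 2 -> potential k n x <= - m^2).
  { intros x hx. unfold potential, m.
    apply (Rmult_le_reg_r (x^2)); [nra|].
    replace ((k ^ 2 - (n ^ 2 - / 4) / x ^ 2) * x^2) with (k^2 * x^2 - n^2 + / 4) by (field; lra).
    assert (h1 : x^2 <= (R+2)^2) by (apply pow_incr; lra).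
    assert (h2 : - (n / (2 * (R + 2))) ^ 2 * x ^ 2 >= - (n^2 / 4)).
    { replace (- (n^2/4)) with (- (n / (2 * (R + 2))) ^ 2 * (R+2)^2) by (field; lra).
      assert (0 <= (n / (2 * (R + 2))) ^ 2) by apply pow2_ge_0. nra. }
    assert (h3 : k^2 * x^2 <= k^2 * (R+2)^2) by (apply Rmult_le_compat_l; nra).
    assert (h4 : (2 * k * (R + 2))^2 <= n^2).
    { apply pow_incr; split; [|easy]. repeat apply Rmult_le_pos; lra. }
    nra. }
  assert (hppos : forall x, 0 <= p x) by (intro; unfold p, sqmod; nra).
  assert (hconv1 : forall x, R <= x <= R + 2 -> 2 * m^2 * p x <= p2 x).
  { intros x hx. specialize (hq x hx). specialize (hppos x). unfold p2.
    assert (0 <= (- potential k n x - m^2) * p x) by (apply Rmult_le_pos; lra).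
    nra. }
  assert (hconv2 : forall x, R <= x <= R + 2 -> 4 * (k * F) * m <= p2 x).
  { intros x hx. specialize (hq x hx). specialize (hppos x).
    pose proof (outgoing_wronskian _ _ _ _ _ _ _ _ _ x hr ho ltac:(lra)) as w. fold F in w.
    assert (hl : (k * F)^2 <= p x * (a1 x ^2 + b1 x ^2)).
    { rewrite <- w. unfold p, sqmod. 
      assert (0 <= (a x * a1 x + b x * b1 x)^2) by apply pow2_ge_0. nra. }
    assert (hkF : 0 < k * F) by nra.
    assert (hp : 0 < p x).
    { destruct hppos as [|he]; [easy|]. rewrite <- he in hl. nra. }
    assert (h : p x * (4 * (k * F) * m) <= p x * p2 x).
    { unfold p2. assert (0 <= (k * F - m * p x)^2) by apply pow2_ge_0.
      assert (0 <= (- potential k n x - m^2) * (p x * p x)) by (apply Rmult_le_pos; nra).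
      nra. }
    now apply Rmult_le_reg_l in h. }
  destruct (convex_step p p1 p2 R (4 * (k * F) * m)) as [s1 s2]; auto.
  1,2: intros; (apply sqmod_derive || apply sqmod_derive2); lra.
  { intros; apply hconv2; lra. }
  assert (hkF : 0 < k * F) by nra.
  assert (hkFm : 0 < k * F * m) by nra.
  assert (hp1' : forall x, R + 1 <= x -> x <= T -> 0 <= p1 x).
  { intros x h1 h2. apply Rle_trans with (p1 (R + 1)); [lra|].
    apply sqmod_derive_nondecreasing; lra. }
  destruct (convex_step p p1 p2 (R + 1) (4 * (k * F) * m ^ 3)) as [s3 s4].
  1,2: intros; (apply sqmod_derive || apply sqmod_derive2); lra.
  { intros t ht. apply Rle_trans with (2 * m^2 * p t); [|apply hconv1; lra].
    assert (p (R + 1) <= p t).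
    { apply (nondecreasing_of_derive p p1); [lra|intros; apply sqmod_derive; lra|].
      intros; apply hp1'; lra. }
    specialize (hppos R).
    assert (2 * m^2 * (2 * (k * F) * m) <= 2 * m^2 * p t) by (apply Rmult_le_compat_l; nra).
    nra. }
  { apply hp1'; lra. }
  replace (R + 1 + 1) with (R + 2) in * by ring.
  assert (p (R + 2) <= p T).
  { apply (nondecreasing_of_derive p p1); [lra|intros; apply sqmod_derive; lra|].
    intros; apply hp1'; lra. }
  specialize (hppos (R + 1)). fold m. nra.
Qed.

(** For these [n] the cubic lower bound exceeds the quadratic upper bound, so [p]
   has negative derivative at [R], and, being convex, on its left. *)
Lemma sqmod_decreases (R : R) :
  r < R -> 2 * k * (R + 2) <= n -> 7 < k * n * (/ (2 * (R + 2))) ^ 3 -> 0 < F ->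
  forall x, r < x < R -> p R < p x.
Proof.
  intros hrR h1 h2 hF x hx.
  assert (hT : R + 2 <= T) by (apply le_turning; lra).
  assert (hneg : p1 R < 0).
  { apply Rnot_le_lt; intros hp1.
    pose proof (sqmod_grows R hrR h1 hF hp1) as g1.
    pose proof (sqmod_turning_le ltac:(lra)) as g2.
    assert (2 * k * F * (n / (2 * (R + 2))) ^ 3 = 2 * F * n^2 * (k * n * (/ (2 * (R + 2))) ^ 3)) by (field; lra).
    assert (0 < 2 * F * n^2) by (apply Rmult_lt_0_compat; nra).
    assert (2 * F * n^2 * 7 < 2 * F * n^2 * (k * n * (/ (2 * (R + 2))) ^ 3)) by now apply Rmult_lt_compat_l.
    nra. }
  destruct (mean_value p p1 x R) as [c [hc1 hc2]]; [lra|intros; apply sqmod_derive; lra|].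
  pose proof (sqmod_derive_nondecreasing c R ltac:(lra) ltac:(lra) ltac:(lra)). nra.
Qed.
End SquaredModulus.

(** * Integrals over the circle *)

Definition circ (g : R -> R) : R := RInt g 0 (2 * PI).

Definition cts (g : R -> R) : Prop := forall x, continuous g x.

Lemma cts_mult f g : cts f -> cts g -> cts (fun x => f x * g x).
Proof. intros hf hg x. exact (continuous_mult (K:=R_AbsRing) f g x (hf x) (hg x)). Qed.

Lemma cts_plus f g : cts f -> cts g -> cts (fun x => f x + g x).
Proof. intros hf hg x. exact (continuous_plus (V:=R_NormedModule) f g x (hf x) (hg x)). Qed.

Lemma cts_minus f g : cts f -> cts g -> cts (fun x => f x - g x).
Proof. intros hf hg x. exact (continuous_minus (V:=R_NormedModule) f g x (hf x) (hg x)). Qed.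

Lemma cts_const c : cts (fun _ => c).
Proof. intros x. apply continuous_const. Qed.

Lemma cts_comp f g : cts f -> cts g -> cts (fun x => g (f x)).
Proof. intros hf hg x. apply (continuous_comp f g); auto. Qed.

Lemma cts_ext f g : (forall x, f x = g x) -> cts f -> cts g.
Proof. intros h hf x. apply (continuous_ext f); auto. Qed.

Lemma cts_derive f : (forall x, ex_derive f x) -> cts f.
Proof. intros h x. now apply (ex_derive_continuous (V:=R_NormedModule)). Qed.

Lemma cts_cos_lin n s : cts (fun t => cos (n * t + s)).
Proof. apply cts_derive; intros x; auto_derive; easy. Qed.

Lemma cts_ex_RInt f a b : cts f -> ex_RInt f a b.
Proof. intros hf. apply (ex_RInt_continuous (V:=R_CompleteNormedModule)). auto. Qed.

Lemma circ_ext f g : (forall x, f x = g x) -> circ f = circ g.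
Proof. intros h. unfold circ. apply RInt_ext; auto. Qed.

Lemma circ_plus f g : cts f -> cts g -> circ (fun x => f x + g x) = circ f + circ g.
Proof.
  intros hf hg. unfold circ.
  exact (RInt_plus (V:=R_CompleteNormedModule) f g _ _ (cts_ex_RInt _ _ _ hf) (cts_ex_RInt _ _ _ hg)).
Qed.

Lemma circ_minus f g : cts f -> cts g -> circ (fun x => f x - g x) = circ f - circ g.
Proof.
  intros hf hg. unfold circ.
  exact (RInt_minus (V:=R_CompleteNormedModule) f g _ _ (cts_ex_RInt _ _ _ hf) (cts_ex_RInt _ _ _ hg)).
Qed.

Lemma circ_scal c f : cts f -> circ (fun x => c * f x) = c * circ f.
Proof.
  intros hf. unfold circ.
  exact (RInt_scal (V:=R_CompleteNormedModule) f _ _ c (cts_ex_RInt _ _ _ hf)).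
Qed.

Lemma circ_lin x y f g : cts f -> cts g ->
  circ (fun t => x * f t + y * g t) = x * circ f + y * circ g.
Proof.
  intros hf hg. rewrite <- (circ_scal x f hf), <- (circ_scal y g hg).
  apply (circ_plus (fun t => x * f t) (fun t => y * g t)).
  - apply (cts_mult (fun _ => x)); auto using cts_const.
  - apply (cts_mult (fun _ => y)); auto using cts_const.
Qed.

Lemma circ_lin4 x y z v f g h l : cts f -> cts g -> cts h -> cts l ->
  circ (fun t => (x * f t + y * g t) + (z * h t + v * l t)) =
  (x * circ f + y * circ g) + (z * circ h + v * circ l).
Proof.
  intros hf hg hh hl. rewrite <- (circ_lin x y f g hf hg), <- (circ_lin z v h l hh hl).
  assert (S : forall a b p q, cts p -> cts q -> cts (fun t => a * p t + b * q t)).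
  { intros a b p q hp hq. apply cts_plus; apply cts_mult; auto using cts_const. }
  apply (circ_plus (fun t => x * f t + y * g t) (fun t => z * h t + v * l t)); auto.
Qed.

Lemma circ_derive (G g : R -> R) : (forall x, is_derive G x (g x)) -> cts g -> G (2 * PI) = G 0 -> circ g = 0.
Proof.
  intros hd hg he. unfold circ.
  rewrite (is_RInt_unique _ _ _ _ (is_RInt_derive (V:=R_CompleteNormedModule) G g 0 (2*PI) (fun x _ => hd x) (fun x _ => hg x))).
  unfold minus, plus, opp; simpl. rewrite he. ring.
Qed.

Lemma RInt_affine g u v a b : cts g ->
  RInt (fun y => u * g (u * y + v)) a b = RInt g (u * a + v) (u * b + v).
Proof.
  intros hg.
  exact (RInt_comp_lin (V:=R_CompleteNormedModule) g u v a b (cts_ex_RInt _ _ _ hg)).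
Qed.

Lemma RInt_split g a b c : cts g -> RInt g a c = RInt g a b + RInt g b c.
Proof.
  intros hg. symmetry.
  exact (RInt_Chasles (V:=R_CompleteNormedModule) g a b c (cts_ex_RInt _ _ _ hg) (cts_ex_RInt _ _ _ hg)).
Qed.

Lemma circ_shift g s : cts g -> (forall x, g (x + 2 * PI) = g x) ->
  circ (fun x => g (x + s)) = circ g.
Proof.
  intros hg hp. unfold circ.
  transitivity (RInt g (1 * 0 + s) (1 * (2 * PI) + s)).
  { rewrite <- RInt_affine by easy. apply RInt_ext; intros x _.
    now rewrite !Rmult_1_l. }
  replace (1 * 0 + s) with s by ring.
  rewrite (RInt_split g s 0), (RInt_split g 0 (2 * PI)) by easy.
  replace (RInt g (2 * PI) (1 * (2 * PI) + s)) with (RInt g 0 s).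
  - pose proof (RInt_split g s 0 s hg) as h.
    rewrite (RInt_point s g) in h. unfold zero in h; simpl in h. lra.
  - transitivity (RInt g (1 * 0 + 2 * PI) (1 * s + 2 * PI)).
    + rewrite <- RInt_affine by easy. apply RInt_ext; intros x _.
      now rewrite !Rmult_1_l, hp.
    + f_equal; ring.
Qed.

Lemma circ_reflect g : cts g -> (forall x, g (x + 2 * PI) = g x) ->
  circ (fun x => g (- x)) = circ g.
Proof.
  intros hg hp. unfold circ.
  pose proof (RInt_affine g (-1) (2 * PI) 0 (2 * PI) hg) as h.
  replace (-1 * 0 + 2 * PI) with (2 * PI) in h by ring.
  replace (-1 * (2 * PI) + 2 * PI) with 0 in h by ring.
  pose proof (RInt_split g 0 (2 * PI) 0 hg) as h2.
  rewrite (RInt_point 0 g) in h2. unfold zero in h2; simpl in h2.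
  assert (hg' : cts (fun x => g (- x))).
  { apply (cts_comp (fun x => - x) g); [apply cts_derive; intros; auto_derive; easy|easy]. }
  assert (h3 : RInt (fun y => -1 * g (-1 * y + 2 * PI)) 0 (2 * PI) = -1 * circ (fun x => g (- x))).
  { rewrite <- circ_scal by easy. apply RInt_ext; intros x _.
    rewrite hp. do 2 f_equal; ring. }
  unfold circ in h3. lra.
Qed.

Lemma circ_param_derive (f f' : R -> R -> R) (x : R) :
  locally x (fun y => forall t, is_derive (fun z => f z t) y (f' y t)) ->
  (forall t, continuity_2d_pt f' x t) ->
  locally x (fun y => cts (f y)) ->
  is_derive (fun y => circ (f y)) x (circ (f' x)).
Proof.
  intros hd hc hi.
  assert (he : circ (f' x) = circ (fun t => Derive (fun u => f u t) x)).
  { apply circ_ext; intros t. symmetry. apply is_derive_unique.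
    now apply (locally_singleton _ _ hd). }
  rewrite he. unfold circ.
  apply (is_derive_RInt_param f 0 (2 * PI) x).
  - revert hd. apply filter_imp. intros y hy t _. eexists; apply hy.
  - intros t _. apply (continuity_2d_pt_ext_loc f'); [|apply hc].
    apply locally_2d_locally.
    destruct hd as [d hd]. exists d. intros [u v] [h1 h2]. simpl in *.
    symmetry. apply is_derive_unique. now apply hd.
  - revert hi. apply filter_imp. intros y hy. now apply cts_ex_RInt.
Qed.

(** * Plane waves and Bessel functions *)

(** Liouville's substitution: the factor [sqrt x] removes the first order term of
   Bessel's equation. *)
Lemma bessel_solves k n r u u1 :
  0 <= r -> (forall x, r < x -> is_derive u x (u1 x)) ->
  (forall x, r < x -> is_derive u1 x (- u1 x / x - (k^2 - n^2 / x^2) * u x)) ->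
  solves k n r (fun x => sqrt x * u x) (fun x => sqrt x * u1 x + / (2 * sqrt x) * u x).
Proof.
  intros hr h1 h2 x hx.
  assert (hs : 0 < sqrt x) by (apply sqrt_lt_R0; lra).
  assert (hd : is_derive sqrt x (/ (2 * sqrt x))).
  { auto_derive; [lra|]. field; lra. }
  assert (hx2 : sqrt x * sqrt x = x) by (apply sqrt_sqrt; lra).
  split.
  - eapply is_derive_eq; [apply is_derive_Rmult; [exact hd|now apply h1]|]. ring.
  - eapply is_derive_eq.
    + apply is_derive_Rplus; apply is_derive_Rmult; [exact hd|now apply h2| |now apply h1].
      auto_derive; [lra|reflexivity].
    + unfold potential. set (s := sqrt x) in *. rewrite <- hx2. field. lra.
Qed.

(** [wave_coef 0 n x + i wave_coef (- PI / 2) n x] is [2 pi i^n J_n(x)], the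
   [n]-th cosine coefficient of the plane wave [exp (i x cos t)]. Letting the
   phase [al] vary turns the real and imaginary parts of each identity into one,
   since differentiation shifts the phase by a quarter turn; the index is an
   integer so that the recurrences need no case distinction at zero. *)
Definition wave_coef (al : R) (n : Z) (x : R) : R :=
  circ (fun t => cos (x * cos t + al) * cos (IZR n * t)).

Notation jre := (wave_coef 0).
Notation jim := (wave_coef (- (PI / 2))).

Lemma cts_wave al n x : cts (fun t => cos (x * cos t + al) * cos (IZR n * t)).
Proof. apply cts_derive; intros; auto_derive; easy. Qed.

Lemma cos_quarter y : cos (y + PI / 2) = - sin y.
Proof. rewrite cos_plus, cos_PI2, sin_PI2. ring. Qed.

Lemma wave_coef_phase al n x :
  wave_coef al n x = cos al * jre n x - sin al * jim n x.
Proof.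
  unfold wave_coef.
  rewrite <- (circ_scal (cos al) _ (cts_wave 0 n x)), <- (circ_scal (sin al) _ (cts_wave (- (PI / 2)) n x)).
  rewrite <- (circ_minus (fun t => cos al * _) (fun t => sin al * _)).
  - apply circ_ext. intros t. rewrite (cos_plus (x * cos t) al), Rplus_0_r.
    rewrite (cos_plus (x * cos t) (- (PI / 2))), cos_neg, sin_neg, cos_PI2, sin_PI2. ring.
  - apply (cts_mult (fun _ => cos al)); [apply cts_const|apply cts_wave].
  - apply (cts_mult (fun _ => sin al)); [apply cts_const|apply cts_wave].
Qed.

Lemma wave_coef_opposite al n x : wave_coef (al + PI / 2 + PI / 2) n x = - wave_coef al n x.
Proof.
  rewrite (wave_coef_phase al), (wave_coef_phase (_ + _)).
  replace (al + PI / 2 + PI / 2) with (al + PI) by field.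
  rewrite neg_cos, neg_sin. ring.
Qed.

Ltac continuity_2d :=
  repeat first
    [ apply continuity_2d_pt_id1 | apply continuity_2d_pt_id2 | apply continuity_2d_pt_const
    | apply continuity_2d_pt_mult | apply continuity_2d_pt_plus | apply continuity_2d_pt_opp
    | apply (continuity_1d_2d_pt_comp cos); [apply continuity_cos|]
    | apply (continuity_1d_2d_pt_comp sin); [apply continuity_sin|] ].

Lemma cos_shift_sum n t :
  cos (IZR (n + 1) * t) + cos (IZR (n - 1) * t) = 2 * (cos t * cos (IZR n * t)).
Proof.
  rewrite plus_IZR, minus_IZR.
  replace ((IZR n + 1) * t) with (IZR n * t + t) by ring.
  replace ((IZR n - 1) * t) with (IZR n * t - t) by ring.
  rewrite cos_plus, cos_minus. ring.
Qed.

Lemma cos_shift_diff n t :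
  cos (IZR (n - 1) * t) - cos (IZR (n + 1) * t) = 2 * (sin t * sin (IZR n * t)).
Proof.
  rewrite plus_IZR, minus_IZR.
  replace ((IZR n + 1) * t) with (IZR n * t + t) by ring.
  replace ((IZR n - 1) * t) with (IZR n * t - t) by ring.
  rewrite cos_plus, cos_minus. ring.
Qed.

Lemma wave_coef_derive al n x :
  is_derive (wave_coef al n) x
    (/ 2 * (wave_coef (al + PI / 2) (n + 1) x + wave_coef (al + PI / 2) (n - 1) x)).
Proof.
  eapply is_derive_eq.
  - apply (circ_param_derive _ (fun x t => - (cos t * sin (x * cos t + al) * cos (IZR n * t)))).
    + apply filter_forall. intros y t. auto_derive; [easy|ring].
    + intros t. continuity_2d.
    + apply filter_forall. intros y. apply cts_wave.
  - unfold wave_coef. rewrite <- circ_plus by apply cts_wave.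
    rewrite <- circ_scal by (apply cts_plus; apply cts_wave).
    apply circ_ext. intros t. rewrite <- Rplus_assoc, cos_quarter.
    set (y := x * cos t + al).
    transitivity (- / 2 * sin y * (cos (IZR (n + 1) * t) + cos (IZR (n - 1) * t))); [|field].
    rewrite cos_shift_sum. field.
Qed.

Lemma sin_Z_2PI n : sin (IZR n * (2 * PI)) = 0.
Proof.
  replace (IZR n * (2 * PI)) with (IZR (n * 2) * PI) by (rewrite mult_IZR; ring).
  apply sin_eq_0_1. now exists (n * 2)%Z.
Qed.

(** The integral over the circle of the derivative of [cos (x cos t + al) sin (n
   t)] is zero. *)
Lemma wave_coef_recurrence al n x :
  IZR n * wave_coef al n x =
  x / 2 * (wave_coef (al + PI / 2) (n - 1) x - wave_coef (al + PI / 2) (n + 1) x).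
Proof.
  set (be := al + PI / 2).
  assert (h : circ (fun t => IZR n * (cos (x * cos t + al) * cos (IZR n * t)) - x / 2 *
     (cos (x * cos t + be) * cos (IZR (n - 1) * t) - cos (x * cos t + be) * cos (IZR (n + 1) * t))) = 0).
  { apply (circ_derive (fun t => cos (x * cos t + al) * sin (IZR n * t))).
    - intros t. auto_derive; [easy|].
      unfold be. rewrite <- Rmult_minus_distr_l, cos_shift_diff, <- Rplus_assoc, cos_quarter. field.
    - apply cts_derive; intros t; auto_derive; easy.
    - rewrite sin_Z_2PI, (Rmult_0_r (IZR n)), sin_0. ring. }
  pose proof (circ_scal (IZR n) _ (cts_wave al n x)) as h1.
  pose proof (circ_scal (x / 2) _ (cts_minus _ _ (cts_wave be (n - 1) x) (cts_wave be (n + 1) x))) as h2.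
  pose proof (circ_minus _ _ (cts_wave be (n - 1) x) (cts_wave be (n + 1) x)) as h3.
  cbv beta in h1, h2, h3. rewrite circ_minus in h.
  - rewrite h1, h2, h3 in h. fold (wave_coef al n x) (wave_coef be (n - 1) x) (wave_coef be (n + 1) x) in h. lra.
  - apply cts_derive; intros t; auto_derive; easy.
  - apply cts_derive; intros t; auto_derive; easy.
Qed.

(** The two recurrences express the first two derivatives, and [n^2] times the
   function, by the functions of index [n - 2] to [n + 2]. *)
Lemma wave_coef_bessel al n x : 0 < x ->
  is_derive (fun x => / 2 * (wave_coef (al + PI / 2) (n + 1) x + wave_coef (al + PI / 2) (n - 1) x)) x
    (- (/ 2 * (wave_coef (al + PI / 2) (n + 1) x + wave_coef (al + PI / 2) (n - 1) x)) / x
      - (1^2 - IZR n^2 / x^2) * wave_coef al n x).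
Proof.
  intros hx. set (be := al + PI / 2). eapply is_derive_eq.
  - apply is_derive_Rscal. apply is_derive_Rplus; apply wave_coef_derive.
  - pose proof (wave_coef_recurrence al n x) as e1. fold be in e1.
    pose proof (wave_coef_recurrence be (n - 1) x) as e2.
    pose proof (wave_coef_recurrence be (n + 1) x) as e3.
    unfold be in e2, e3 |- *. rewrite !wave_coef_opposite in *. fold be in e2, e3 |- *.
    rewrite minus_IZR in e2. rewrite plus_IZR in e3.
    replace (n + 1 + 1)%Z with (n + 2)%Z in * by ring.
    replace (n + 1 - 1)%Z with n in * by ring.
    replace (n - 1 + 1)%Z with n in * by ring.
    replace (n - 1 - 1)%Z with (n - 2)%Z in * by ring.
    set (N := IZR n) in *. set (u := wave_coef al n x) in *.
    set (p := wave_coef be (n + 1) x) in *. set (m := wave_coef be (n - 1) x) in *.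
    set (p2 := wave_coef al (n + 2) x) in *. set (m2 := wave_coef al (n - 2) x) in *.
    assert (e : N^2 * u = x / 2 * (p + m) - x^2 / 4 * (m2 - 2 * u + p2)).
    { replace (N^2 * u) with (N * (N * u)) by ring. rewrite e1.
      transitivity (x / 2 * (((N - 1) * m + m) - ((N + 1) * p - p))); [ring|].
      rewrite e2, e3. field. }
    apply (Rmult_eq_reg_r (x^2)); [|nra].
    replace ((- (/ 2 * (p + m)) / x - (1 ^ 2 - N ^ 2 / x ^ 2) * u) * x^2)
      with (- (x / 2) * (p + m) - x^2 * u + N^2 * u) by (field; lra).
    rewrite e. field.
Qed.

(** Below the turning point the square of a solution is convex; being nonnegative
   and zero at the origin, it increases. *)
Lemma solves_sq_increasing n y y1 s t :
  solves 1 n 0 y y1 -> (forall eps, 0 < eps -> exists d, 0 < d /\ forall x, 0 < x < d -> Rabs (y x) < eps) ->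
  1 <= n -> 0 < s < t -> 2 * t <= n -> y s = 0 \/ y s ^ 2 < y t ^ 2.
Proof.
  intros hs h0 hn hst htn.
  destruct (Req_dec (y s) 0) as [|hne]; [now left|right].
  apply Rnot_le_lt; intros hle.
  set (p := fun x => y x ^2). set (p1 := fun x => 2 * (y x * y1 x)).
  set (p2 := fun x => 2 * (y1 x ^2 - potential 1 n x * y x ^2)).
  assert (D1 : forall x, 0 < x -> is_derive p x (p1 x)).
  { intros x hx. destruct (hs x hx) as [d1 d2].
    apply (is_derive_ext (fun x => y x * y x)); [intros; unfold p; simpl; ring|].
    eapply is_derive_eq; [apply is_derive_Rmult; exact d1|unfold p1; ring]. }
  assert (D2 : forall x, 0 < x -> is_derive p1 x (p2 x)).
  { intros x hx. destruct (hs x hx) as [d1 d2].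
    eapply is_derive_eq; [apply is_derive_Rscal, is_derive_Rmult; [exact d1|exact d2]|unfold p2; ring]. }
  assert (hconv : forall u v, 0 < u -> u <= v -> v <= t -> p1 u <= p1 v).
  { intros u v hu huv hv. apply (nondecreasing_of_derive p1 p2); [easy|intros; apply D2; lra|].
    intros x hx. unfold p2.
    assert (hq : potential 1 n x <= 0).
    { unfold potential. apply (Rmult_le_reg_r (x^2)); [nra|].
      replace ((1 ^ 2 - (n ^ 2 - / 4) / x ^ 2) * x^2) with (x^2 - n^2 + /4) by (field; lra).
      nra. }
    assert (0 <= y x ^ 2) by apply pow2_ge_0. assert (0 <= y1 x ^2) by apply pow2_ge_0. nra. }
  destruct (mean_value p p1 s t) as [c [hc1 hc2]]; [lra|intros; apply D1; lra|].
  assert (hneg : p1 s <= 0).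
  { apply Rle_trans with (p1 c); [apply hconv; lra|]. unfold p in hc2. nra. }
  destruct (h0 (Rabs (y s))) as [d [hd hy]]; [now apply Rabs_pos_lt|].
  set (x := Rmin (s/2) (d/2)).
  assert (0 < x /\ x < s /\ x < d) as (x1 & x2 & x3).
  { unfold x. pose proof (Rmin_l (s/2) (d/2)); pose proof (Rmin_r (s/2) (d/2)).
    assert (0 < Rmin (s/2) (d/2)) by (apply Rmin_pos; lra). lra. }
  specialize (hy x ltac:(lra)).
  destruct (mean_value p p1 x s) as [c' [hc1' hc2']]; [lra|intros; apply D1; lra|].
  assert (p1 c' <= 0) by (apply Rle_trans with (p1 s); [apply hconv; lra|easy]).
  assert (p s <= p x) by nra. unfold p in H0.
  rewrite <- (pow2_abs (y s)), <- (pow2_abs (y x)) in H0.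
  pose proof (Rabs_pos (y x)). nra.
Qed.

Lemma small_at_zero u : continuous u 0 ->
  forall eps, 0 < eps -> exists d, 0 < d /\ forall x, 0 < x < d -> Rabs (sqrt x * u x) < eps.
Proof.
  intros hu eps heps.
  assert (hc : continuous (fun x => sqrt x * u x) 0).
  { apply (continuous_mult (K:=R_AbsRing) sqrt u); [|easy].
    apply continuity_pt_filterlim, continuity_pt_sqrt; lra. }
  destruct (proj1 (filterlim_locally _ _) hc (mkposreal eps heps)) as [d hd].
  exists d. split; [apply cond_pos|]. intros x hx.
  specialize (hd x). unfold ball in hd; simpl in hd. unfold AbsRing_ball, abs, minus, plus, opp in hd; simpl in hd.
  rewrite sqrt_0 in hd. replace (sqrt x * u x + - (0 * u 0)) with (sqrt x * u x) in hd by ring.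
  apply hd. rewrite Rabs_pos_eq; lra.
Qed.

Lemma wave_coef_increasing al n s t :
  (1 <= n)%Z -> 0 < s < t -> 2 * t <= IZR n ->
  wave_coef al n s = 0 \/ s * wave_coef al n s ^ 2 < t * wave_coef al n t ^ 2.
Proof.
  intros hn hst ht.
  destruct (solves_sq_increasing (IZR n) (fun x => sqrt x * wave_coef al n x) _ s t
    (bessel_solves 1 (IZR n) 0 (wave_coef al n) _ (Rle_refl 0)
      (fun x _ => wave_coef_derive al n x) (wave_coef_bessel al n)))
    as [h|h]; auto.
  - apply small_at_zero. apply (ex_derive_continuous (V:=R_NormedModule)). eexists; apply wave_coef_derive.
  - now apply (IZR_le 1).
  - left. assert (0 < sqrt s) by (apply sqrt_lt_R0; lra). nra.
  - right. rewrite !Rpow_mult_distr, !pow2_sqrt in h; lra.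
Qed.

Lemma derive_zero_of_zero (f : R -> R) l a b x :
  a < x < b -> (forall y, a < y < b -> f y = 0) -> is_derive f x l -> l = 0.
Proof.
  intros hx h hd. rewrite <- (is_derive_unique _ _ _ hd).
  apply is_derive_unique. apply (is_derive_ext_loc (fun _ => 0)).
  - assert (hp : 0 < Rmin (x - a) (b - x)) by (apply Rmin_pos; lra).
    exists (mkposreal _ hp). intros y hy. symmetry. apply h.
    unfold ball in hy; simpl in hy; unfold AbsRing_ball, abs, minus, plus, opp in hy; simpl in hy.
    apply Rabs_def2 in hy.
    pose proof (Rmin_l (x - a) (b - x)); pose proof (Rmin_r (x - a) (b - x)). lra.
  - auto_derive; easy.
Qed.

(** A common zero would, by monotonicity, make mode [n] vanish on an interval at
   the origin; the recurrences carry this down to mode zero, whose real part is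
   [2 pi] at the origin. *)
Lemma wave_coef_nonzero n s :
  (1 <= n)%Z -> 0 < s -> 2 * s <= IZR n -> jre n s = 0 -> jim n s = 0 -> False.
Proof.
  intros hn hs hsn hr hi.
  assert (A : forall m : nat, (Z.of_nat m <= n)%Z -> forall al x, 0 < x < s ->
     wave_coef al (n - Z.of_nat m) x = 0).
  { induction m as [|m IH].
    - intros _ al x hx. rewrite Z.sub_0_r.
      destruct (wave_coef_increasing al n x s) as [|h]; auto.
      rewrite (wave_coef_phase al n s), hr, hi in h.
      assert (0 <= x * wave_coef al n x ^ 2) by (apply Rmult_le_pos; [lra|apply pow2_ge_0]). lra.
    - intros hm al x hx. specialize (IH ltac:(lia) (al - PI / 2)).
      replace (n - Z.of_nat (S m))%Z with (n - Z.of_nat m - 1)%Z by lia.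
      set (l := (n - Z.of_nat m)%Z) in *.
      pose proof (derive_zero_of_zero _ _ 0 s x hx IH (wave_coef_derive (al - PI / 2) l x)) as e.
      pose proof (wave_coef_recurrence (al - PI / 2) l x) as r. rewrite (IH x hx) in r.
      replace (al - PI / 2 + PI / 2) with al in e, r by ring.
      apply (Rmult_eq_reg_l x); nra. }
  specialize (A (Z.to_nat n)). rewrite Z2Nat.id in A by lia. rewrite Z.sub_diag in A.
  specialize (A ltac:(lia)).
  assert (h0 : jre 0 0 = 2 * PI).
  { unfold wave_coef. transitivity (circ (fun _ => 1)).
    - apply circ_ext. intros t. rewrite !Rmult_0_l, Rplus_0_l, cos_0. ring.
    - unfold circ. rewrite (RInt_const (V:=R_CompleteNormedModule)). unfold scal; simpl; unfold mult; simpl. ring. }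
  assert (hc : continuous (jre 0) 0).
  { apply (ex_derive_continuous (V:=R_NormedModule)). eexists; apply wave_coef_derive. }
  pose proof PI_RGT_0 as hpi.
  destruct (proj1 (filterlim_locally _ _) hc (mkposreal PI hpi)) as [d hd].
  pose proof (cond_pos d) as hdp.
  set (x := Rmin (s/2) (d/2)).
  assert (0 < x /\ x < s /\ x < d) as (x1 & x2 & x3).
  { unfold x. pose proof (Rmin_l (s/2) (d/2)); pose proof (Rmin_r (s/2) (d/2)).
    assert (0 < Rmin (s/2) (d/2)) by (apply Rmin_pos; lra). lra. }
  specialize (hd x). unfold ball in hd; simpl in hd; unfold AbsRing_ball, abs, minus, plus, opp in hd; simpl in hd.
  rewrite (A 0 x ltac:(lra)), h0 in hd.
  assert (Rabs (0 + - (2 * PI)) < PI) as hh.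
  { apply hd. rewrite Rabs_pos_eq; lra. }
  apply Rabs_def2 in hh. lra.
Qed.

(** [J_n] is real and [i^n] alternates between the two axes: rotating the angle
   by half a turn shows which of the two integrals is zero. *)
Lemma wave_coef_consecutive_orthogonal n x :
  jre n x * jre (n + 1) x + jim n x * jim (n + 1) x = 0.
Proof.
  assert (P : forall m t, cos (IZR m * (t + 2 * PI)) = cos (IZR m * t)).
  { intros m t. replace (IZR m * (t + 2 * PI)) with (IZR m * t + 2 * IZR m * PI) by ring.
    destruct (Z_le_gt_dec 0 m).
    - rewrite <- (Z2Nat.id m) by easy. rewrite <- INR_IZR_INZ. apply cos_period.
    - rewrite <- (cos_period _ (Z.to_nat (- m))). f_equal. rewrite INR_IZR_INZ, Z2Nat.id, opp_IZR by lia. ring. }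
  assert (S : forall m t, cos (IZR (2 * m) * (t + PI)) = cos (IZR (2 * m) * t)).
  { intros m t. rewrite mult_IZR.
    replace (2 * IZR m * (t + PI)) with (IZR m * (2 * t + 2 * PI)) by ring.
    rewrite P. f_equal. ring. }
  assert (S' : forall m t, cos (IZR (2 * m + 1) * (t + PI)) = - cos (IZR (2 * m + 1) * t)).
  { intros m t. rewrite plus_IZR, mult_IZR.
    replace ((2 * IZR m + 1) * (t + PI)) with (((2 * IZR m + 1) * t + PI) + 2 * IZR m * PI) by ring.
    destruct (Z_le_gt_dec 0 m).
    - rewrite <- (Z2Nat.id m) by easy. rewrite <- INR_IZR_INZ, cos_period. apply neg_cos.
    - rewrite <- neg_cos, <- (cos_period _ (Z.to_nat (- m))). f_equal.
      rewrite INR_IZR_INZ, Z2Nat.id, opp_IZR by lia. ring. }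
  assert (C2 : forall t, cos (t + 2 * PI) = cos t).
  { intros t. rewrite cos_plus, cos_2PI, sin_2PI. ring. }
  assert (T : forall al m, wave_coef al m x = circ (fun t => cos (- (x * cos t) + al) * cos (IZR m * (t + PI)))).
  { intros al m. unfold wave_coef.
    rewrite <- (circ_shift _ PI) by (try apply cts_wave; intros t; now rewrite C2, P).
    apply circ_ext. intros t. rewrite neg_cos. do 2 f_equal. ring. }
  assert (R1 : forall al t, cos (- (x * cos t) + al) = cos (x * cos t + - al)).
  { intros al t. rewrite <- cos_neg. f_equal. ring. }
  assert (E1 : forall m, jim (2 * m) x = 0).
  { intros m. assert (jim (2 * m) x = - jim (2 * m) x); [|lra].
    rewrite <- wave_coef_opposite, T. replace (- (PI / 2) + PI / 2 + PI / 2) with (- - (PI / 2)) by field.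
    apply circ_ext. intros t. now rewrite S, R1. }
  assert (E2 : forall m, jre (2 * m + 1) x = 0).
  { intros m. assert (jre (2 * m + 1) x = - jre (2 * m + 1) x); [|lra].
    rewrite T at 1. replace (- jre (2 * m + 1) x) with (-1 * jre (2 * m + 1) x) by ring. unfold wave_coef.
    rewrite <- circ_scal by apply cts_wave. apply circ_ext. intros t. rewrite S', R1, Ropp_0. ring. }
  destruct (Z.Even_or_Odd n) as [[m ->]|[m ->]].
  - rewrite E1, E2. ring.
  - replace (2 * m + 1 + 1)%Z with (2 * (m + 1))%Z by ring. rewrite E1, E2. ring.
Qed.

(** * Response of a circle to one mode of a plane wave *)

(** [tr + i ti] is the amplitude of the outgoing mode that cancels the [n]-th
   mode of a plane wave on the circle of radius [r]. *)
Definition mode_response (k r : R) (n : Z) (tr ti : R) : Prop :=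
  exists a a1 b b1, outgoing k (IZR n) r a a1 b b1 tr ti /\
    right_continuous a r /\ right_continuous b r /\
    a r = - sqrt r * jre n (k * r) /\ b r = - sqrt r * jim n (k * r).

Lemma outgoing_restrict k n r r' a a1 b b1 fr fi :
  r <= r' -> outgoing k n r a a1 b b1 fr fi -> outgoing k n r' a a1 b b1 fr fi.
Proof.
  intros hr [h1 h2 h3 h4]. split; auto; intros x hx; [apply h1|apply h2]; lra.
Qed.

Lemma right_continuous_plus f g r : right_continuous f r -> right_continuous g r ->
  right_continuous (fun t => f t + g t) r.
Proof.
  intros hf hg eps heps.
  destruct (hf (eps/2) ltac:(lra)) as [d1 [hd1 h1]]. destruct (hg (eps/2) ltac:(lra)) as [d2 [hd2 h2]].
  exists (Rmin d1 d2). split; [now apply Rmin_pos|]. intros t ht.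
  pose proof (Rmin_l d1 d2); pose proof (Rmin_r d1 d2).
  specialize (h1 t ltac:(lra)). specialize (h2 t ltac:(lra)).
  replace (f t + g t - (f r + g r)) with ((f t - f r) + (g t - g r)) by ring.
  eapply Rle_lt_trans; [apply Rabs_triang|lra].
Qed.

Lemma right_continuous_mult f g r : right_continuous f r -> right_continuous g r ->
  right_continuous (fun x => f x * g x) r.
Proof.
  intros hf hg eps heps.
      pose proof (Rabs_pos (f r)); pose proof (Rabs_pos (g r)).
      set (K := Rabs (f r) + Rabs (g r) + 1). set (e := Rmin 1 (eps / K)).
      assert (hK : 1 <= K) by (unfold K; lra).
      assert (0 < eps / K) by (apply Rdiv_lt_0_compat; lra).
      assert (he : 0 < e) by (apply Rmin_pos; lra).
      assert (e1 : e <= 1) by apply Rmin_l.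
      assert (e2 : e * K <= eps).
      { replace eps with (eps / K * K) by (field; lra). apply Rmult_le_compat_r; [lra|apply Rmin_r]. }
      destruct (hf e he) as [d1 [hd1 u1]]. destruct (hg e he) as [d2 [hd2 u2]].
      exists (Rmin d1 d2). split; [now apply Rmin_pos|]. intros x hx.
      pose proof (Rmin_l d1 d2); pose proof (Rmin_r d1 d2).
      specialize (u1 x ltac:(lra)); specialize (u2 x ltac:(lra)).
      replace (f x * g x - f r * g r) with ((f x - f r) * (g x - g r) + (f x - f r) * g r + f r * (g x - g r)) by ring.
      pose proof (Rabs_triang ((f x - f r) * (g x - g r) + (f x - f r) * g r) (f r * (g x - g r))) as t1.
      pose proof (Rabs_triang ((f x - f r) * (g x - g r)) ((f x - f r) * g r)) as t2.
      rewrite Rabs_mult in t1. rewrite (Rabs_mult _ (g x - g r)), (Rabs_mult _ (g r)) in t2.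
      set (p := Rabs (f x - f r)) in *. set (q := Rabs (g x - g r)) in *.
      assert (0 <= p) by apply Rabs_pos. assert (0 <= q) by apply Rabs_pos.
      assert (p * q <= p * 1) by (apply Rmult_le_compat_l; lra).
      assert (p * (1 + Rabs (g r)) < e * (1 + Rabs (g r))) by (apply Rmult_lt_compat_r; lra).
      assert (Rabs (f r) * q <= Rabs (f r) * e) by (apply Rmult_le_compat_l; lra).
      unfold K in e2. lra.
Qed.

Lemma right_continuous_const c r : right_continuous (fun _ => c) r.
Proof.
  intros eps heps. exists 1. split; [lra|]. intros x _. rewrite Rminus_diag_eq, Rabs_R0 by easy. easy.
Qed.

Lemma right_continuous_lin a b a' b' x y x' y' r :
  right_continuous a r -> right_continuous b r -> right_continuous a' r -> right_continuous b' r ->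
  right_continuous (fun t => (x * a t + y * b t) + (x' * a' t + y' * b' t)) r.
Proof.
  assert (S : forall c f, right_continuous f r -> right_continuous (fun t => c * f t) r).
  { intros c f hf. apply (right_continuous_mult (fun _ => c)); auto using right_continuous_const. }
  intros. apply right_continuous_plus; apply right_continuous_plus; now apply S.
Qed.

Lemma right_continuous_ext f g r : (forall x, f x = g x) -> right_continuous f r -> right_continuous g r.
Proof.
  intros h hf eps heps. destruct (hf eps heps) as [d [hd H]]. exists d; split; [easy|].
  intros x hx. rewrite <- !h. auto.
Qed.

(** By uniqueness applied to a combination of two outgoing solutions, the
   amplitude depends linearly on the boundary value. *)
Lemma far_of_boundary k n r a a1 b b1 fr fi a' a1' b' b1' fr' fi' x y :
  0 < k -> 0 < r ->
  outgoing k n r a a1 b b1 fr fi -> right_continuous a r -> right_continuous b r ->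
  outgoing k n r a' a1' b' b1' fr' fi' -> right_continuous a' r -> right_continuous b' r ->
  a' r = x * a r - y * b r -> b' r = x * b r + y * a r ->
  fr' = x * fr - y * fi /\ fi' = x * fi + y * fr.
Proof.
  intros hk hr h1 ca cb h2 ca' cb' ea eb.
  pose proof (outgoing_lin _ _ _ _ _ _ _ _ _ _ _ _ _ _ _ x y (-1) 0 h1 h2) as h.
  destruct (far_zero_of_boundary_zero _ _ _ _ _ _ _ _ _ hk hr h).
  - refine (right_continuous_ext _ _ r _ (right_continuous_lin a b a' b' x (-y) (-1) 0 r ca cb ca' cb')).
    intros; ring.
  - refine (right_continuous_ext _ _ r _ (right_continuous_lin a b a' b' y x 0 (-1) r ca cb ca' cb')).
    intros; ring.
  - rewrite ea. ring.
  - rewrite eb. ring.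
  - lra.
Qed.

Lemma mode_response_unique k r n tr ti tr' ti' :
  0 < k -> 0 < r -> mode_response k r n tr ti -> mode_response k r n tr' ti' ->
  tr = tr' /\ ti = ti'.
Proof.
  intros hk hr (a & a1 & b & b1 & h & ca & cb & ea & eb) (a' & a1' & b' & b1' & h' & ca' & cb' & ea' & eb').
  destruct (far_of_boundary _ _ _ _ _ _ _ _ _ _ _ _ _ _ _ 1 0 hk hr h ca cb h' ca' cb'); lra.
Qed.

Lemma right_limit_ge f r l c :
  right_continuous f r -> 0 < c -> (forall x, r < x < r + c -> l <= f x) -> l <= f r.
Proof.
  intros hf hc h. apply Rnot_lt_le; intro hlt.
  destruct (hf (l - f r)) as [d [hd hx]]; [lra|].
  set (x := r + Rmin d c / 2).
  assert (0 < Rmin d c) by now apply Rmin_pos.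
  pose proof (Rmin_l d c); pose proof (Rmin_r d c).
  specialize (hx x ltac:(unfold x; lra)). specialize (h x ltac:(unfold x; lra)).
  apply Rabs_def2 in hx. lra.
Qed.

Lemma right_limit_unique f r l c :
  right_continuous f r -> 0 < c -> (forall x, r < x < r + c -> f x = l) -> f r = l.
Proof.
  intros hf hc h. apply Rle_antisym.
  - assert (- l <= -1 * f r); [|lra].
    apply (right_limit_ge (fun x => -1 * f x) r (- l) c); [|easy|intros x hx; rewrite h by easy; lra].
    apply (right_continuous_mult (fun _ => -1)); auto using right_continuous_const.
  - apply (right_limit_ge f r l c hf hc). intros x hx. rewrite h by easy. lra.
Qed.

(** Zero amplitude would make the mode vanish, up to its boundary value; but that
   is a Bessel function below its turning point. *)
Lemma mode_response_nonzero k r n tr ti :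
  0 < k -> 0 < r -> (1 <= n)%Z -> 2 * (k * r) <= IZR n -> mode_response k r n tr ti ->
  0 < tr ^ 2 + ti ^ 2.
Proof.
  intros hk hr hn1 hn (a & a1 & b & b1 & h & ca & cb & ea & eb).
  destruct (Rle_lt_or_eq_dec 0 (tr^2+ti^2)) as [|he]; [nra|easy|exfalso].
  assert (tr = 0) as -> by nra. assert (ti = 0) as -> by nra.
  pose proof (zero_of_far_zero _ _ _ _ _ _ _ hk (Rlt_le _ _ hr) (IZR_le 1 n hn1) h) as hz.
  assert (hs : 0 < sqrt r) by now apply sqrt_lt_R0.
  assert (a r = 0) as za by (apply (right_limit_unique a r 0 1); auto; [lra|intros; apply hz; lra]).
  assert (b r = 0) as zb by (apply (right_limit_unique b r 0 1); auto; [lra|intros; apply hz; lra]).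
  apply (wave_coef_nonzero n (k * r)); auto; nra.
Qed.

Lemma continuous_small f x : continuous f x -> forall eps, 0 < eps ->
  exists d, 0 < d /\ forall y, Rabs (y - x) < d -> Rabs (f y - f x) < eps.
Proof.
  intros hc eps heps. destruct (proj1 (filterlim_locally _ _) hc (mkposreal eps heps)) as [d hd].
  exists d; split; [apply cond_pos|]. intros y hy. exact (hd y hy).
Qed.

Lemma right_continuous_of_continuous f x : continuous f x -> right_continuous f x.
Proof.
  intros hc eps heps. destruct (continuous_small f x hc eps heps) as [d [hd h]].
  exists d; split; [easy|]. intros y hy. apply h. rewrite Rabs_pos_eq; lra.
Qed.

(** Outside the larger circle the two modes are proportional, and amplitudes of
   equal modulus force equal moduli on that circle. But from the inner to the
   outer circle the modulus of a high outgoing mode decreases, while that of the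
   boundary data, a Bessel function, increases. *)
Lemma mode_response_radius k r1 r2 :
  0 < k -> 0 < r1 -> r1 < r2 -> exists N, forall n, (N <= n)%Z -> forall tr1 ti1 tr2 ti2,
  mode_response k r1 n tr1 ti1 -> mode_response k r2 n tr2 ti2 ->
  tr1 ^ 2 + ti1 ^ 2 <> tr2 ^ 2 + ti2 ^ 2.
Proof.
  intros hk hr1 hr12.
  set (be := (/ (2 * (r2 + 2))) ^ 3).
  assert (hbe : 0 < be) by (apply pow_lt, Rinv_0_lt_compat; lra).
  set (X := 1 + 2 * k * (r2 + 2) + 7 / (k * be)).
  assert (hkbe : 0 < k * be) by now apply Rmult_lt_0_compat.
  assert (h7 : 0 < 7 / (k * be)) by (apply Rdiv_lt_0_compat; lra).
  assert (hk2 : 0 < 2 * k * (r2 + 2)) by (repeat apply Rmult_lt_0_compat; lra).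
  exists (up X). intros n hn tr1 ti1 tr2 ti2 H1 H2 he.
  assert (hnX : X < IZR n).
  { apply Rlt_le_trans with (IZR (up X)); [apply archimed|now apply IZR_le]. }
  assert (c1 : 1 <= IZR n) by (unfold X in hnX; lra).
  assert (c1' : (1 <= n)%Z) by now apply le_IZR.
  assert (c2 : 2 * k * (r2 + 2) <= IZR n) by (unfold X in hnX; lra).
  assert (c3 : 7 < k * IZR n * be).
  { replace 7 with ((7 / (k * be)) * (k * be)) by (field; lra).
    replace (k * IZR n * be) with (IZR n * (k * be)) by ring.
    apply Rmult_lt_compat_r; [easy|]. unfold X in hnX; lra. }
  assert (c4 : 2 * (k * r2) <= IZR n) by lra.
  assert (hlt : 0 < k * r1 < k * r2) by (split; [now apply Rmult_lt_0_compat|now apply Rmult_lt_compat_l]).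
  assert (c4' : 2 * (k * r1) <= IZR n) by lra.
  pose proof (mode_response_nonzero k r1 n tr1 ti1 hk hr1 c1' c4' H1) as hF1.
  pose proof (mode_response_nonzero k r2 n tr2 ti2 hk ltac:(lra) c1' c4 H2) as hF2.
  destruct H1 as (a & a1 & b & b1 & h & ca & cb & ea & eb).
  destruct H2 as (a' & a1' & b' & b1' & h' & ca' & cb' & ea' & eb').
  pose proof (outgoing_restrict _ _ r1 r2 _ _ _ _ _ _ ltac:(lra) h) as hres.
  pose proof (outgoing_lin _ _ _ _ _ _ _ _ _ _ _ _ _ _ _ tr2 ti2 (- tr1) (- ti1) hres h') as hz.
  assert (hz' : outgoing k (IZR n) r2
    (fun t => (tr2 * a t - ti2 * b t) + (- tr1 * a' t - - ti1 * b' t))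
    (fun t => (tr2 * a1 t - ti2 * b1 t) + (- tr1 * a1' t - - ti1 * b1' t))
    (fun t => (tr2 * b t + ti2 * a t) + (- tr1 * b' t + - ti1 * a' t))
    (fun t => (tr2 * b1 t + ti2 * a1 t) + (- tr1 * b1' t + - ti1 * a1' t)) 0 0).
  { replace 0 with ((tr2 * tr1 - ti2 * ti1) + (- tr1 * tr2 - - ti1 * ti2)) at 1 by ring.
    replace 0 with ((tr2 * ti1 + ti2 * tr1) + (- tr1 * ti2 + - ti1 * tr2)) by ring. exact hz. }
  pose proof (zero_of_far_zero _ _ _ _ _ _ _ hk (Rlt_le _ _ (Rlt_trans _ _ _ hr1 hr12)) c1 hz') as Z.
  assert (cont : forall y y1, solves k (IZR n) r1 y y1 -> right_continuous y r2).
  { intros y y1 hs. apply right_continuous_of_continuous.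
    apply (ex_derive_continuous (V:=R_NormedModule)). exists (y1 r2). exact (proj1 (hs r2 hr12)). }
  pose proof (cont _ _ (og_re _ _ _ _ _ _ _ _ _ h)) as ca2.
  pose proof (cont _ _ (og_im _ _ _ _ _ _ _ _ _ h)) as cb2.
  assert (E1 : (tr2 * a r2 - ti2 * b r2) + (- tr1 * a' r2 - - ti1 * b' r2) = 0).
  { apply (right_limit_unique (fun t => (tr2 * a t - ti2 * b t) + (- tr1 * a' t - - ti1 * b' t)) r2 0 1); [|lra|intros; apply Z; lra].
    refine (right_continuous_ext _ _ r2 _ (right_continuous_lin a b a' b' tr2 (-ti2) (-tr1) ti1 r2 ca2 cb2 ca' cb')).
    intros; ring. }
  assert (E2 : (tr2 * b r2 + ti2 * a r2) + (- tr1 * b' r2 + - ti1 * a' r2) = 0).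
  { apply (right_limit_unique (fun t => (tr2 * b t + ti2 * a t) + (- tr1 * b' t + - ti1 * a' t)) r2 0 1); [|lra|intros; apply Z; lra].
    refine (right_continuous_ext _ _ r2 _ (right_continuous_lin a b a' b' ti2 tr2 (-ti1) (-tr1) r2 ca2 cb2 ca' cb')).
    intros; ring. }
  assert (E : a r2 ^ 2 + b r2 ^ 2 = a' r2 ^ 2 + b' r2 ^ 2).
  { apply (Rmult_eq_reg_l (tr2^2 + ti2^2)); [|lra].
    transitivity ((tr2 * a r2 - ti2 * b r2)^2 + (tr2 * b r2 + ti2 * a r2)^2); [ring|].
    replace (tr2 * a r2 - ti2 * b r2) with (tr1 * a' r2 - ti1 * b' r2) by lra.
    replace (tr2 * b r2 + ti2 * a r2) with (tr1 * b' r2 + ti1 * a' r2) by lra.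
    rewrite <- he. ring. }
  pose proof (sqmod_decreases k (IZR n) r1 a a1 b b1 tr1 ti1 hk ltac:(lra) c1 h r2 hr12 c2 c3 hF1) as D.
  assert (D1 : a r2 ^ 2 + b r2 ^ 2 <= a r1 ^ 2 + b r1 ^ 2).
  { apply (right_limit_ge (fun x => a x ^ 2 + b x ^ 2) r1 _ (r2 - r1)); [|lra|].
    - apply (right_continuous_ext (fun x => a x * a x + b x * b x)); [intros; ring|].
      apply right_continuous_plus; now apply right_continuous_mult.
    - intros x hx. apply Rlt_le, D. lra. }
  assert (hs1 : sqrt r1 ^ 2 = r1) by (apply pow2_sqrt; lra).
  assert (hs2 : sqrt r2 ^ 2 = r2) by (apply pow2_sqrt; lra).
  assert (V1 : k * (a r1 ^ 2 + b r1 ^ 2) = k * r1 * jre n (k * r1) ^ 2 + k * r1 * jim n (k * r1) ^ 2).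
  { rewrite ea, eb. transitivity (k * sqrt r1 ^ 2 * (jre n (k * r1) ^ 2 + jim n (k * r1) ^ 2)); [ring|].
    rewrite hs1. ring. }
  assert (V2 : k * (a r2 ^ 2 + b r2 ^ 2) = k * r2 * jre n (k * r2) ^ 2 + k * r2 * jim n (k * r2) ^ 2).
  { rewrite E, ea', eb'. transitivity (k * sqrt r2 ^ 2 * (jre n (k * r2) ^ 2 + jim n (k * r2) ^ 2)); [ring|].
    rewrite hs2. ring. }
  assert (V3 : k * r2 * jre n (k * r2) ^ 2 + k * r2 * jim n (k * r2) ^ 2 <= k * r1 * jre n (k * r1) ^ 2 + k * r1 * jim n (k * r1) ^ 2).
  { rewrite <- V1, <- V2. apply Rmult_le_compat_l; lra. }
  assert (0 <= k * r2 * jre n (k * r2) ^ 2) by (apply Rmult_le_pos; [lra|apply pow2_ge_0]).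
  assert (0 <= k * r2 * jim n (k * r2) ^ 2) by (apply Rmult_le_pos; [lra|apply pow2_ge_0]).
  destruct (wave_coef_increasing 0 n _ _ c1' hlt c4) as [z1|z1];
  destruct (wave_coef_increasing (- (PI / 2)) n _ _ c1' hlt c4) as [z2|z2]; try rewrite z1 in *; try rewrite z2 in *; try lra.
  apply (wave_coef_nonzero n (k * r1)); auto; nra.
Qed.

(** The raising recurrence [J_(n+1) = n J_n / x - J_n'], up to sign, in
   Liouville's form; at infinity only the derivative counts, hence the factor [i
   k]. *)
Lemma outgoing_raise k n r a a1 b b1 fr fi :
  0 <= r -> outgoing k n r a a1 b b1 fr fi ->
  outgoing k (n + 1) r
    (fun x => a1 x - (n + / 2) / x * a x)
    (fun x => - potential k n x * a x + (n + / 2) / x^2 * a x - (n + / 2) / x * a1 x)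
    (fun x => b1 x - (n + / 2) / x * b x)
    (fun x => - potential k n x * b x + (n + / 2) / x^2 * b x - (n + / 2) / x * b1 x)
    (- k * fi) (k * fr).
Proof.
  intros hr ho.
  pose proof (outgoing_lim_re1 _ _ _ _ _ _ _ _ _ hr ho) as l1.
  pose proof (outgoing_lim_im1 _ _ _ _ _ _ _ _ _ hr ho) as l2.
  destruct ho as [sa sb la lb].
  assert (S : forall y y1, solves k n r y y1 -> solves k (n + 1) r
    (fun x => y1 x - (n + / 2) / x * y x)
    (fun x => - potential k n x * y x + (n + / 2) / x^2 * y x - (n + / 2) / x * y1 x)).
  { intros y y1 hs x hx. destruct (hs x hx) as [d1 d2].
    assert (D : is_derive (fun x => (n + / 2) / x) x (- (n + / 2) / x^2)).
    { auto_derive; [lra|]. field; lra. }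
    split.
    - eapply is_derive_eq; [apply is_derive_Rminus; [exact d2|apply is_derive_Rmult; [exact D|exact d1]]|].
      field; lra.
    - eapply is_derive_eq.
      + apply is_derive_Rminus; [apply is_derive_Rplus|]; apply is_derive_Rmult;
          [|exact d1| |exact d1|exact D|exact d2].
        * unfold potential. auto_derive; [nra|reflexivity].
        * auto_derive; [nra|reflexivity].
      + unfold potential. field. lra. }
  assert (V : forall y al be, vanishes (fun x => y x - (al * cos (k * x) + be * sin (k * x))) ->
     vanishes (fun x => (n + / 2) / x * y x)).
  { intros y al be hv.
    destruct (bounded_of_vanishes _ _ _ hv (fun x => trig_bound al be (k * x))) as [M hM].
    apply (vanishes_ext (fun x => y x * ((n + / 2) * / x)) _ 0).
    - intros; unfold Rdiv; ring.
    - apply (vanishes_bounded_mult _ _ (Rabs al + Rabs be + 1) M); [|exact hM]. apply vanishes_scal, vanishes_inv. }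
  split; auto.
  - assert (va : vanishes (fun x => (n + / 2) / x * a x)).
    { apply (V a fr (- fi)). refine (vanishes_ext _ _ 0 _ la). intros; ring. }
    refine (vanishes_ext _ _ 0 _ (vanishes_plus _ _ l1 (vanishes_scal _ (-1) va))). intros; ring.
  - assert (vb : vanishes (fun x => (n + / 2) / x * b x)).
    { apply (V b fi fr). refine (vanishes_ext _ _ 0 _ lb). intros; ring. }
    refine (vanishes_ext _ _ 0 _ (vanishes_plus _ _ l2 (vanishes_scal _ (-1) vb))). intros; ring.
Qed.

(** Amplitudes of consecutive high modes are never real multiples of one another.
   Otherwise, with [v] and [w] the two modes, [outgoing_raise] and uniqueness
   make [v'] a real multiple of [v] plus an imaginary multiple of [w]; at the
   circle [v] and [w] are real multiples of [i^n] and [i^(n+1)], so the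
   Wronskian of [v] with its conjugate would tend to zero there, against
   [outgoing_wronskian]. *)
Lemma mode_response_consecutive k r n fr fi gr gi :
  0 < k -> 0 < r -> (1 <= n)%Z -> 2 * (k * r) <= IZR n ->
  mode_response k r n fr fi -> mode_response k r (n + 1) gr gi ->
  fi * gr - fr * gi = 0 -> False.
Proof.
  intros hk hr hn1 hn H1 H2 hreal.
  pose proof (mode_response_nonzero _ _ _ _ _ hk hr hn1 hn H1) as hF.
  assert (hG : 0 < gr^2 + gi^2).
  { refine (mode_response_nonzero k r (n+1) gr gi hk hr _ _ H2); [lia|rewrite plus_IZR; lra]. }
  destruct H1 as (a & a1 & b & b1 & h & ca & cb & ea & eb).
  destruct H2 as (c & c1 & d & d1 & h' & cc & cd & ec & ed).
  rewrite plus_IZR in h'.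
  pose proof (outgoing_raise _ _ _ _ _ _ _ _ _ (Rlt_le _ _ hr) h) as hw.
  set (N := IZR n) in *.
  (* with f, g the two amplitudes, the combination i k f w - g (raised v) has amplitude zero *)
  pose proof (outgoing_lin _ _ _ _ _ _ _ _ _ _ _ _ _ _ _ (- k * fi) (k * fr) (- gr) (- gi) h' hw) as hz.
  match type of hz with outgoing _ _ _ ?A ?A1 ?B ?B1 ?x ?y => 
    assert (hz' : outgoing k (N + 1) r A A1 B B1 0 0) end.
  { replace 0 with (- k * fi * gr - k * fr * gi + (- gr * (- k * fi) - - gi * (k * fr))) at 1 by ring.
    replace 0 with (- k * fi * gi + k * fr * gr + (- gr * (k * fr) + - gi * (- k * fi))) by ring. exact hz. }
  assert (hN : 1 <= N) by now apply (IZR_le 1).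
  assert (hN' : 1 <= N + 1) by lra.
  pose proof (zero_of_far_zero _ _ _ _ _ _ _ hk (Rlt_le _ _ hr) hN' hz') as Z.
  cbv beta in Z.
  set (la := (fr * gr + fi * gi) / (gr^2 + gi^2)).
  assert (f1 : fr = la * gr).
  { unfold la. apply (Rmult_eq_reg_r (gr^2 + gi^2)); [|lra]. 
    transitivity ((fr * gr + fi * gi) * gr - gi * (fi * gr - fr * gi)); [ring|].
    rewrite hreal. field. lra. }
  assert (f2 : fi = la * gi).
  { unfold la. apply (Rmult_eq_reg_r (gr^2 + gi^2)); [|lra].
    transitivity ((fr * gr + fi * gi) * gi + gr * (fi * gr - fr * gi)); [ring|].
    rewrite hreal. field. lra. }
  assert (W : forall x, r < x -> a x * c x + b x * d x = (gr^2 + gi^2) * la).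
  { intros x hx.
    pose proof (outgoing_wronskian _ _ _ _ _ _ _ _ _ x (Rlt_le _ _ hr) h hx) as w.
    destruct (Z x hx) as [z1 z2].
    set (u := a1 x - (N + / 2) / x * a x) in *. set (v := b1 x - (N + / 2) / x * b x) in *.
    assert (w' : a x * v - u * b x = k * (fr^2 + fi^2)) by (rewrite <- w; unfold u, v; ring).
    assert (hla : la <> 0). { intro e. rewrite e in f1, f2. nra. }
    assert (eu : u = - k * la * d x).
    { apply (Rmult_eq_reg_l (gr^2 + gi^2)); [|lra].
      rewrite f1, f2 in z1, z2.
      transitivity (gr * (gr * u - gi * v) + gi * (gr * v + gi * u)); [ring|].
      replace (gr * u - gi * v) with (- k * (la * gi) * c x - k * (la * gr) * d x) by lra.
      replace (gr * v + gi * u) with (- k * (la * gi) * d x + k * (la * gr) * c x) by lra.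
      ring. }
    assert (ev : v = k * la * c x).
    { apply (Rmult_eq_reg_l (gr^2 + gi^2)); [|lra].
      rewrite f1, f2 in z1, z2.
      transitivity (gr * (gr * v + gi * u) - gi * (gr * u - gi * v)); [ring|].
      replace (gr * u - gi * v) with (- k * (la * gi) * c x - k * (la * gr) * d x) by lra.
      replace (gr * v + gi * u) with (- k * (la * gi) * d x + k * (la * gr) * c x) by lra.
      ring. }
    rewrite eu, ev, f1, f2 in w'.
    apply (Rmult_eq_reg_l (k * la)); [|apply Rmult_integral_contrapositive; split; lra].
    transitivity (k * ((la * gr) ^ 2 + (la * gi) ^ 2)); [|ring]. rewrite <- w'. ring. }
  assert (L : a r * c r + b r * d r = (gr^2 + gi^2) * la).
  { apply (right_limit_unique (fun x => a x * c x + b x * d x) r _ 1); [|lra|intros; apply W; lra].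
    apply right_continuous_plus; now apply right_continuous_mult. }
  pose proof (wave_coef_consecutive_orthogonal n (k * r)) as o.
  rewrite ea, eb, ec, ed in L.
  assert (la = 0).
  { apply (Rmult_eq_reg_l (gr^2 + gi^2)); [|lra]. rewrite <- L.
    transitivity (sqrt r * sqrt r * (jre n (k * r) * jre (n + 1) (k * r) + jim n (k * r) * jim (n + 1) (k * r))); [ring|].
    rewrite o. ring. }
  rewrite H in f1, f2. nra.
Qed.

(** * Uniqueness of Fourier coefficients *)

Definition periodic (g : R -> R) : Prop := forall t, g (t + 2 * PI) = g t.

Lemma cos_Z_periodic (n : Z) (s : R) : periodic (fun t => cos (IZR n * t + s)).
Proof.
  intros t. replace (IZR n * (t + 2 * PI) + s) with ((IZR n * t + s) + IZR n * (2 * PI)) by ring.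
  rewrite cos_plus, sin_Z_2PI.
  replace (IZR n * (2 * PI)) with (2 * (IZR n * PI)) by ring.
  rewrite cos_2a_sin.
  replace (sin (IZR n * PI)) with 0; [ring|]. symmetry. apply sin_eq_0_1. now exists n.
Qed.

Lemma cts_bounded g a b : a <= b -> cts g -> exists M, forall t, a <= t <= b -> Rabs (g t) <= M.
Proof.
  intros hab hg.
  destruct (continuity_ab_maj (fun t => Rabs (g t)) a b hab) as [c [hc _]].
  - intros x _. apply continuity_pt_filterlim. apply (continuous_comp g Rabs); [apply hg|].
    apply continuity_pt_filterlim, Rcontinuity_abs.
  - exists (Rabs (g c)). exact hc.
Qed.

Lemma RInt_ge_const g a b m : a <= b -> cts g -> (forall t, a < t < b -> m <= g t) -> m * (b - a) <= RInt g a b.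
Proof.
  intros hab hg hm.
  replace (m * (b - a)) with (RInt (fun _ => m) a b).
  - apply RInt_le; auto; apply cts_ex_RInt; auto. apply cts_const.
  - rewrite (RInt_const (V:=R_CompleteNormedModule)). unfold scal; simpl; unfold mult; simpl; ring.
Qed.

Lemma cts_pow f m : cts f -> cts (fun t => f t ^ m).
Proof.
  intros hf. induction m as [|m IH]; simpl; [apply cts_const|now apply cts_mult].
Qed.

Lemma fourier_kernel_orthogonal h : cts h ->
  (forall (n : Z) s, circ (fun t => h t * cos (IZR n * t + s)) = 0) ->
  forall m (n : Z) s, circ (fun t => h t * (1 - cos t) ^ m * cos (IZR n * t + s)) = 0.
Proof.
  intros hc hz. 
  assert (hk : cts (fun t => 1 - cos t)) by (apply cts_derive; intros; auto_derive; easy).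
  induction m as [|m IH]; intros n s.
  - rewrite <- (hz n s). apply circ_ext. intros; simpl; ring.
  - set (w := fun (l : Z) t => h t * (1 - cos t) ^ m * cos (IZR l * t + s)).
    assert (hw : forall l, cts (w l)).
    { intros l. unfold w. apply cts_mult; [|apply cts_cos_lin]. apply cts_mult; [easy|now apply cts_pow]. }
    transitivity (circ (fun t => w n t - / 2 * (w (n + 1)%Z t + w (n - 1)%Z t))).
    + apply circ_ext. intros t. unfold w. rewrite plus_IZR, minus_IZR.
      replace ((IZR n + 1) * t + s) with (IZR n * t + s + t) by ring.
      replace ((IZR n - 1) * t + s) with (IZR n * t + s - t) by ring.
      set (u := IZR n * t + s). rewrite (cos_plus u), (cos_minus u). simpl. field.
    + rewrite circ_minus, circ_scal, circ_plus; try apply hw.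
      * unfold w. rewrite !IH. ring.
      * apply cts_plus; apply hw.
      * apply (cts_mult (fun _ => / 2)); [apply cts_const|apply cts_plus; apply hw].
Qed.

(** If [h] were positive at [pi], its integral against [(1 - cos t)^m] would be
   positive for large [m], as these kernels concentrate at [pi]: on the arc of
   half-width [d / 2] they exceed [mu^m], off the arc of half-width [d] they are
   at most [la^m], and [la < mu]. *)
Lemma fourier_nonpositive h : cts h ->
  (forall (n : Z) s, circ (fun t => h t * cos (IZR n * t + s)) = 0) -> h PI <= 0.
Proof.
  intros hc hz. apply Rnot_lt_le; intros hpos.
  pose proof PI_RGT_0 as hpi. pose proof PI2_1 as hpi2.
  destruct (cts_bounded h 0 (2 * PI) ltac:(lra) hc) as [M hM].
  assert (hM0 : 0 <= M) by (eapply Rle_trans; [apply Rabs_pos|apply (hM PI); lra]).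
  destruct (continuous_small h PI (hc PI) (h PI / 2) ltac:(lra)) as [d0 [hd0 hnear]].
  set (d := Rmin d0 1).
  assert (0 < d /\ d <= d0 /\ d <= 1) as (e1 & e2 & e3).
  { unfold d. split; [apply Rmin_pos; lra|]. split; [apply Rmin_l|apply Rmin_r]. }
  assert (hk : forall t, 1 - cos t = 1 + cos (Rabs (t - PI))).
  { intros t. assert (cos (t - PI) = - cos t) by (rewrite cos_minus, cos_PI, sin_PI; ring).
    unfold Rabs. destruct (Rcase_abs (t - PI)); [rewrite cos_neg|]; lra. }
  set (la := 1 + cos d). set (mu := 1 + cos (d / 2)).
  assert (hla : 1 < la). { unfold la. pose proof (cos_gt_0 d). lra. }
  assert (hmu : la < mu). { unfold la, mu. pose proof (cos_decreasing_1 (d/2) d). lra. }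
  set (a := h PI) in *.
  assert (key : forall m, a / 2 * mu ^ m * d <= M * la ^ m * (2 * PI)).
  { intros m.
    set (F := fun t => h t * (1 - cos t) ^ m).
    assert (hF : cts F).
    { apply cts_mult; [easy|]. apply cts_pow, cts_derive; intros; auto_derive; easy. }
    assert (h0 : RInt F 0 (2 * PI) = 0).
    { transitivity (circ (fun t => h t * (1 - cos t) ^ m * cos (IZR 0 * t + 0))); [|now apply fourier_kernel_orthogonal]. apply circ_ext. intros t.
      unfold F. rewrite Rmult_0_l, Rplus_0_r, cos_0. ring. }
    rewrite (RInt_split F 0 (PI - d/2)), (RInt_split F (PI - d/2) (PI + d/2)) in h0 by easy.
    assert (hpl : 0 < la ^ m) by (apply pow_lt; lra).
    assert (out : forall t, 0 <= t <= 2 * PI -> - (M * la ^ m) <= F t).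
    { intros t ht. unfold F.
      assert (hk0 : 0 <= 1 - cos t) by (pose proof (COS_bound t); lra).
      assert (hkm : 0 <= (1 - cos t) ^ m) by now apply pow_le.
      destruct (Rlt_dec (Rabs (t - PI)) d) as [hn|hf].
      - specialize (hnear t ltac:(lra)). apply Rabs_def2 in hnear.
        assert (0 <= h t * (1 - cos t)^m) by (apply Rmult_le_pos; lra).
        assert (0 <= M * la ^ m) by (apply Rmult_le_pos; lra). lra.
      - assert (hkl : 1 - cos t <= la).
        { rewrite hk. unfold la. apply Rplus_le_compat_l.
          assert (Rabs (t - PI) <= PI) by (apply Rabs_le; lra).
          destruct (Req_dec d (Rabs (t - PI))) as [<-|]; [lra|].
          apply Rlt_le, cos_decreasing_1; lra. }
        assert ((1 - cos t)^m <= la ^ m) by (apply pow_incr; lra).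
        specialize (hM t ht). apply Rabs_le_between in hM.
        assert (M * (1 - cos t)^m <= M * la^m) by (apply Rmult_le_compat_l; lra).
        assert (- M * (1 - cos t)^m <= h t * (1 - cos t)^m) by (apply Rmult_le_compat_r; lra).
        lra. }
    pose proof (RInt_ge_const F 0 (PI - d/2) (- (M * la^m)) ltac:(lra) hF (fun t ht => out t ltac:(lra))) as i1.
    pose proof (RInt_ge_const F (PI + d/2) (2 * PI) (- (M * la^m)) ltac:(lra) hF (fun t ht => out t ltac:(lra))) as i3.
    assert (i2 : a / 2 * mu ^ m * ((PI + d/2) - (PI - d/2)) <= RInt F (PI - d/2) (PI + d/2)).
    { apply RInt_ge_const; [lra|easy|]. intros t ht. unfold F.
      assert (hn : Rabs (t - PI) < d / 2) by (apply Rabs_def1; lra).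
      specialize (hnear t ltac:(lra)). apply Rabs_def2 in hnear.
      assert (mu ^ m <= (1 - cos t) ^ m).
      { apply pow_incr. split; [lra|]. rewrite hk. unfold mu. apply Rplus_le_compat_l.
        apply Rlt_le, cos_decreasing_1; try lra. apply Rabs_pos. }
      apply Rmult_le_compat; try lra. apply pow_le; lra. }
    assert (0 <= M * la ^ m) by (apply Rmult_le_pos; lra).
    nra. }
  assert (hq : Rabs (mu / la) > 1).
  { rewrite Rabs_pos_eq by (apply Rlt_le, Rdiv_lt_0_compat; lra).
    apply (Rmult_lt_reg_r la); [lra|]. unfold Rdiv. rewrite Rmult_assoc, Rinv_l; lra. }
  assert (had : 0 < a / 2 * d) by (apply Rmult_lt_0_compat; lra).
  destruct (Pow_x_infinity _ hq (M * (2 * PI) / (a / 2 * d) + 1)) as [N hN].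
  specialize (hN N (le_n N)). specialize (key N).
  assert (hlN : 0 < la ^ N) by (apply pow_lt; lra).
  rewrite Rabs_pos_eq in hN by (apply pow_le, Rlt_le, Rdiv_lt_0_compat; lra).
  unfold Rdiv at 1 in hN. rewrite Rpow_mult_distr, pow_inv in hN.
  assert (mu ^ N * / la ^ N <= M * (2 * PI) / (a / 2 * d)).
  { apply (Rmult_le_reg_r (a / 2 * d * la ^ N)); [now apply Rmult_lt_0_compat|].
    replace (mu ^ N * / la ^ N * (a / 2 * d * la ^ N)) with (a / 2 * mu ^ N * d) by (field; lra).
    replace (M * (2 * PI) / (a / 2 * d) * (a / 2 * d * la ^ N)) with (M * la ^ N * (2 * PI)) by (field; lra).
    exact key. }
  lra.
Qed.

(** A translation carries the given point to [pi]. *)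
Lemma fourier_unique g : cts g -> periodic g ->
  (forall (n : Z) s, circ (fun t => g t * cos (IZR n * t + s)) = 0) -> forall t, g t = 0.
Proof.
  intros hg hp hz t0.
  set (h := fun t => g (t + (t0 - PI))).
  assert (hh : cts h).
  { apply (cts_comp (fun t => t + (t0 - PI)) g); [apply cts_derive; intros; auto_derive; easy|easy]. }
  assert (hhz : forall (n : Z) s, circ (fun t => h t * cos (IZR n * t + s)) = 0).
  { intros n s. rewrite <- (hz n (s - IZR n * (t0 - PI))).
    rewrite <- (circ_shift (fun t => g t * cos (IZR n * t + (s - IZR n * (t0 - PI)))) (t0 - PI)).
    - apply circ_ext. intros t. unfold h. f_equal. f_equal. ring.
    - apply cts_mult; [easy|apply cts_cos_lin].
    - intros t. now rewrite hp, (cos_Z_periodic n). }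
  pose proof (fourier_nonpositive h hh hhz) as h1.
  assert (h2 : (fun t => -1 * h t) PI <= 0).
  { apply (fourier_nonpositive (fun t => -1 * h t)).
    - apply (cts_mult (fun _ => -1)); [apply cts_const|easy].
    - intros n s. transitivity (-1 * circ (fun t => h t * cos (IZR n * t + s))).
      + rewrite <- circ_scal by (apply cts_mult; [easy|apply cts_cos_lin]). apply circ_ext; intros; ring.
      + rewrite hhz; ring. }
  unfold h in h1, h2. replace (PI + (t0 - PI)) with t0 in h1, h2 by ring. lra.
Qed.

Lemma fourier_eq g g' : cts g -> cts g' -> periodic g -> periodic g' ->
  (forall (n : Z) s, circ (fun t => g t * cos (IZR n * t + s)) = circ (fun t => g' t * cos (IZR n * t + s))) ->
  forall t, g t = g' t.
Proof.
  intros hg hg' hp hp' h t. apply Rminus_diag_uniq.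
  apply (fourier_unique (fun t => g t - g' t)).
  - now apply cts_minus.
  - intros x. now rewrite hp, hp'.
  - intros n s. rewrite <- (Rminus_diag_eq _ _ (h n s)).
    rewrite <- circ_minus by (apply cts_mult; [easy|apply cts_cos_lin]). apply circ_ext; intros; ring.
Qed.

(** * Fourier modes of solutions of the Helmholtz equation *)

Definition polar (c : R * R) (rho t : R) : R * R :=
  (fst c + rho * cos t, snd c + rho * sin t).

Lemma edist_polar c rho t : 0 <= rho -> edist (polar c rho t) c = rho.
Proof.
  intros h. unfold edist, enorm, polar; simpl fst; simpl snd.
  pose proof (sin2_cos2 t) as e. unfold Rsqr in e.
  replace ((fst c + rho * cos t - fst c) ^ 2 + (snd c + rho * sin t - snd c) ^ 2)
    with (rho ^ 2 * (sin t * sin t + cos t * cos t)) by ring.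
  rewrite e, Rmult_1_r. now apply sqrt_pow2.
Qed.

Lemma polar_exterior Dk rho t : 0 < radius Dk -> radius Dk < rho -> exterior Dk (polar (center Dk) rho t).
Proof. intros h1 h2. unfold exterior. rewrite edist_polar; lra. Qed.

Lemma exterior_open Dk (x y : R) : exterior Dk (x, y) -> locally (x, y) (exterior Dk).
Proof.
  intros h. unfold exterior in h.
  assert (hc : continuity_2d_pt (fun u v => edist (u, v) (center Dk)) x y).
  { unfold edist, enorm; simpl fst; simpl snd.
    apply (continuity_1d_2d_pt_comp sqrt).
    - apply continuity_pt_sqrt. apply Rplus_le_le_0_compat; apply pow2_ge_0.
    - apply (continuity_2d_pt_ext (fun u v => (u - fst (center Dk)) * (u - fst (center Dk)) + (v - snd (center Dk)) * (v - snd (center Dk))));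
        [intros; simpl; ring|].
      unfold Rminus; continuity_2d. }
  assert (he : 0 < edist (x, y) (center Dk) - radius Dk) by lra.
  specialize (hc (mkposreal _ he)). cbn [pos] in hc.
  apply (proj1 (locally_2d_locally _ _ _)) in hc.
  assert (T : forall a b c : R, Rabs (a - b) < b - c -> c < a).
  { intros a b c H. apply Rabs_def2 in H. lra. }
  revert hc. apply filter_imp. intros [u v] H. exact (T _ _ _ H).
Qed.

Section Helmholtz.
Variables (Dk : disk) (k : R) (f : R * R -> R) (n : Z) (s : R).
Hypothesis hr : 0 < radius Dk.
Hypothesis hC2 : C2_on (exterior Dk) f.
Hypothesis hH : forall x, exterior Dk x -> laplacian f x + k ^ 2 * f x = 0.

Let c := center Dk.

Lemma C1_differentiable g x y : C1_on (exterior Dk) g -> exterior Dk (x, y) ->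
  differentiable_pt_lim (fun u v => g (u, v)) x y (partial1 g (x, y)) (partial2 g (x, y)).
Proof.
  intros hg hp. apply filterdiff_differentiable_pt_lim.
  apply (is_derive_filterdiff (fun u v => g (u, v)) x y (fun u v => partial1 g (u, v))).
  - generalize (exterior_open Dk _ _ hp). apply filter_imp. intros [u v] hu. simpl.
    destruct (hg _ hu) as [h1 _]. exact (Derive_correct _ _ h1).
  - destruct (hg _ hp) as (_ & h2 & _). exact (Derive_correct _ _ h2).
  - destruct (hg _ hp) as (_ & _ & h3 & _).
    apply (continuous_ext (partial1 g)); [now intros []|exact h3].
Qed.

Lemma C1_continuous g : C1_on (exterior Dk) g -> forall p, exterior Dk p -> continuous g p.
Proof.
  intros hg [x y] hp.
  assert (hd : differentiable_pt (fun u v => g (u, v)) x y).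
  { exists (partial1 g (x, y)), (partial2 g (x, y)). now apply C1_differentiable. }
  apply differentiable_continuity_pt in hd.
  apply continuity_2d_pt_filterlim in hd.
  apply (continuous_ext (fun z => g (fst z, snd z))); [now intros []|exact hd].
Qed.

Lemma chain_rule g X Y t dx dy :
  C1_on (exterior Dk) g -> exterior Dk (X t, Y t) -> is_derive X t dx -> is_derive Y t dy ->
  is_derive (fun u => g (X u, Y u)) t (partial1 g (X t, Y t) * dx + partial2 g (X t, Y t) * dy).
Proof.
  intros hg hp hx hy. apply is_derive_Reals.
  apply (derivable_pt_lim_comp_2d (fun u v => g (u, v)));
    [now apply C1_differentiable| |]; now apply is_derive_Reals.
Qed.

Lemma polar_derive_radius g rho t : C1_on (exterior Dk) g -> radius Dk < rho ->
  is_derive (fun u => g (polar c u t)) rho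
    (partial1 g (polar c rho t) * cos t + partial2 g (polar c rho t) * sin t).
Proof.
  intros hg h. apply (chain_rule g (fun u => fst c + u * cos t) (fun u => snd c + u * sin t)); auto.
  - now apply polar_exterior.
  - auto_derive; [easy|ring].
  - auto_derive; [easy|ring].
Qed.

Lemma polar_derive_angle g rho t : C1_on (exterior Dk) g -> radius Dk < rho ->
  is_derive (fun u => g (polar c rho u)) t
    (rho * (partial2 g (polar c rho t) * cos t - partial1 g (polar c rho t) * sin t)).
Proof.
  intros hg h. eapply is_derive_eq.
  - apply (chain_rule g (fun u => fst c + rho * cos u) (fun u => snd c + rho * sin u)); auto.
    + now apply polar_exterior.
    + auto_derive; [easy|reflexivity].
    + auto_derive; [easy|reflexivity].
  - unfold polar. ring.
Qed.

Lemma polar_continuity g rho t : radius Dk < rho -> (forall p, exterior Dk p -> continuous g p) ->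
  continuity_2d_pt (fun u v => g (polar c u v)) rho t.
Proof.
  intros h hg. apply continuity_2d_pt_filterlim.
  apply (continuous_comp_2 (fun z : R * R => fst c + fst z * cos (snd z)) (fun z : R * R => snd c + fst z * sin (snd z))
     (fun u v => g (u, v)) (rho, t)).
  - apply (proj1 (continuity_2d_pt_filterlim (fun u v => fst c + u * cos v) rho t)). continuity_2d.
  - apply (proj1 (continuity_2d_pt_filterlim (fun u v => snd c + u * sin v) rho t)). continuity_2d.
  - apply (continuous_ext g); [now intros []|]. apply hg. now apply polar_exterior.
Qed.

Lemma continuity_2d_pt_section (F : R -> R -> R) x y : continuity_2d_pt F x y -> continuous (F x) y.
Proof.
  intros h. apply (proj2 (filterlim_locally _ _)). intros eps.
  destruct (h eps) as [d hd]. exists d. intros v hv.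
  unfold ball; simpl; unfold AbsRing_ball, abs, minus, plus, opp; simpl.
  apply hd; [rewrite Rminus_diag_eq, Rabs_R0 by easy; apply cond_pos|exact hv].
Qed.

Let w t := cos (IZR n * t + s).
Let f1 := partial1 f.
Let f2 := partial2 f.
Let dr rho t := f1 (polar c rho t) * cos t + f2 (polar c rho t) * sin t.
Let drr rho t := (partial1 f1 (polar c rho t) * cos t + partial2 f1 (polar c rho t) * sin t) * cos t
  + (partial1 f2 (polar c rho t) * cos t + partial2 f2 (polar c rho t) * sin t) * sin t.
Let dt rho t := rho * (f2 (polar c rho t) * cos t - f1 (polar c rho t) * sin t).
Let dtt rho t := rho * (rho * (partial2 f2 (polar c rho t) * cos t - partial1 f2 (polar c rho t) * sin t) * cos t
  - rho * (partial2 f1 (polar c rho t) * cos t - partial1 f1 (polar c rho t) * sin t) * sin t) - rho * dr rho t.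

Definition mode (rho : R) : R := circ (fun t => f (polar c rho t) * w t).
Definition mode_dr (rho : R) : R := circ (fun t => dr rho t * w t).

Lemma mode_integrands_continuous :
  (forall rho t, radius Dk < rho -> continuity_2d_pt (fun u v => f (polar c u v) * w v) rho t) /\
  (forall rho t, radius Dk < rho -> continuity_2d_pt (fun u v => dr u v * w v) rho t) /\
  (forall rho t, radius Dk < rho -> continuity_2d_pt (fun u v => drr u v * w v) rho t) /\
  (forall rho t, radius Dk < rho -> continuity_2d_pt (fun u v => dtt u v * w v) rho t).
Proof.
  destruct hC2 as (h0 & h1 & h2).
  assert (hw : forall rho t, continuity_2d_pt (fun u v => w v) rho t) by (intros; unfold w; continuity_2d).
  assert (P : forall g, C1_on (exterior Dk) g -> forall rho t, radius Dk < rho ->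
     continuity_2d_pt (fun u v => g (polar c u v)) rho t /\
     continuity_2d_pt (fun u v => partial1 g (polar c u v)) rho t /\
     continuity_2d_pt (fun u v => partial2 g (polar c u v)) rho t).
  { intros g hg rho t h. repeat split; apply polar_continuity; auto.
    - now apply C1_continuous.
    - intros p hp. apply (hg p hp).
    - intros p hp. apply (hg p hp). }
  repeat split; intros rho t h; apply continuity_2d_pt_mult; auto;
    destruct (P f h0 rho t h) as (a1 & a2 & a3); destruct (P _ h1 rho t h) as (b1 & b2 & b3);
    destruct (P _ h2 rho t h) as (d1 & d2 & d3).
  - exact a1.
  - unfold dr. continuity_2d; assumption.
  - unfold drr. continuity_2d; assumption.
  - unfold dtt, dr, Rminus. continuity_2d; assumption.
Qed.

Lemma locally_gt (a x : R) : a < x -> locally x (fun y => a < y).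
Proof. intros h. exact (open_gt a x h). Qed.

Lemma mode_derive rho : radius Dk < rho -> is_derive mode rho (mode_dr rho).
Proof.
  intros h. destruct mode_integrands_continuous as (c0 & c1 & _ & _).
  apply (circ_param_derive (fun u t => f (polar c u t) * w t) (fun u t => dr u t * w t)).
  - generalize (locally_gt _ _ h). apply filter_imp. intros y hy t.
    eapply is_derive_eq; [apply is_derive_Rmult; [apply polar_derive_radius; [apply hC2|exact hy]|]|].
    + apply is_derive_Rconst.
    + unfold dr, f1, f2. ring.
  - intros t. now apply c1.
  - generalize (locally_gt _ _ h). apply filter_imp. intros y hy t.
    apply (continuity_2d_pt_section (fun u v => f (polar c u v) * w v)). now apply c0.
Qed.

Lemma mode_derive2 rho : radius Dk < rho ->
  is_derive mode_dr rho (- mode_dr rho / rho - (k ^ 2 - IZR n ^ 2 / rho ^ 2) * mode rho).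
Proof.
  intros h. destruct mode_integrands_continuous as (c0 & c1 & c2 & c3).
  destruct hC2 as (h0 & h1 & h2).
  assert (hD : is_derive mode_dr rho (circ (fun t => drr rho t * w t))).
  { apply (circ_param_derive (fun u t => dr u t * w t) (fun u t => drr u t * w t)).
    - generalize (locally_gt _ _ h). apply filter_imp. intros y hy t.
      eapply is_derive_eq.
      + apply is_derive_Rmult; [apply is_derive_Rplus; apply is_derive_Rmult|].
        * apply polar_derive_radius; [exact h1|exact hy].
        * apply is_derive_Rconst.
        * apply polar_derive_radius; [exact h2|exact hy].
        * apply is_derive_Rconst.
        * apply is_derive_Rconst.
      + unfold drr, f1, f2. ring.
    - intros t. now apply c2.
    - generalize (locally_gt _ _ h). apply filter_imp. intros y hy t.
      apply (continuity_2d_pt_section (fun u v => dr u v * w v)). now apply c1. }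
  eapply is_derive_eq; [exact hD|].
  assert (k0 : cts (fun t => f (polar c rho t) * w t)).
  { intros t. apply (continuity_2d_pt_section (fun u v => f (polar c u v) * w v)). now apply c0. }
  assert (k1 : cts (fun t => dr rho t * w t)).
  { intros t. apply (continuity_2d_pt_section (fun u v => dr u v * w v)). now apply c1. }
  assert (k2 : cts (fun t => drr rho t * w t)).
  { intros t. apply (continuity_2d_pt_section (fun u v => drr u v * w v)). now apply c2. }
  assert (k3 : cts (fun t => dtt rho t * w t)).
  { intros t. apply (continuity_2d_pt_section (fun u v => dtt u v * w v)). now apply c3. }
  (* two integrations by parts in the angle, as one total derivative *)
  assert (P1 : circ (fun t => dtt rho t * w t + IZR n ^ 2 * (f (polar c rho t) * w t)) = 0).
  { apply (circ_derive (fun t => dt rho t * w t + IZR n * (f (polar c rho t) * sin (IZR n * t + s)))).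
    - intros t. eapply is_derive_eq.
      + apply is_derive_Rplus; [apply is_derive_Rmult|apply is_derive_Rscal, is_derive_Rmult].
        * apply is_derive_Rscal. apply is_derive_Rminus; apply is_derive_Rmult.
          -- apply polar_derive_angle; [exact h2|exact h].
          -- auto_derive; [easy|reflexivity].
          -- apply polar_derive_angle; [exact h1|exact h].
          -- auto_derive; [easy|reflexivity].
        * unfold w. auto_derive; [easy|reflexivity].
        * apply polar_derive_angle; [exact h0|exact h].
        * auto_derive; [easy|reflexivity].
      + unfold dtt, dt, dr, w, f1, f2. ring.
    - apply cts_plus; [exact k3|]. apply (cts_mult (fun _ => IZR n ^ 2)); [apply cts_const|exact k0].
    - pose proof (cos_Z_periodic n s 0) as e1. pose proof (cos_Z_periodic n (s - PI / 2) 0) as e2.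
      cbv beta in e1, e2. rewrite Rplus_0_l in e1, e2.
      replace (IZR n * (2 * PI) + (s - PI / 2)) with (- (PI / 2 - (IZR n * (2 * PI) + s))) in e2 by ring.
      replace (IZR n * 0 + (s - PI / 2)) with (- (PI / 2 - (IZR n * 0 + s))) in e2 by ring.
      rewrite !cos_neg, !cos_shift in e2.
      unfold dt, w, polar. rewrite e1, e2, cos_2PI, sin_2PI, cos_0, sin_0. reflexivity. }
  rewrite circ_plus in P1; [|exact k3|apply (cts_mult (fun _ => IZR n ^ 2)); [apply cts_const|exact k0]].
  rewrite (circ_scal (IZR n ^ 2) (fun t => f (polar c rho t) * w t)) in P1 by exact k0.
  fold (mode rho) in P1.
  assert (P2 : circ (fun t => drr rho t * w t) = circ (fun t => (- / rho ^ 2) * (dtt rho t * w t)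
     + ((- / rho) * (dr rho t * w t) + (- k ^ 2) * (f (polar c rho t) * w t)))).
  { apply circ_ext. intros t.
    pose proof (hH _ (polar_exterior Dk rho t hr h)) as hh. unfold laplacian in hh.
    fold c f1 f2 in hh.
    pose proof (sin2_cos2 t) as e. unfold Rsqr in e.
    set (A := partial1 f1 (polar c rho t)) in *. set (B := partial2 f1 (polar c rho t)) in *.
    set (C := partial1 f2 (polar c rho t)) in *. set (D := partial2 f2 (polar c rho t)) in *.
    assert (hf : k^2 * f (polar c rho t) = - (A + D) * (sin t * sin t + cos t * cos t)) by (rewrite e; lra).
    transitivity (((- / rho ^ 2) * dtt rho t + (- / rho) * dr rho t - k^2 * f (polar c rho t)) * w t); [|ring].
    rewrite hf. unfold drr, dtt. fold A B C D. field. lra. }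
  rewrite P2.
  rewrite circ_plus, circ_plus.
  - pose proof (circ_scal (- / rho ^ 2) _ k3) as q1. pose proof (circ_scal (- / rho) _ k1) as q2.
    pose proof (circ_scal (- k ^ 2) _ k0) as q3. cbv beta in q1, q2, q3.
    rewrite q1, q2, q3. fold (mode rho) (mode_dr rho).
    replace (circ (fun t => dtt rho t * w t)) with (- (IZR n ^ 2 * mode rho)) by lra.
    field. lra.
  - apply (cts_mult (fun _ => - / rho)); [apply cts_const|exact k1].
  - apply (cts_mult (fun _ => - k ^ 2)); [apply cts_const|exact k0].
  - apply (cts_mult (fun _ => - / rho ^ 2)); [apply cts_const|exact k3].
  - apply cts_plus; [apply (cts_mult (fun _ => - / rho)); [apply cts_const|exact k1]|
     apply (cts_mult (fun _ => - k ^ 2)); [apply cts_const|exact k0]].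
Qed.

Lemma mode_solves :
  solves k (IZR n) (radius Dk) (fun x => sqrt x * mode x) (fun x => sqrt x * mode_dr x + / (2 * sqrt x) * mode x).
Proof.
  apply bessel_solves; [lra|intros; now apply mode_derive|intros; now apply mode_derive2].
Qed.

(** Extended by its boundary values along radii, the field is continuous in both
   polar variables, hence uniformly continuous near the boundary circle. *)
Lemma mode_right_continuous :
  (forall x, closed_exterior Dk x -> filterlim f (within (closed_exterior Dk) (locally x)) (locally (f x))) ->
  right_continuous mode (radius Dk) /\ (forall rho, radius Dk <= rho -> cts (fun t => f (polar c rho t))).
Proof.
  intros hc. set (r := radius Dk) in *.
  set (F := fun rho t => f (polar c (Rmax r rho) t)).
  assert (hF : forall rho t, continuity_2d_pt F rho t).
  { intros rho t.
    assert (hp : forall u v, closed_exterior Dk (polar c (Rmax r u) v)).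
    { intros u v. unfold closed_exterior, c. pose proof (Rmax_l r u).
      rewrite edist_polar by lra. exact H. }
    apply continuity_2d_pt_filterlim.
    assert (hm : forall u v, continuity_2d_pt (fun a _ => Rmax r a) u v).
    { intros u v eps. exists eps. intros a b h1 _.
      eapply Rle_lt_trans; [|exact h1]. unfold Rmax.
      pose proof (Rle_abs (a - u)) as m1. pose proof (Rle_abs (u - a)) as m2. rewrite (Rabs_minus_sym u a) in m2.
      destruct (Rle_dec r a), (Rle_dec r u); apply Rabs_le; lra. }
    assert (hg : continuous (fun z : R * R => polar c (Rmax r (fst z)) (snd z)) (rho, t)).
    { apply (continuous_comp_2 (fun z : R * R => fst c + Rmax r (fst z) * cos (snd z))
         (fun z : R * R => snd c + Rmax r (fst z) * sin (snd z)) (fun u v => (u, v)) (rho, t)).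
      - apply (proj1 (continuity_2d_pt_filterlim (fun u v => fst c + Rmax r u * cos v) rho t)).
        apply continuity_2d_pt_plus; [continuity_2d|]. apply continuity_2d_pt_mult; [apply hm|continuity_2d].
      - apply (proj1 (continuity_2d_pt_filterlim (fun u v => snd c + Rmax r u * sin v) rho t)).
        apply continuity_2d_pt_plus; [continuity_2d|]. apply continuity_2d_pt_mult; [apply hm|continuity_2d].
      - apply (continuous_ext (fun z => z)); [now intros []|apply continuous_id]. }
    unfold F. intros P hP. specialize (hc _ (hp rho t) P hP). unfold filtermap, within in hc.
    specialize (hg _ hc). unfold filtermap in *. revert hg. apply filter_imp.
    intros z hz. apply hz, hp. }
  split.
  - intros eps heps. pose proof PI_RGT_0 as hpi.
    assert (he : 0 < eps / (4 * PI)) by (apply Rdiv_lt_0_compat; lra).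
    destruct (uniform_continuity_2d_1d' F 0 (2 * PI) r (fun x _ => hF r x) (mkposreal _ he)) as [d hd].
    simpl in hd. pose proof (cond_pos d).
    exists d. split; [easy|]. intros x hx. unfold mode.
    assert (kc : forall rho, r <= rho -> cts (fun t => f (polar c rho t) * w t)).
    { intros rho h. apply cts_mult; [|apply cts_cos_lin]. intros t.
      apply (continuous_ext (F rho)); [intros; unfold F; now rewrite Rmax_right|].
      apply continuity_2d_pt_section, hF. }
    rewrite <- circ_minus by (apply kc; lra).
    apply Rle_lt_trans with (2 * PI * (eps / (4 * PI))).
    + unfold circ. replace (2 * PI * (eps / (4 * PI))) with ((2 * PI - 0) * (eps / (4 * PI))) by ring.
      apply abs_RInt_le_const; [lra|apply cts_ex_RInt, cts_minus; apply kc; lra|].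
      intros t ht. rewrite <- Rmult_minus_distr_r, Rabs_mult.
      specialize (hd t r t x ht ltac:(lra) ht ltac:(lra)).
      rewrite Rminus_diag_eq, Rabs_R0 in hd by easy. specialize (hd (cond_pos d)).
      unfold F in hd. rewrite (Rmax_right r x), (Rmax_left r r) in hd by lra.
      assert (Rabs (w t) <= 1) by (apply Rabs_le, COS_bound).
      pose proof (Rabs_pos (f (polar c x t) - f (polar c r t))). pose proof (Rabs_pos (w t)). nra.
    + replace (2 * PI * (eps / (4 * PI))) with (eps / 2) by (field; lra). lra.
  - intros rho h t. apply (continuous_ext (F rho)); [intros; unfold F; now rewrite Rmax_right|].
    apply continuity_2d_pt_section, hF.
Qed.
End Helmholtz.

(** * Moving the origin of the far field expansion *)

Lemma lipschitz_of_derive (f f' : R -> R) :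
  (forall t, is_derive f t (f' t)) -> (forall t, Rabs (f' t) <= 1) ->
  forall x y, Rabs (f x - f y) <= Rabs (x - y).
Proof.
  intros hd hb x y. destruct (MVT_gen f y x f') as [c [_ hc]].
  - intros t _. apply hd.
  - intros t _. apply continuity_pt_filterlim.
    apply (ex_derive_continuous (V:=R_NormedModule)). now exists (f' t).
  - rewrite hc, Rabs_mult. specialize (hb c). pose proof (Rabs_pos (x - y)). nra.
Qed.

Lemma cos_lipschitz x y : Rabs (cos x - cos y) <= Rabs (x - y).
Proof.
  apply (lipschitz_of_derive cos (fun t => - sin t)); intros t.
  - auto_derive; [easy|ring].
  - rewrite Rabs_Ropp. apply Rabs_le, SIN_bound.
Qed.

Lemma sin_lipschitz x y : Rabs (sin x - sin y) <= Rabs (x - y).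
Proof.
  apply (lipschitz_of_derive sin cos); intros t.
  - auto_derive; [easy|ring].
  - apply Rabs_le, COS_bound.
Qed.

Lemma Rabs_atan_le x : Rabs (atan x) <= Rabs x.
Proof.
  replace (atan x) with (atan x - atan 0) by (rewrite atan_0; ring).
  replace x with (x - 0) at 2 by ring.
  apply (lipschitz_of_derive atan (fun z => / (1 + z ^ 2))); intros t.
  - apply is_derive_Reals, derivable_pt_lim_atan.
  - pose proof (pow2_ge_0 t). rewrite Rabs_pos_eq by (apply Rlt_le, Rinv_0_lt_compat; lra).
    rewrite <- Rinv_1 at 2. apply Rinv_le_contravar; lra.
Qed.

Definition dirdot (c : R * R) (t : R) : R := fst c * cos t + snd c * sin t.

Lemma dirdot_bound c t : Rabs (dirdot c t) <= Rabs (fst c) + Rabs (snd c).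
Proof. apply trig_bound. Qed.

(** The point is [rho + c.t] along the direction [t], up to a bounded
   displacement across it; the change of angle is the arctangent of a quotient
   of order [1 / rho], and the distance to the origin exceeds [rho + c.t] by a
   term of the same order. *)
Lemma polar_recentre c rho t :
  let L := Rabs (fst c) + Rabs (snd c) in
  2 * L + 1 <= rho ->
  exists R del, polar c rho t = polar (0, 0) R (t + del) /\
    Rabs del <= 2 * L / rho /\ 0 <= R - (rho + dirdot c t) <= L ^ 2 / rho.
Proof.
  intros L hrho.
  pose proof (dirdot_bound c t) as hg. fold L in hg.
  set (g := dirdot c t) in *.
  set (e := snd c * cos t - fst c * sin t).
  assert (he : Rabs e <= L).
  { unfold e. pose proof (trig_bound (snd c) (- fst c) t) as h. rewrite Rabs_Ropp in h.
    replace (snd c * cos t - fst c * sin t) with (snd c * cos t + - fst c * sin t) by ring. unfold L; lra. }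
  assert (hL : 0 <= L) by (eapply Rle_trans; [apply Rabs_pos|exact he]).
  apply Rabs_le_between in hg.
  assert (hx : rho / 2 < rho + g) by lra.
  set (x := rho + g) in *.
  set (q := sqrt (1 + (e / x) ^ 2)).
  assert (hq0 : 0 < 1 + (e / x) ^ 2) by (pose proof (pow2_ge_0 (e / x)); lra).
  assert (hq : 0 < q) by now apply sqrt_lt_R0.
  assert (hq2 : q ^ 2 = 1 + (e / x)^2) by (apply pow2_sqrt; lra).
  exists (x * q), (atan (e / x)).
  assert (hsq : 1 + (e / x)² = 1 + (e / x) ^ 2) by (unfold Rsqr; ring).
  assert (hcos : cos (atan (e / x)) = / q).
  { rewrite cos_atan, hsq. fold q. field; lra. }
  assert (hsin : sin (atan (e / x)) = e / x / q).
  { rewrite sin_atan, hsq. fold q. field; lra. }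
  pose proof (sin2_cos2 t) as hsc. unfold Rsqr in hsc.
  split; [|split].
  - unfold polar; simpl fst; simpl snd. rewrite cos_plus, sin_plus, hcos, hsin. f_equal.
    + replace (0 + x * q * (cos t * / q - sin t * (e / x / q))) with (x * cos t - e * sin t) by (field; lra).
      unfold x, g, e, dirdot.
      transitivity (fst c * (sin t * sin t + cos t * cos t) + rho * cos t); [rewrite hsc; ring|ring].
    + replace (0 + x * q * (sin t * / q + cos t * (e / x / q))) with (x * sin t + e * cos t) by (field; lra).
      unfold x, g, e, dirdot.
      transitivity (snd c * (sin t * sin t + cos t * cos t) + rho * sin t); [rewrite hsc; ring|ring].
  - eapply Rle_trans; [apply Rabs_atan_le|]. unfold Rdiv at 1. rewrite Rabs_mult, Rabs_inv, (Rabs_pos_eq x) by lra.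
    apply (Rmult_le_reg_r (x * rho)); [nra|].
    replace (Rabs e * / x * (x * rho)) with (Rabs e * rho) by (field; lra).
    replace (2 * L / rho * (x * rho)) with (L * (2 * x)) by (field; lra).
    apply Rmult_le_compat; try lra. apply Rabs_pos.
  - assert (hR : (x * q)^2 = x^2 + e^2).
    { replace ((x * q)^2) with (x^2 * q^2) by ring. rewrite hq2. field. lra. }
    assert (hq1 : 1 <= q). { apply Rnot_lt_le; intro. assert (q^2 < 1) by nra. pose proof (pow2_ge_0 (e / x)). lra. }
    assert (x <= x * q) by nra.
    split; [lra|].
    apply (Rmult_le_reg_r (rho)); [lra|].
    replace (L ^ 2 / rho * rho) with (L ^ 2) by (field; lra).
    assert (e^2 <= L^2). { rewrite <- (pow2_abs e). apply pow_incr. split; [apply Rabs_pos|easy]. }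
    assert ((x * q - x) * (x * q + x) <= L^2) by nra.
    nra.
Qed.

Lemma heine P a b : cts P -> forall eps, 0 < eps -> exists d, 0 < d /\
  forall x y, a <= x <= b -> a <= y <= b -> Rabs (x - y) < d -> Rabs (P x - P y) < eps.
Proof.
  intros hP eps heps.
  destruct (unifcont_normed_1d (K:=R_AbsRing) (V:=R_NormedModule) P a b (fun x _ => hP x) (mkposreal eps heps)) as [d hd].
  exists d. split; [apply cond_pos|]. intros x y hx hy hxy.
  specialize (hd y x hy hx hxy). exact hd.
Qed.

(** To first order [|c + rho t| = rho + c.t], so seen from [c] the amplitude in
   the direction [t] acquires the phase [exp (i k c.t)]. The pair [P], [Q]
   stands for either component of the field. *)
Lemma far_field_recentre k g P Q K M c :
  0 < k -> 0 < M -> cts P -> cts Q ->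
  (forall R t, M < R -> Rabs (sqrt R * g (polar (0, 0) R t) - (P t * cos (k * R) + Q t * sin (k * R))) <= K / sqrt R) ->
  forall eps, 0 < eps -> exists M', forall rho t, M' < rho -> 0 <= t <= 2 * PI ->
    Rabs (sqrt rho * g (polar c rho t) -
      (P t * cos (k * (rho + dirdot c t)) + Q t * sin (k * (rho + dirdot c t)))) < eps.
Proof.
  intros hk hM hP hQ hg eps heps.
  set (L := Rabs (fst c) + Rabs (snd c)).
  assert (hL : 0 <= L) by (unfold L; pose proof (Rabs_pos (fst c)); pose proof (Rabs_pos (snd c)); lra).
  pose proof PI_RGT_0 as hpi.
  destruct (cts_bounded P 0 (2 * PI) ltac:(lra) hP) as [B1 hB1].
  destruct (cts_bounded Q 0 (2 * PI) ltac:(lra) hQ) as [B2 hB2].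
  assert (hB1' : 0 <= B1) by (eapply Rle_trans; [apply Rabs_pos|apply (hB1 0); lra]).
  assert (hB2' : 0 <= B2) by (eapply Rle_trans; [apply Rabs_pos|apply (hB2 0); lra]).
  set (e := Rmin 1 (eps / 8)).
  assert (0 < e /\ e <= 1 /\ 8 * e <= eps) as (e0 & e1 & e2).
  { unfold e. pose proof (Rmin_l 1 (eps/8)); pose proof (Rmin_r 1 (eps/8)).
    split; [apply Rmin_pos; lra|lra]. }
  destruct (heine P (-1) (2 * PI + 1) hP e e0) as [d1 [hd1 u1]].
  destruct (heine Q (-1) (2 * PI + 1) hQ e e0) as [d2 [hd2 u2]].
  set (d := Rmin 1 (Rmin d1 d2)).
  assert (0 < d /\ d <= 1 /\ d <= d1 /\ d <= d2) as (f0 & f1 & f2 & f3).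
  { unfold d. pose proof (Rmin_l 1 (Rmin d1 d2)); pose proof (Rmin_r 1 (Rmin d1 d2)).
    pose proof (Rmin_l d1 d2); pose proof (Rmin_r d1 d2).
    split; [repeat apply Rmin_pos; lra|lra]. }
  set (B := B1 + B2).
  set (C := B + 5).
  (* lower bounds for the radius that make each of the error terms small *)
  set (m1 := 2 * L + 1). set (m2 := 2 * M + 1). set (m3 := 2 * L / d).
  set (m4 := k * L ^ 2 * (B + 1) / e). set (m5 := 2 * (K / e) ^ 2 + 1).
  set (m6 := 2 * (L + L^2) * C / e).
  assert (h3 : 0 <= m3) by (apply Rdiv_le_0_compat; lra).
  assert (hkL : 0 <= k * L^2) by (apply Rmult_le_pos; [lra|apply pow2_ge_0]).
  assert (h4 : 0 <= m4) by (apply Rdiv_le_0_compat; [apply Rmult_le_pos; [easy|unfold B; lra]|lra]).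
  assert (h6 : 0 <= m6).
  { apply Rdiv_le_0_compat; [|lra]. apply Rmult_le_pos; [|unfold C, B; lra]. pose proof (pow2_ge_0 L). lra. }
  assert (h5 : 0 <= m5) by (unfold m5; pose proof (pow2_ge_0 (K / e)); lra).
  exists (m1 + m2 + m3 + m4 + m5 + m6). intros rho t hrho ht.
  assert (r1 : m1 < rho /\ m2 < rho /\ m3 < rho /\ m4 < rho /\ m5 < rho /\ m6 < rho) by (unfold m1, m2 in *; lra).
  destruct r1 as (r1 & r2 & r3 & r4 & r5 & r6).
  assert (hrho1 : 1 <= rho) by (unfold m1 in r1; lra).
  destruct (polar_recentre c rho t) as (R & del & hp & hdel & hR); [fold L; unfold m1 in r1; lra|].
  fold L in hdel, hR. rewrite hp.
  set (ga := dirdot c t) in *.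
  pose proof (dirdot_bound c t) as hga. fold L ga in hga. apply Rabs_le_between in hga.
  assert (hR2 : rho / 2 < R) by (unfold m1 in r1; lra).
  assert (hdel2 : Rabs del < d).
  { eapply Rle_lt_trans; [exact hdel|]. apply (Rmult_lt_reg_r (rho / d)); [apply Rdiv_lt_0_compat; lra|].
    replace (2 * L / rho * (rho / d)) with m3 by (unfold m3; field; lra).
    replace (d * (rho / d)) with rho by (field; lra). exact r3. }
  assert (hdel3 := hdel2). apply Rabs_def2 in hdel3.
  specialize (u1 (t + del) t ltac:(lra) ltac:(lra)). specialize (u2 (t + del) t ltac:(lra) ltac:(lra)).
  replace (t + del - t) with del in * by ring. specialize (u1 ltac:(lra)); specialize (u2 ltac:(lra)).
  specialize (hg R (t + del) ltac:(unfold m2 in r2; lra)).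
  assert (hKR : K / sqrt R < e).
  { assert (hs : 0 < sqrt R) by (apply sqrt_lt_R0; lra).
    apply (Rmult_lt_reg_r (sqrt R)); [easy|]. unfold Rdiv. rewrite Rmult_assoc, Rinv_l, Rmult_1_r by lra.
    apply Rnot_le_lt; intro hle.
    assert (R <= (K / e)^2).
    { replace R with (sqrt R ^ 2) by (apply pow2_sqrt; lra). apply pow_incr. split; [lra|].
      apply (Rmult_le_reg_l e); [easy|]. replace (e * (K / e)) with K by (field; lra). exact hle. }
    unfold m5 in r5. lra. }
  set (A := sqrt R * g (polar (0, 0) R (t + del))) in *.
  set (A1 := P (t + del) * cos (k * R) + Q (t + del) * sin (k * R)) in *.
  set (A0 := P t * cos (k * (rho + ga)) + Q t * sin (k * (rho + ga))).
  assert (hRe : Rabs (k * R - k * (rho + ga)) <= k * L^2 / rho).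
  { rewrite <- Rmult_minus_distr_l, Rabs_mult, (Rabs_pos_eq k), (Rabs_pos_eq (R - _)) by lra.
    replace (k * L^2 / rho) with (k * (L^2 / rho)) by (field; lra). apply Rmult_le_compat_l; lra. }
  assert (hRe2 : (B + 1) * (k * L^2 / rho) <= e).
  { apply (Rmult_le_reg_r (rho / e)); [apply Rdiv_lt_0_compat; lra|].
    replace ((B + 1) * (k * L ^ 2 / rho) * (rho / e)) with m4 by (unfold m4; field; lra).
    replace (e * (rho / e)) with rho by (field; lra). lra. }
  specialize (hB1 t ht). specialize (hB2 t ht).
  pose proof (cos_lipschitz (k * R) (k * (rho + ga))) as lc.
  pose proof (sin_lipschitz (k * R) (k * (rho + ga))) as ls.
  assert (cb : forall x, Rabs (cos x) <= 1) by (intro; apply Rabs_le, COS_bound).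
  assert (sb : forall x, Rabs (sin x) <= 1) by (intro; apply Rabs_le, SIN_bound).
  assert (PM : forall a b x y, Rabs a <= x -> Rabs b <= y -> Rabs (a * b) <= x * y).
  { intros a b x y h1 h2. rewrite Rabs_mult. apply Rmult_le_compat; auto using Rabs_pos. }
  assert (hA10 : Rabs (A1 - A0) <= 3 * e).
  { unfold A1, A0.
    replace (_ - _) with (((P (t + del) - P t) * cos (k * R) + (Q (t + del) - Q t) * sin (k * R))
      + (P t * (cos (k * R) - cos (k * (rho + ga))) + Q t * (sin (k * R) - sin (k * (rho + ga))))) by ring.
    eapply Rle_trans; [apply Rabs_triang|].
    pose proof (Rabs_triang ((P (t + del) - P t) * cos (k * R)) ((Q (t + del) - Q t) * sin (k * R))) as q1.
    pose proof (Rabs_triang (P t * (cos (k * R) - cos (k * (rho + ga)))) (Q t * (sin (k * R) - sin (k * (rho + ga))))) as q2.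
    pose proof (PM _ _ _ _ (Rlt_le _ _ u1) (cb (k * R))) as p1.
    pose proof (PM _ _ _ _ (Rlt_le _ _ u2) (sb (k * R))) as p2.
    pose proof (PM _ _ _ _ hB1 (Rle_trans _ _ _ lc hRe)) as p3.
    pose proof (PM _ _ _ _ hB2 (Rle_trans _ _ _ ls hRe)) as p4.
    assert (0 <= k * L^2 / rho) by (eapply Rle_trans; [apply Rabs_pos|exact hRe]).
    unfold B in hRe2. lra. }
  assert (hA0 : Rabs A0 <= B).
  { unfold A0. eapply Rle_trans; [apply Rabs_triang|].
    pose proof (PM _ _ _ _ hB1 (cb (k * (rho + ga)))) as p1.
    pose proof (PM _ _ _ _ hB2 (sb (k * (rho + ga)))) as p2. unfold B; lra. }
  assert (hAA0 : Rabs (A - A0) <= 4 * e).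
  { replace (A - A0) with ((A - A1) + (A1 - A0)) by ring. eapply Rle_trans; [apply Rabs_triang|]. lra. }
  assert (hA : Rabs A <= C).
  { replace A with ((A - A0) + A0) by ring. eapply Rle_trans; [apply Rabs_triang|]. unfold C; lra. }
  assert (hs : 0 < sqrt R) by (apply sqrt_lt_R0; lra).
  assert (hs' : 0 < sqrt rho) by (apply sqrt_lt_R0; lra).
  replace (sqrt rho * g (polar (0, 0) R (t + del))) with (A + (sqrt rho / sqrt R - 1) * A)
    by (unfold A; field; lra).
  replace (A + (sqrt rho / sqrt R - 1) * A - A0) with ((A - A0) + (sqrt rho / sqrt R - 1) * A) by ring.
  eapply Rle_lt_trans; [apply Rabs_triang|].
  assert (hratio : Rabs (sqrt rho / sqrt R - 1) <= 2 * (L + L^2) / rho).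
  { assert (sr : sqrt rho * sqrt rho = rho) by (apply sqrt_sqrt; lra).
    assert (sR : sqrt R * sqrt R = R) by (apply sqrt_sqrt; lra).
    replace (sqrt rho / sqrt R - 1) with ((rho - R) * / (sqrt R * (sqrt rho + sqrt R))).
    2:{ rewrite <- sr at 1. rewrite <- sR at 1. field. split; lra. }
    rewrite Rabs_mult, Rabs_inv, (Rabs_pos_eq (sqrt R * _)) by nra.
    assert (L^2 / rho <= L^2).
    { apply (Rmult_le_reg_r rho); [lra|]. replace (L^2 / rho * rho) with (L^2) by (field; lra).
      pose proof (pow2_ge_0 L). nra. }
    assert (hd : Rabs (rho - R) <= L + L^2) by (apply Rabs_le; lra).
    replace (2 * (L + L^2) / rho) with ((L + L^2) * / (rho / 2)) by (field; lra).
    apply Rmult_le_compat; [apply Rabs_pos| |exact hd|].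
    - apply Rlt_le, Rinv_0_lt_compat; nra.
    - apply Rinv_le_contravar; [lra|]. nra. }
  pose proof (PM _ _ _ _ hratio hA) as p.
  assert (2 * (L + L ^ 2) / rho * C <= e).
  { apply (Rmult_le_reg_r (rho / e)); [apply Rdiv_lt_0_compat; lra|].
    replace (2 * (L + L ^ 2) / rho * C * (rho / e)) with m6 by (unfold m6; field; lra).
    replace (e * (rho / e)) with rho by (field; lra). lra. }
  lra.
Qed.

(** * The modes of a scattered field are outgoing *)

Definition direction (t : R) : R * R := (cos t, sin t).

Lemma unit_direction t : unit_vector (direction t).
Proof.
  unfold unit_vector, enorm, direction; simpl fst; simpl snd.
  replace (cos t ^ 2 + sin t ^ 2) with 1; [apply sqrt_1|].
  rewrite <- (sin2_cos2 t). unfold Rsqr. ring.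
Qed.

Lemma unit_vector_direction d : unit_vector d -> exists t, d = direction t.
Proof.
  destruct d as [x y]. unfold unit_vector, enorm; simpl fst; simpl snd. intros h.
  assert (h1 : x ^ 2 + y ^ 2 = 1).
  { pose proof (pow2_ge_0 x); pose proof (pow2_ge_0 y).
    rewrite <- (pow2_sqrt (x^2 + y^2)) by lra. rewrite h. ring. }
  assert (hx : -1 <= x <= 1) by nra.
  assert (hs : sin (acos x) = Rabs y).
  { rewrite sin_acos by easy. rewrite <- sqrt_Rsqr_abs. f_equal. unfold Rsqr. lra. }
  unfold direction. destruct (Rle_dec 0 y) as [hy|hy].
  - exists (acos x). rewrite cos_acos, hs, Rabs_pos_eq; auto.
  - exists (- acos x). rewrite cos_neg, sin_neg, cos_acos, hs, Rabs_left1 by lra. f_equal; ring.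
Qed.

Lemma enorm_polar R t : 0 <= R -> enorm (polar (0, 0) R t) = R.
Proof.
  intros h. rewrite <- (edist_polar (0, 0) R t h) at 2. unfold edist. f_equal.
  unfold polar; simpl. f_equal; ring.
Qed.

Lemma im_le_Cmod z : Rabs (Im z) <= Cmod z.
Proof. eapply Rle_trans; [apply Rmax_r|apply Rmax_Cmod]. Qed.

Lemma Cmod_expi t : Cmod (expi t) = 1.
Proof.
  unfold Cmod, expi; simpl fst; simpl snd.
  replace (cos t ^ 2 + sin t ^ 2) with 1; [apply sqrt_1|].
  rewrite <- (sin2_cos2 t). unfold Rsqr. ring.
Qed.

Lemma far_field_components k u uinf : has_far_field k u uinf ->
  exists K M, 0 < M /\ forall R t, M < R ->
    Rabs (sqrt R * Re (u (polar (0, 0) R t)) -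
      (Re (uinf (direction t)) * cos (k * R) + - Im (uinf (direction t)) * sin (k * R))) <= K / sqrt R /\
    Rabs (sqrt R * Im (u (polar (0, 0) R t)) -
      (Im (uinf (direction t)) * cos (k * R) + Re (uinf (direction t)) * sin (k * R))) <= K / sqrt R.
Proof.
  intros (E & K & M & hM & h). exists K, M. split; [easy|]. intros R t hR.
  set (x := polar (0, 0) R t).
  assert (hx : enorm x = R) by (apply enorm_polar; lra).
  destruct (h x ltac:(lra)) as [h1 h2]. rewrite hx in h1, h2.
  assert (hdir : dilate (/ R) x = direction t).
  { unfold dilate, x, polar, direction; simpl. f_equal; field; lra. }
  rewrite hdir in h1.
  assert (hs : 0 < sqrt R) by (apply sqrt_lt_R0; lra).
  assert (h3 : (sqrt R * u x)%C = (expi (k * R) * (uinf (direction t) + E x))%C).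
  { rewrite h1. field. intros e. apply RtoC_inj in e. lra. }
  set (e := (expi (k * R) * E x)%C).
  assert (he : Cmod e <= K / sqrt R) by (unfold e; rewrite Cmod_mult, Cmod_expi; lra).
  assert (h4 : (sqrt R * u x - expi (k * R) * uinf (direction t))%C = e).
  { rewrite h3. unfold e. ring. }
  split.
  - apply Rle_trans with (Rabs (Re e)); [|eapply Rle_trans; [apply re_le_Cmod|exact he]].
    rewrite <- h4. right. f_equal. unfold Re, Im, expi, Cminus, Cplus, Cmult, Copp, RtoC; simpl. ring.
  - apply Rle_trans with (Rabs (Im e)); [|eapply Rle_trans; [apply im_le_Cmod|exact he]].
    rewrite <- h4. right. f_equal. unfold Re, Im, expi, Cminus, Cplus, Cmult, Copp, RtoC; simpl. ring.
Qed.

Lemma cts_uniform_limit P : 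
  (forall eps, 0 < eps -> exists A, cts A /\ forall t, Rabs (P t - A t) <= eps) -> cts P.
Proof.
  intros h x. apply (proj2 (filterlim_locally _ _)). intros [eps heps].
  destruct (h (eps / 4) ltac:(lra)) as [A [hA hPA]].
  destruct (continuous_small A x (hA x) (eps / 4) ltac:(lra)) as [d [hd hx]].
  exists (mkposreal d hd). intros y hy.
  change (Rabs (P y - P x) < eps). specialize (hx y hy).
  pose proof (hPA x) as p1. pose proof (hPA y) as p2.
  apply Rabs_le_between in p1, p2. apply Rabs_def2 in hx. apply Rabs_def1; lra.
Qed.

(** The component of [x - c] along [x] is already larger than the radius. *)
Lemma polar_origin_exterior Dk R t :
  radius Dk + Rabs (fst (center Dk)) + Rabs (snd (center Dk)) < R -> exterior Dk (polar (0, 0) R t).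
Proof.
  intros h. unfold exterior, edist, enorm, polar; simpl fst; simpl snd.
  set (c := center Dk) in *.
  pose proof (dirdot_bound c t) as hg. apply Rabs_le_between in hg.
  pose proof (Rabs_pos (fst c)); pose proof (Rabs_pos (snd c)).
  pose proof (sin2_cos2 t) as e. unfold Rsqr in e.
  destruct (Rlt_dec (radius Dk) 0) as [hn|hn].
  { eapply Rlt_le_trans; [exact hn|apply sqrt_pos]. }
  apply Rlt_le_trans with (R - dirdot c t); [lra|].
  rewrite <- (sqrt_pow2 (R - dirdot c t)) by lra.
  apply sqrt_le_1_alt.
  assert (hh : (0 + R * cos t - fst c) ^ 2 + (0 + R * sin t - snd c) ^ 2
    = (R - dirdot c t)^2 + (snd c * cos t - fst c * sin t)^2).
  { unfold dirdot.
    transitivity (R^2 * (sin t * sin t + cos t * cos t) - 2 * R * (fst c * cos t + snd c * sin t) + (fst c ^2 + snd c ^2)); [ring|].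
    transitivity (R^2 - 2 * R * (fst c * cos t + snd c * sin t) + (fst c ^2 + snd c ^2) * (sin t * sin t + cos t * cos t)); [rewrite e; ring|ring]. }
  rewrite hh. pose proof (pow2_ge_0 (snd c * cos t - fst c * sin t)). lra.
Qed.

(** The amplitude is the uniform limit of the rescaled fields on large circles,
   which are continuous. *)
Lemma far_field_continuous k Dk u uinf :
  C2_onC (exterior Dk) u -> has_far_field k u uinf ->
  cts (fun t => Re (uinf (direction t))) /\ cts (fun t => Im (uinf (direction t))).
Proof.
  intros [hre him] hf.
  destruct (far_field_components k u uinf hf) as (K & M & hM & h).
  set (c := center Dk).
  assert (hcts : forall g R, C1_on (exterior Dk) g -> radius Dk + Rabs (fst c) + Rabs (snd c) < R ->
    cts (fun t => g (polar (0, 0) R t))).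
  { intros g R hg hR t.
    apply (continuous_comp_2 (fun t => 0 + R * cos t) (fun t => 0 + R * sin t) (fun a b => g (a, b)) t).
    - apply (cts_derive (fun t => 0 + R * cos t)); intros; auto_derive; easy.
    - apply (cts_derive (fun t => 0 + R * sin t)); intros; auto_derive; easy.
    - apply (continuous_ext g); [now intros []|]. apply (C1_continuous Dk g hg).
      now apply polar_origin_exterior. }
  assert (hlarge : forall eps, 0 < eps -> exists R, M < R /\ radius Dk + Rabs (fst c) + Rabs (snd c) < R /\ 
     2 * (K / sqrt R) <= eps /\ 0 < R).
  { intros eps heps.
    set (R := Rmax (Rmax M (radius Dk + Rabs (fst c) + Rabs (snd c))) ((2 * K / eps)^2) + 1).
    pose proof (Rmax_l (Rmax M (radius Dk + Rabs (fst c) + Rabs (snd c))) ((2 * K / eps)^2)).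
    pose proof (Rmax_r (Rmax M (radius Dk + Rabs (fst c) + Rabs (snd c))) ((2 * K / eps)^2)).
    pose proof (Rmax_l M (radius Dk + Rabs (fst c) + Rabs (snd c))).
    pose proof (Rmax_r M (radius Dk + Rabs (fst c) + Rabs (snd c))).
    assert (hR0 : 0 < R) by (unfold R; lra).
    exists R. repeat split; try (unfold R; lra).
    assert (hs : 0 < sqrt R) by now apply sqrt_lt_R0.
    apply (Rmult_le_reg_r (sqrt R / eps)); [now apply Rdiv_lt_0_compat|].
    replace (2 * (K / sqrt R) * (sqrt R / eps)) with (2 * K / eps) by (field; lra).
    replace (eps * (sqrt R / eps)) with (sqrt R) by (field; lra).
    destruct (Rle_dec (2 * K / eps) 0) as [hn|hn]; [lra|].
    rewrite <- (sqrt_pow2 (2 * K / eps)) by lra. apply sqrt_le_1_alt. unfold R; lra. }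
  assert (cb : forall x, Rabs (cos x) <= 1) by (intro; apply Rabs_le, COS_bound).
  assert (sb : forall x, Rabs (sin x) <= 1) by (intro; apply Rabs_le, SIN_bound).
  assert (T : forall a b x y e, Rabs x <= 1 -> Rabs y <= 1 -> Rabs a <= e -> Rabs b <= e -> Rabs (x * a + y * b) <= 2 * e).
  { intros a b x y e hx hy ha hb. eapply Rle_trans; [apply Rabs_triang|]. rewrite !Rabs_mult.
    pose proof (Rabs_pos a); pose proof (Rabs_pos b); pose proof (Rabs_pos x); pose proof (Rabs_pos y). nra. }
  assert (E : forall x, sin x * sin x + cos x * cos x = 1) by (intro x; exact (sin2_cos2 x)).
  (* the phase [al] selects the real or the imaginary part *)
  assert (V : forall al, cts (fun t => cos al * Re (uinf (direction t)) + sin al * Im (uinf (direction t)))).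
  { intros al. apply cts_uniform_limit. intros eps heps.
    destruct (hlarge eps heps) as (R & hR1 & hR2 & hR3 & hR4).
    exists (fun t => cos (k * R + al) * sqrt R * Re (u (polar (0, 0) R t)) + sin (k * R + al) * sqrt R * Im (u (polar (0, 0) R t))).
    split.
    { apply cts_plus; apply cts_mult; try apply cts_const.
      - apply (hcts (fun x => Re (u x))); [apply hre|exact hR2].
      - apply (hcts (fun x => Im (u x))); [apply him|exact hR2]. }
    intros t. destruct (h R t hR1) as [h1 h2].
    eapply Rle_trans; [|exact hR3]. rewrite Rabs_minus_sym.
    eapply Rle_trans; [|apply (T _ _ _ _ _ (cb (k * R + al)) (sb (k * R + al)) h1 h2)].
    right. f_equal. set (P := Re (uinf (direction t))). set (Q := Im (uinf (direction t))).
    rewrite cos_plus, sin_plus.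
    transitivity (((cos (k * R) * cos al - sin (k * R) * sin al) * sqrt R * Re (u (polar (0, 0) R t)) +
      (sin (k * R) * cos al + cos (k * R) * sin al) * sqrt R * Im (u (polar (0, 0) R t))) -
      (cos al * P + sin al * Q) * (sin (k * R) * sin (k * R) + cos (k * R) * cos (k * R))); [rewrite E|]; ring. }
  split.
  - apply (cts_ext (fun t => cos 0 * Re (uinf (direction t)) + sin 0 * Im (uinf (direction t)))); [|apply V].
    intros t. rewrite cos_0, sin_0. ring.
  - apply (cts_ext (fun t => cos (PI / 2) * Re (uinf (direction t)) + sin (PI / 2) * Im (uinf (direction t)))); [|apply V].
    intros t. rewrite cos_PI2, sin_PI2. ring.
Qed.

(** Real and imaginary parts of the amplitude seen from the centre [c], as in
   [far_field_recentre]. *)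
Definition amp_re (k : R) (c : R * R) (uinf : R * R -> C) (t : R) : R :=
  cos (k * dirdot c t) * Re (uinf (direction t)) - sin (k * dirdot c t) * Im (uinf (direction t)).
Definition amp_im (k : R) (c : R * R) (uinf : R * R -> C) (t : R) : R :=
  sin (k * dirdot c t) * Re (uinf (direction t)) + cos (k * dirdot c t) * Im (uinf (direction t)).

Lemma cts_phase k c : cts (fun t => cos (k * dirdot c t)) /\ cts (fun t => sin (k * dirdot c t)).
Proof. split; apply cts_derive; intros t; unfold dirdot; auto_derive; easy. Qed.

Lemma cts_amp k Dk u uinf c :
  C2_onC (exterior Dk) u -> has_far_field k u uinf -> cts (amp_re k c uinf) /\ cts (amp_im k c uinf).
Proof.
  intros h1 h2. destruct (far_field_continuous k Dk u uinf h1 h2) as [p q].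
  destruct (cts_phase k c) as [e1 e2].
  split; [apply cts_minus|apply cts_plus]; apply cts_mult; auto.
Qed.

Lemma mode_asymptotics k Dk g P Q n s :
  cts P -> cts Q -> (forall rho, radius Dk <= rho -> cts (fun t => g (polar (center Dk) rho t))) ->
  (forall eps, 0 < eps -> exists M', forall rho t, M' < rho -> 0 <= t <= 2 * PI ->
    Rabs (sqrt rho * g (polar (center Dk) rho t) - (P t * cos (k * rho) + Q t * sin (k * rho))) < eps) ->
  vanishes (fun x => sqrt x * mode Dk g n s x -
    (circ (fun t => P t * cos (IZR n * t + s)) * cos (k * x) + circ (fun t => Q t * cos (IZR n * t + s)) * sin (k * x))).
Proof.
  intros hP hQ hc h eps heps. pose proof PI_RGT_0 as hpi.
  destruct (h (eps / (4 * PI))) as [M hM]; [apply Rdiv_lt_0_compat; lra|].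
  exists (Rmax M (radius Dk)). intros x hx.
  pose proof (Rmax_l M (radius Dk)); pose proof (Rmax_r M (radius Dk)).
  specialize (hc x ltac:(lra)).
  set (w := fun t => cos (IZR n * t + s)).
  assert (hw : cts w) by apply cts_cos_lin.
  set (G := fun t => (sqrt x * g (polar (center Dk) x t) - (P t * cos (k * x) + Q t * sin (k * x))) * w t).
  assert (e : circ G = sqrt x * mode Dk g n s x - (circ (fun t => P t * w t) * cos (k * x) + circ (fun t => Q t * w t) * sin (k * x))).
  { unfold mode. fold w.
    pose proof (circ_lin4 (sqrt x) 0 (- cos (k * x)) (- sin (k * x))
      _ _ _ _ (cts_mult _ _ hc hw) (cts_mult _ _ hc hw) (cts_mult _ _ hP hw) (cts_mult _ _ hQ hw)) as e.
    cbv beta in e. unfold w in e |- *. transitivity (circ (fun t =>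
      sqrt x * (g (polar (center Dk) x t) * w t) + 0 * (g (polar (center Dk) x t) * w t) +
      (- cos (k * x) * (P t * w t) + - sin (k * x) * (Q t * w t)))).
    - apply circ_ext. intros t. unfold G. ring.
    - unfold w. rewrite e. ring. }
  unfold w in e. cbv beta in e. rewrite <- e.
  apply Rle_lt_trans with ((2 * PI - 0) * (eps / (4 * PI))).
  - unfold circ. apply abs_RInt_le_const; [lra| |].
    + apply cts_ex_RInt. unfold G. apply cts_mult; [|easy]. apply cts_minus; [apply (cts_mult (fun _ => sqrt x)); auto using cts_const|].
      apply cts_plus; [apply (cts_mult P (fun _ => cos (k * x)))|apply (cts_mult Q (fun _ => sin (k * x)))]; auto using cts_const.
    + intros t ht. unfold G. rewrite Rabs_mult.
      specialize (hM x t ltac:(lra) ht).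
      assert (Rabs (w t) <= 1) by (apply Rabs_le, COS_bound).
      pose proof (Rabs_pos (w t)). 
      match goal with |- ?a * _ <= _ => assert (0 <= a) by apply Rabs_pos end. nra.
  - replace ((2 * PI - 0) * (eps / (4 * PI))) with (eps / 2) by (field; lra). lra.
Qed.

Lemma scattered_mode_outgoing k Dk d0 d u uinf n s :
  0 < k -> 0 < radius Dk -> is_scattered_field k Dk d0 d u -> has_far_field k u uinf ->
  let c := center Dk in
  let a := fun x => sqrt x * mode Dk (fun y => Re (u y)) n s x in
  let b := fun x => sqrt x * mode Dk (fun y => Im (u y)) n s x in
  (exists a1 b1, outgoing k (IZR n) (radius Dk) a a1 b b1
     (circ (fun t => amp_re k c uinf t * cos (IZR n * t + s)))
     (circ (fun t => amp_im k c uinf t * cos (IZR n * t + s)))) /\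
  right_continuous a (radius Dk) /\ right_continuous b (radius Dk).
Proof.
  intros hk hr (hC2 & hcont & hH & _ & _) hfar c a b.
  destruct hC2 as [hre him].
  assert (hHre : forall x, exterior Dk x -> laplacian (fun y => Re (u y)) x + k ^ 2 * Re (u x) = 0).
  { intros x hx. specialize (hH x hx). apply (f_equal (@fst R R)) in hH.
    unfold laplacianC in hH. rewrite <- RtoC_pow in hH. unfold Cplus, Cmult, RtoC in hH; simpl in hH.
    change (laplacian (fun y => Re (u y)) x + k ^ 2 * fst (u x) = 0). lra. }
  assert (hHim : forall x, exterior Dk x -> laplacian (fun y => Im (u y)) x + k ^ 2 * Im (u x) = 0).
  { intros x hx. specialize (hH x hx). apply (f_equal (@snd R R)) in hH.
    unfold laplacianC in hH. rewrite <- RtoC_pow in hH. unfold Cplus, Cmult, RtoC in hH; simpl in hH.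
    change (laplacian (fun y => Im (u y)) x + k ^ 2 * snd (u x) = 0). lra. }
  assert (cre : forall x, closed_exterior Dk x ->
    filterlim (fun y => Re (u y)) (within (closed_exterior Dk) (locally x)) (locally (Re (u x)))).
  { intros x hx. eapply filterlim_comp; [apply (hcont x hx)|]. destruct (u x) as [p q]. apply (continuous_fst p q). }
  assert (cim : forall x, closed_exterior Dk x ->
    filterlim (fun y => Im (u y)) (within (closed_exterior Dk) (locally x)) (locally (Im (u x)))).
  { intros x hx. eapply filterlim_comp; [apply (hcont x hx)|]. destruct (u x) as [p q]. apply (continuous_snd p q). }
  destruct (mode_right_continuous Dk (fun y => Re (u y)) n s hr cre) as [rre kre].
  destruct (mode_right_continuous Dk (fun y => Im (u y)) n s hr cim) as [rim kim].
  assert (rs : right_continuous sqrt (radius Dk)).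
  { apply right_continuous_of_continuous. apply continuity_pt_filterlim, continuity_pt_sqrt; lra. }
  split; [|split; now apply right_continuous_mult].
  destruct (far_field_components k u uinf hfar) as (K & M & hM & hcomp).
  destruct (far_field_continuous k Dk u uinf (conj hre him) hfar) as [cP cQ].
  set (P := fun t => Re (uinf (direction t))) in *. set (Q := fun t => Im (uinf (direction t))) in *.
  assert (cQ' : cts (fun t => - Q t)).
  { apply (cts_ext (fun t => 0 - Q t)); [intros; ring|]. apply cts_minus; [apply cts_const|exact cQ]. }
  pose proof (far_field_recentre k (fun y => Re (u y)) P (fun t => - Q t) K M c hk hM cP cQ'
    (fun R t h => proj1 (hcomp R t h))) as f1.
  pose proof (far_field_recentre k (fun y => Im (u y)) Q P K M c hk hM cQ cP
    (fun R t h => proj2 (hcomp R t h))) as f2.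
  destruct (cts_phase k c) as [e1 e2].
  assert (cA : cts (amp_re k c uinf)) by (apply cts_minus; apply cts_mult; auto).
  assert (cB : cts (amp_im k c uinf)) by (apply cts_plus; apply cts_mult; auto).
  assert (cB' : cts (fun t => - amp_im k c uinf t)).
  { apply (cts_ext (fun t => 0 - amp_im k c uinf t)); [intros; ring|]. apply cts_minus; [apply cts_const|exact cB]. }
  assert (m1 := mode_asymptotics k Dk (fun y => Re (u y)) _ _ n s cA cB' kre).
  assert (m2 := mode_asymptotics k Dk (fun y => Im (u y)) _ _ n s cB cA kim).
  exists (fun x => sqrt x * mode_dr Dk (fun y => Re (u y)) n s x + / (2 * sqrt x) * mode Dk (fun y => Re (u y)) n s x).
  exists (fun x => sqrt x * mode_dr Dk (fun y => Im (u y)) n s x + / (2 * sqrt x) * mode Dk (fun y => Im (u y)) n s x).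
  split.
  - now apply mode_solves.
  - now apply mode_solves.
  - refine (vanishes_ext _ _ 0 _ (m1 _)).
    + intros x _. unfold a.
      assert (en : circ (fun t => - amp_im k c uinf t * cos (IZR n * t + s)) = - circ (fun t => amp_im k c uinf t * cos (IZR n * t + s))).
      { replace (- circ (fun t => amp_im k c uinf t * cos (IZR n * t + s))) with (-1 * circ (fun t => amp_im k c uinf t * cos (IZR n * t + s))) by ring.
        rewrite <- circ_scal by (apply cts_mult; [exact cB|apply cts_cos_lin]). apply circ_ext; intros; ring. }
      rewrite en. ring.
    + intros eps heps. destruct (f1 eps heps) as [M' hM']. exists M'. intros rho t h1 h2.
      specialize (hM' rho t h1 h2). fold c.
      replace (amp_re k c uinf t * cos (k * rho) + - amp_im k c uinf t * sin (k * rho)) with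
        (P t * cos (k * (rho + dirdot c t)) + - Q t * sin (k * (rho + dirdot c t))); [exact hM'|].
      rewrite Rmult_plus_distr_l, cos_plus, sin_plus. unfold amp_re, amp_im. fold (P t) (Q t). ring.
  - refine (vanishes_ext _ _ 0 _ (m2 _)).
    + intros x _. unfold b. ring.
    + intros eps heps. destruct (f2 eps heps) as [M' hM']. exists M'. intros rho t h1 h2.
      specialize (hM' rho t h1 h2). fold c.
      replace (amp_im k c uinf t * cos (k * rho) + amp_re k c uinf t * sin (k * rho)) with
        (Q t * cos (k * (rho + dirdot c t)) + P t * sin (k * (rho + dirdot c t))); [exact hM'|].
      rewrite Rmult_plus_distr_l, cos_plus, sin_plus. unfold amp_re, amp_im. fold (P t) (Q t). ring.
Qed.

(** * Factorization of the far field pattern *)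

Lemma cos_Z_reflect n t s : cos (IZR n * (- t) + s) = cos (IZR n * t - s).
Proof. rewrite <- cos_neg. f_equal. ring. Qed.

Lemma circ_even_phase g n : cts g -> periodic g -> (forall t, g (- t) = g t) ->
  forall s, circ (fun t => g t * cos (IZR n * t + s)) = cos s * circ (fun t => g t * cos (IZR n * t)).
Proof.
  intros hg hp he s.
  assert (hc : cts (fun t => g t * cos (IZR n * t + s))) by (apply cts_mult; [easy|apply cts_cos_lin]).
  assert (hc' : cts (fun t => g t * cos (IZR n * t + - s))) by (apply cts_mult; [easy|apply cts_cos_lin]).
  assert (hc0 : cts (fun t => g t * cos (IZR n * t))).
  { apply (cts_ext (fun t => g t * cos (IZR n * t + 0))); [intros; now rewrite Rplus_0_r|].
    apply cts_mult; [easy|apply cts_cos_lin]. }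
  assert (e : circ (fun t => g t * cos (IZR n * t + s)) = circ (fun t => g t * cos (IZR n * t + - s))).
  { rewrite <- (circ_reflect (fun t => g t * cos (IZR n * t + s))); [|easy|].
    - apply circ_ext. intros t. now rewrite he, cos_Z_reflect.
    - intros t. now rewrite hp, (cos_Z_periodic n). }
  assert (e2 : circ (fun t => g t * cos (IZR n * t + s)) + circ (fun t => g t * cos (IZR n * t + - s))
    = 2 * cos s * circ (fun t => g t * cos (IZR n * t))).
  { rewrite <- circ_plus, <- circ_scal by easy. apply circ_ext. intros t.
    rewrite !cos_plus, cos_neg, sin_neg. ring. }
  lra.
Qed.

(** The Jacobi-Anger expansion of a plane wave. *)
Lemma plane_wave_mode ka x ph n s :
  circ (fun t => cos (x * cos (t - ph) + ka) * cos (IZR n * t + s)) = cos (IZR n * ph + s) * wave_coef ka n x.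
Proof.
  assert (C2 : forall t, cos (t + 2 * PI) = cos t).
  { intros t. rewrite cos_plus, cos_2PI, sin_2PI. ring. }
  unfold wave_coef. rewrite <- circ_even_phase.
  - rewrite <- (circ_shift (fun t => cos (x * cos (t - ph) + ka) * cos (IZR n * t + s)) ph).
    + apply circ_ext. intros t. replace (t + ph - ph) with t by ring. f_equal. f_equal. ring.
    + apply cts_derive; intros; auto_derive; easy.
    + intros t. rewrite (cos_Z_periodic n). replace (t + 2 * PI - ph) with (t - ph + 2 * PI) by ring. now rewrite C2.
  - apply cts_derive; intros; auto_derive; easy.
  - intros t. now rewrite C2.
  - intros t. now rewrite cos_neg.
Qed.

Lemma plane_wave_mode_sin ka x ph n s :
  circ (fun t => sin (x * cos (t - ph) + ka) * cos (IZR n * t + s)) =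
  cos (IZR n * ph + s) * wave_coef (ka - PI / 2) n x.
Proof.
  rewrite <- plane_wave_mode. apply circ_ext. intros t. f_equal.
  rewrite <- (cos_shift (_ + _)), <- cos_neg. f_equal. ring.
Qed.

Lemma dot_polar c r t ph : dot (polar c r t) (direction ph) = dirdot c ph + r * cos (t - ph).
Proof. unfold dot, polar, direction, dirdot; simpl. rewrite cos_minus. ring. Qed.

Lemma scattered_mode_boundary k Dk ph0 ph u n s :
  0 < radius Dk -> is_scattered_field k Dk (direction ph0) (direction ph) u ->
  let c := center Dk in let r := radius Dk in
  let X := cos (k * dirdot c ph0) * cos (IZR n * ph0 + s) + cos (k * dirdot c ph) * cos (IZR n * ph + s) in
  let Y := sin (k * dirdot c ph0) * cos (IZR n * ph0 + s) + sin (k * dirdot c ph) * cos (IZR n * ph + s) in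
  mode Dk (fun y => Re (u y)) n s r = - (X * jre n (k * r) - Y * jim n (k * r)) /\
  mode Dk (fun y => Im (u y)) n s r = - (X * jim n (k * r) + Y * jre n (k * r)).
Proof.
  intros hr (_ & _ & _ & hb & _) c r X Y.
  assert (hu : forall t, u (polar c r t) = (- incident_field k (direction ph0) (direction ph) (polar c r t))%C).
  { intros t. apply hb. unfold on_boundary. apply edist_polar. unfold r; lra. }
  assert (kc : forall ka x ph, cts (fun t => cos (x * cos (t - ph) + ka) * cos (IZR n * t + s))).
  { intros. apply cts_derive; intros; auto_derive; easy. }
  assert (ks : forall ka x ph, cts (fun t => sin (x * cos (t - ph) + ka) * cos (IZR n * t + s))).
  { intros. apply cts_derive; intros; auto_derive; easy. }
  set (z0 := k * dirdot c ph0) in *. set (z := k * dirdot c ph) in *.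
  assert (hd : forall p t, k * dot (polar c r t) (direction p) = k * r * cos (t - p) + k * dirdot c p).
  { intros p t. rewrite dot_polar. ring. }
  split; unfold mode; fold c.
  - transitivity (-1 * (circ (fun t => cos (k * r * cos (t - ph0) + z0) * cos (IZR n * t + s)) +
      circ (fun t => cos (k * r * cos (t - ph) + z) * cos (IZR n * t + s)))).
    + rewrite <- circ_plus, <- circ_scal; auto using cts_plus. apply circ_ext. intros t.
      rewrite hu. unfold incident_field, expi. rewrite !hd. fold z0 z.
      unfold Re, Copp, Cplus; simpl. ring.
    + rewrite !plane_wave_mode, (wave_coef_phase z0), (wave_coef_phase z). unfold X, Y. ring.
  - transitivity (-1 * (circ (fun t => sin (k * r * cos (t - ph0) + z0) * cos (IZR n * t + s)) +
      circ (fun t => sin (k * r * cos (t - ph) + z) * cos (IZR n * t + s)))).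
    + rewrite <- circ_plus, <- circ_scal; auto using cts_plus. apply circ_ext. intros t.
      rewrite hu. unfold incident_field, expi. rewrite !hd. fold z0 z.
      unfold Im, Copp, Cplus; simpl. ring.
    + rewrite !plane_wave_mode_sin, (wave_coef_phase (z0 - PI / 2)), (wave_coef_phase (z - PI / 2)).
      rewrite !cos_minus, !sin_minus, cos_PI2, sin_PI2. unfold X, Y. ring.
Qed.

(** [fr + i fi] is the far field of the disk of radius [r] about the origin for
   one incident plane wave, as a function of the angle between observation and
   incidence. Being even, it has only cosine coefficients, [tr + i ti], whence
   the factor [cos s]. *)
Record profile (k r : R) (fr fi : R -> R) (tr ti : Z -> R) : Prop := {
  pf_cts_re : cts fr; pf_cts_im : cts fi;
  pf_periodic_re : periodic fr; pf_periodic_im : periodic fi;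
  pf_even_re : forall t, fr (- t) = fr t; pf_even_im : forall t, fi (- t) = fi t;
  pf_coef_re : forall n s, circ (fun t => fr t * cos (IZR n * t + s)) = cos s * tr n;
  pf_coef_im : forall n s, circ (fun t => fi t * cos (IZR n * t + s)) = cos s * ti n;
  pf_response : forall n, mode_response k r n (tr n) (ti n) }.

(** Reflection does not change the cosine coefficients, and those against sines
   are zero. *)
Lemma even_of_coef g T : cts g -> periodic g ->
  (forall (n : Z) s, circ (fun t => g t * cos (IZR n * t + s)) = cos s * T n) ->
  forall t, g (- t) = g t.
Proof.
  intros hg hp h t.
  revert t. apply fourier_eq; auto.
  - apply (cts_comp (fun t => - t) g); [apply cts_derive; intros; auto_derive; easy|easy].
  - intros x. rewrite <- (hp (- (x + 2 * PI))). f_equal. ring.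
  - intros n s. transitivity (circ (fun t => g t * cos (IZR n * t + - s))); [|rewrite !h, cos_neg; ring].
    rewrite <- (circ_reflect (fun t => g t * cos (IZR n * t + - s))).
    + apply circ_ext. intros x. rewrite cos_Z_reflect. do 2 f_equal. ring.
    + apply cts_mult; [easy|apply cts_cos_lin].
    + intros x. now rewrite hp, (cos_Z_periodic n).
Qed.

Definition coef (g : R -> R) (n : Z) (s : R) : R := circ (fun t => g t * cos (IZR n * t + s)).

Definition superpose (x y z v : R) (g h : R -> R) (p q t : R) : R :=
  (x * g (t - p) + y * h (t - p)) + (z * g (t - q) + v * h (t - q)).

Lemma cts_superpose x y z v g h p q : cts g -> cts h -> cts (superpose x y z v g h p q).
Proof.
  intros hg hh.
  assert (S : forall a f c, cts f -> cts (fun t => a * f (t - c))).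
  { intros a f c hf. apply (cts_mult (fun _ => a) (fun t => f (t - c))); [apply cts_const|].
    apply (cts_comp (fun t => t - c) f); [apply cts_derive; intros; auto_derive; easy|easy]. }
  exact (cts_plus _ _ (cts_plus _ _ (S x g p hg) (S y h p hh)) (cts_plus _ _ (S z g q hg) (S v h q hh))).
Qed.

Lemma periodic_superpose x y z v g h p q : periodic g -> periodic h -> periodic (superpose x y z v g h p q).
Proof.
  intros hg hh t.
  assert (S : forall f c, periodic f -> f (t + 2 * PI - c) = f (t - c)).
  { intros f c hf. rewrite <- (hf (t - c)). f_equal. ring. }
  unfold superpose. now rewrite !(S g), !(S h).
Qed.

Lemma coef_superpose x y z v g h p q n s : cts g -> cts h -> periodic g -> periodic h ->
  coef (superpose x y z v g h p q) n s =
  (x * coef g n (IZR n * p + s) + y * coef h n (IZR n * p + s)) +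
  (z * coef g n (IZR n * q + s) + v * coef h n (IZR n * q + s)).
Proof.
  intros hg hh pg ph.
  assert (C : forall f c, cts f -> cts (fun t => f (t - c) * cos (IZR n * t + s))).
  { intros f c hf. apply cts_mult; [|apply cts_cos_lin].
    apply (cts_comp (fun t => t - c) f); [apply cts_derive; intros; auto_derive; easy|easy]. }
  assert (S : forall f c, cts f -> periodic f ->
    coef f n (IZR n * c + s) = circ (fun t => f (t - c) * cos (IZR n * t + s))).
  { intros f c hf pf. unfold coef. rewrite <- (circ_shift (fun t => f t * cos (IZR n * t + (IZR n * c + s))) (- c)).
    - apply circ_ext. intros t. f_equal. f_equal. ring.
    - apply cts_mult; [easy|apply cts_cos_lin].
    - intros t. now rewrite pf, (cos_Z_periodic n). }
  rewrite !S by easy.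
  rewrite <- (circ_lin4 x y z v _ _ _ _ (C g p hg) (C h p hh) (C g q hg) (C h q hh)).
  apply circ_ext. intros t. unfold superpose. ring.
Qed.

(** The parts of [exp (i ka0) f (t - ph0) + exp (i ka) f (t - ph)], the
   superposition of the responses to two plane waves with phases [ka0], [ka] at
   the centre. *)
Definition total_re (fr fi : R -> R) (ka0 ka : R) : R -> R -> R -> R :=
  superpose (cos ka0) (- sin ka0) (cos ka) (- sin ka) fr fi.
Definition total_im (fr fi : R -> R) (ka0 ka : R) : R -> R -> R -> R :=
  superpose (sin ka0) (cos ka0) (sin ka) (cos ka) fr fi.

(** Every mode of the pattern is a sum of responses to the two plane waves, by
   [far_of_boundary], so that both sides have the same Fourier coefficients. The
   profile is extracted from the wave with incidence [d = d0], where the two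
   waves agree and produce twice the response. Seen from the centre the pattern
   changes by a phase only, which its modulus does not notice. *)
Lemma far_field_structure k Dk ph0 (uinf : R * R -> R * R -> C) :
  0 < k -> 0 < radius Dk ->
  (forall d, unit_vector d -> is_far_field_pattern k Dk (direction ph0) d (fun x => uinf x d)) ->
  exists fr fi tr ti, profile k (radius Dk) fr fi tr ti /\
    forall t ph, Cmod (uinf (direction t) (direction ph)) ^ 2 =
      total_re fr fi (k * dirdot (center Dk) ph0) (k * dirdot (center Dk) ph) ph0 ph t ^ 2 +
      total_im fr fi (k * dirdot (center Dk) ph0) (k * dirdot (center Dk) ph) ph0 ph t ^ 2.
Proof.
  intros hk hr hfar.
  set (c := center Dk). set (r := radius Dk) in *.
  set (ka := fun ph => k * dirdot c ph).
  set (Ar := fun ph => amp_re k c (fun x => uinf x (direction ph))).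
  set (Ai := fun ph => amp_im k c (fun x => uinf x (direction ph))).
  assert (hA : forall ph, cts (Ar ph) /\ cts (Ai ph)).
  { intros ph. destruct (hfar _ (unit_direction ph)) as (u & hu & hff).
    apply (cts_amp k Dk u); [apply hu|exact hff]. }
  assert (hp2 : forall t, cos (t + 2 * PI) = cos t /\ sin (t + 2 * PI) = sin t).
  { intros t. rewrite cos_plus, sin_plus, cos_2PI, sin_2PI. split; ring. }
  assert (hper : forall ph, periodic (Ar ph) /\ periodic (Ai ph)).
  { intros ph; split; intros t; unfold Ar, Ai, amp_re, amp_im, dirdot, direction;
    now rewrite (proj1 (hp2 t)), (proj2 (hp2 t)). }
  assert (hm : forall ph n s, exists a a1 b b1, outgoing k (IZR n) r a a1 b b1
     (circ (fun t => Ar ph t * cos (IZR n * t + s))) (circ (fun t => Ai ph t * cos (IZR n * t + s))) /\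
     right_continuous a r /\ right_continuous b r /\
     let X := cos (ka ph0) * cos (IZR n * ph0 + s) + cos (ka ph) * cos (IZR n * ph + s) in
     let Y := sin (ka ph0) * cos (IZR n * ph0 + s) + sin (ka ph) * cos (IZR n * ph + s) in
     a r = - sqrt r * (X * jre n (k * r) - Y * jim n (k * r)) /\
     b r = - sqrt r * (X * jim n (k * r) + Y * jre n (k * r))).
  { intros ph n s. destruct (hfar _ (unit_direction ph)) as (u & hu & hff).
    destruct (scattered_mode_outgoing k Dk _ _ u _ n s hk hr hu hff) as ((a1 & b1 & ho) & ca & cb).
    destruct (scattered_mode_boundary k Dk ph0 ph u n s hr hu) as [e1 e2].
    eexists _, a1, _, b1. split; [exact ho|]. split; [exact ca|]. split; [exact cb|].
    cbv zeta. fold r. fold r in e1, e2. rewrite e1, e2. unfold ka, c. split; ring. }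
  destruct (hA ph0) as [a0 a1]. destruct (hper ph0) as [b0 b1].
  set (C := / 2 * cos (ka ph0)). set (S := / 2 * sin (ka ph0)).
  set (fr := superpose C S 0 0 (Ar ph0) (Ai ph0) (- ph0) 0).
  set (fi := superpose C (- S) 0 0 (Ai ph0) (Ar ph0) (- ph0) 0).
  assert (cfr : cts fr) by now apply cts_superpose.
  assert (cfi : cts fi) by now apply cts_superpose.
  assert (pfr : periodic fr) by now apply periodic_superpose.
  assert (pfi : periodic fi) by now apply periodic_superpose.
  set (Fr := fun ph => coef (Ar ph)). set (Fi := fun ph => coef (Ai ph)).
  set (tr := fun n => C * Fr ph0 n (IZR n * - ph0) + S * Fi ph0 n (IZR n * - ph0)).
  set (ti := fun n => C * Fi ph0 n (IZR n * - ph0) - S * Fr ph0 n (IZR n * - ph0)).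
  assert (SC : forall x, sin x * sin x + cos x * cos x = 1) by (intro x; exact (sin2_cos2 x)).
  assert (resp : forall n, mode_response k r n (tr n) (ti n)).
  { intros n. destruct (hm ph0 n (IZR n * - ph0)) as (a & a' & b & b' & ho & ca & cb & ea & eb).
    replace (IZR n * ph0 + IZR n * - ph0) with 0 in ea, eb by ring. rewrite cos_0 in ea, eb.
    pose proof (outgoing_lin _ _ _ _ _ _ _ _ _ _ _ _ _ _ _ C (- S) 0 0 ho ho) as hl.
    eexists _, _, _, _. split; [|split; [|split; [|split]]].
    - replace (tr n) with (C * Fr ph0 n (IZR n * - ph0) - - S * Fi ph0 n (IZR n * - ph0)
        + (0 * Fr ph0 n (IZR n * - ph0) - 0 * Fi ph0 n (IZR n * - ph0))) by (unfold tr; ring).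
      replace (ti n) with (C * Fi ph0 n (IZR n * - ph0) + - S * Fr ph0 n (IZR n * - ph0)
        + (0 * Fi ph0 n (IZR n * - ph0) + 0 * Fr ph0 n (IZR n * - ph0))) by (unfold ti; ring).
      exact hl.
    - refine (right_continuous_ext _ _ r _ (right_continuous_lin a b a b C S 0 0 r ca cb ca cb)).
      intros; ring.
    - refine (right_continuous_ext _ _ r _ (right_continuous_lin a b a b (- S) C 0 0 r ca cb ca cb)).
      intros; ring.
    - cbv beta. rewrite ea, eb. unfold C, S.
      transitivity (- sqrt r * jre n (k * r) * (sin (ka ph0) * sin (ka ph0) + cos (ka ph0) * cos (ka ph0))); [field|rewrite SC; ring].
    - cbv beta. rewrite ea, eb. unfold C, S.
      transitivity (- sqrt r * jim n (k * r) * (sin (ka ph0) * sin (ka ph0) + cos (ka ph0) * cos (ka ph0))); [field|rewrite SC; ring]. }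
  assert (FF : forall ph n s,
     let X := cos (ka ph0) * cos (IZR n * ph0 + s) + cos (ka ph) * cos (IZR n * ph + s) in
     let Y := sin (ka ph0) * cos (IZR n * ph0 + s) + sin (ka ph) * cos (IZR n * ph + s) in
     Fr ph n s = X * tr n - Y * ti n /\ Fi ph n s = X * ti n + Y * tr n).
  { intros ph n s X Y. destruct (hm ph n s) as (a & a' & b & b' & ho & ca & cb & ea & eb).
    fold X Y in ea, eb.
    destruct (resp n) as (p & p' & q & q' & ho' & cp & cq & ep & eq).
    apply (far_of_boundary _ _ _ _ _ _ _ _ _ _ _ _ _ _ _ X Y hk hr ho' cp cq ho ca cb).
    - rewrite ea, ep, eq. ring.
    - rewrite eb, ep, eq. ring. }
  (* for d = d0 the two waves add up to twice one wave, which accounts for the halves *)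
  assert (cr : forall n s, coef fr n s = cos s * tr n).
  { intros n s. unfold fr. rewrite coef_superpose by auto. fold (Fr ph0) (Fi ph0).
    destruct (FF ph0 n (IZR n * - ph0 + s)) as [g1 g2]. rewrite g1, g2.
    replace (IZR n * ph0 + (IZR n * - ph0 + s)) with s by ring. unfold C, S.
    transitivity (cos s * tr n * (sin (ka ph0) * sin (ka ph0) + cos (ka ph0) * cos (ka ph0))); [field|rewrite SC; ring]. }
  assert (ci : forall n s, coef fi n s = cos s * ti n).
  { intros n s. unfold fi. rewrite coef_superpose by auto. fold (Fr ph0) (Fi ph0).
    destruct (FF ph0 n (IZR n * - ph0 + s)) as [g1 g2]. rewrite g1, g2.
    replace (IZR n * ph0 + (IZR n * - ph0 + s)) with s by ring. unfold C, S.
    transitivity (cos s * ti n * (sin (ka ph0) * sin (ka ph0) + cos (ka ph0) * cos (ka ph0))); [field|rewrite SC; ring]. }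
  exists fr, fi, tr, ti. split.
  { split; auto; eapply even_of_coef; eauto. }
  (* both sides of the factorization have the same Fourier coefficients *)
  assert (Cre : forall ph t, Ar ph t = total_re fr fi (ka ph0) (ka ph) ph0 ph t).
  { intros ph. destruct (hA ph) as [q0 q1]. destruct (hper ph) as [p0 p1].
    apply fourier_eq; auto; [now apply cts_superpose|now apply periodic_superpose|].
    intros n s. fold (coef (Ar ph) n s) (coef (total_re fr fi (ka ph0) (ka ph) ph0 ph) n s).
    unfold total_re. rewrite coef_superpose, !cr, !ci by auto. destruct (FF ph n s) as [g1 _].
    transitivity (Fr ph n s); [easy|]. rewrite g1. ring. }
  assert (Cim : forall ph t, Ai ph t = total_im fr fi (ka ph0) (ka ph) ph0 ph t).
  { intros ph. destruct (hA ph) as [q0 q1]. destruct (hper ph) as [p0 p1].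
    apply fourier_eq; auto; [now apply cts_superpose|now apply periodic_superpose|].
    intros n s. fold (coef (Ai ph) n s) (coef (total_im fr fi (ka ph0) (ka ph) ph0 ph) n s).
    unfold total_im. rewrite coef_superpose, !cr, !ci by auto. destruct (FF ph n s) as [_ g1].
    transitivity (Fi ph n s); [easy|]. rewrite g1. ring. }
  intros t ph. fold (ka ph0) (ka ph). rewrite <- Cre, <- Cim, Cmod2_alt.
  unfold Ar, Ai, amp_re, amp_im.
  set (z := uinf (direction t) (direction ph)). set (x := k * dirdot c t).
  transitivity ((Re z ^ 2 + Im z ^ 2) * (sin x * sin x + cos x * cos x)); [rewrite SC|]; ring.
Qed.

(** * Phase retrieval *)

(** Otherwise the trigonometric polynomial under the sine would be constant on
   the interval; but the squares of its first two derivatives sum to [p^2 +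
   q^2]. *)
Lemma sin_trig_nonzero C p q a b : a < b -> p <> 0 \/ q <> 0 ->
  exists t, a < t < b /\ sin (C + p * cos t + q * sin t) <> 0.
Proof.
  intros hab hpq.
  destruct (classic (exists t, a < t < b /\ sin (C + p * cos t + q * sin t) <> 0)) as [|hno]; [easy|exfalso].
  assert (hz : forall t, a < t < b -> sin (C + p * cos t + q * sin t) = 0).
  { intros t ht. destruct (Req_dec (sin (C + p * cos t + q * sin t)) 0) as [|hne]; [easy|].
    exfalso. apply hno. now exists t. }
  assert (h1 : forall t, a < t < b -> - p * sin t + q * cos t = 0).
  { intros t ht.
    assert (hd : is_derive (fun t => sin (C + p * cos t + q * sin t)) t
       (cos (C + p * cos t + q * sin t) * (- p * sin t + q * cos t))).
    { auto_derive; [easy|]. ring. }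
    pose proof (derive_zero_of_zero _ _ a b t ht hz hd) as e.
    apply Rmult_integral in e. destruct e as [e|e]; [exfalso|exact e].
    pose proof (sin2_cos2 (C + p * cos t + q * sin t)) as e2. rewrite e, (hz t ht) in e2. unfold Rsqr in e2. lra. }
  set (t := (a + b) / 2).
  assert (ht : a < t < b) by (unfold t; lra).
  assert (hd : is_derive (fun t => - p * sin t + q * cos t) t (- p * cos t - q * sin t)).
  { auto_derive; [easy|]. ring. }
  pose proof (derive_zero_of_zero _ _ a b t ht h1 hd) as e2. specialize (h1 t ht).
  pose proof (sin2_cos2 t) as e. unfold Rsqr in e.
  assert (p ^ 2 + q ^ 2 = 0).
  { transitivity ((p^2 + q^2) * (sin t * sin t + cos t * cos t)); [rewrite e; ring|].
    transitivity ((- p * sin t + q * cos t) ^ 2 + (- p * cos t - q * sin t) ^ 2); [ring|].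
    rewrite h1, e2. ring. }
  destruct hpq; nra.
Qed.

Lemma sin_trig_nonzero2 C p q C' p' q' a b : a < b -> p <> 0 \/ q <> 0 -> p' <> 0 \/ q' <> 0 ->
  exists t, a < t < b /\ sin (C + p * cos t + q * sin t) <> 0 /\ sin (C' + p' * cos t + q' * sin t) <> 0.
Proof.
  intros hab h1 h2.
  destruct (sin_trig_nonzero C p q a b hab h1) as [t0 [ht0 hs]].
  set (F := fun t => sin (C + p * cos t + q * sin t)) in *.
  assert (hF : cts F) by (apply cts_derive; intros; unfold F; auto_derive; easy).
  destruct (continuous_small F t0 (hF t0) (Rabs (F t0))) as [d [hd hc]]; [now apply Rabs_pos_lt|].
  assert (hm : Rmax a (t0 - d) < Rmin b (t0 + d)).
  { apply Rmax_lub_lt; apply Rmin_glb_lt; lra. }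
  destruct (sin_trig_nonzero C' p' q' _ _ hm h2) as [t [ht hs']].
  pose proof (Rmax_l a (t0 - d)); pose proof (Rmax_r a (t0 - d)).
  pose proof (Rmin_l b (t0 + d)); pose proof (Rmin_r b (t0 + d)).
  exists t. split; [lra|]. split; [|exact hs'].
  intro e. specialize (hc t). fold (F t) in e. rewrite e in hc.
  rewrite Rminus_0_l, Rabs_Ropp in hc. assert (Rabs (t - t0) < d) by (apply Rabs_def1; lra). specialize (hc H3). lra.
Qed.

Lemma zero_of_dense_zero h s : cts h -> (forall t, s t <> 0 -> h t = 0) ->
  (forall a b, a < b -> exists t, a < t < b /\ s t <> 0) -> forall t, h t = 0.
Proof.
  intros hh hz hd t. destruct (Req_dec (h t) 0) as [|hne]; [easy|exfalso].
  destruct (continuous_small h t (hh t) (Rabs (h t))) as [d [hd0 hc]]; [now apply Rabs_pos_lt|].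
  destruct (hd (t - d) (t + d) ltac:(lra)) as [u [hu hs]].
  specialize (hc u). rewrite (hz u hs), Rminus_0_l, Rabs_Ropp in hc.
  assert (Rabs (u - t) < d) by (apply Rabs_def1; lra). specialize (hc H). lra.
Qed.

(** The phase difference [k c.(d0 - d)] when [d] makes the angle [t] with [d0]
   and [k c] has components [A], [B] along and across [d0]. *)
Definition phase (A B t : R) : R := A * (1 - cos t) - B * sin t.

Lemma sin_phase_dense A B : A <> 0 \/ B <> 0 ->
  forall a b, a < b -> exists t, a < t < b /\ sin (phase A B t) <> 0.
Proof.
  intros h a b hab. destruct (sin_trig_nonzero A (- A) (- B) a b hab) as [t [ht hs]].
  { destruct h; [left|right]; lra. }
  exists t. split; [easy|]. unfold phase. now replace (A * (1 - cos t) - B * sin t) with (A + - A * cos t + - B * sin t) by ring.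
Qed.

(** For profiles [f1], [f2] of two disks, [x1 + i y1 = f1 s conj (f1 t)] and
   likewise for [f2]; the data are the interference terms of the two incident
   waves, with [s] and [t] the angles of observation relative to them. *)
Section PhaseRetrieval.
Variables (a1 b1 a2 b2 : R -> R) (A1 B1 A2 B2 : R).
Hypothesis ca1 : cts a1. Hypothesis cb1 : cts b1. Hypothesis ca2 : cts a2. Hypothesis cb2 : cts b2.
Hypothesis ea1 : forall t, a1 (- t) = a1 t. Hypothesis eb1 : forall t, b1 (- t) = b1 t.
Hypothesis ea2 : forall t, a2 (- t) = a2 t. Hypothesis eb2 : forall t, b2 (- t) = b2 t.

Let x1 s t := a1 s * a1 t + b1 s * b1 t.
Let y1 s t := b1 s * a1 t - a1 s * b1 t.
Let x2 s t := a2 s * a2 t + b2 s * b2 t.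
Let y2 s t := b2 s * a2 t - a2 s * b2 t.

Hypothesis hdata : forall s t,
  cos (phase A1 B1 (s - t)) * x1 s t - sin (phase A1 B1 (s - t)) * y1 s t =
  cos (phase A2 B2 (s - t)) * x2 s t - sin (phase A2 B2 (s - t)) * y2 s t.

Lemma phase_0 A B : phase A B 0 = 0.
Proof. unfold phase. rewrite cos_0, sin_0. ring. Qed.

Lemma moduli_equal s : x1 s s = x2 s s.
Proof.
  pose proof (hdata s s) as h. replace (s - s) with 0 in h by ring. rewrite !phase_0, cos_0, sin_0 in h. lra.
Qed.

(** At [t = - s] evenness makes the product [f1 s conj (f1 t)] equal to [|f1
   s|^2], so the data determine the cosine of the phase on an interval. *)
Lemma phases_equal_or_opposite s0 : x1 s0 s0 <> 0 -> (A1 = A2 /\ B1 = B2) \/ (A1 = - A2 /\ B1 = - B2).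
Proof.
  intros hne.
  set (F := fun s => x1 s s).
  assert (hF : cts F) by (apply cts_plus; apply cts_mult; easy).
  destruct (continuous_small F s0 (hF s0) (Rabs (F s0))) as [d [hd hc]]; [now apply Rabs_pos_lt|].
  assert (hnz : forall s, s0 - d < s < s0 + d -> x1 s s <> 0).
  { intros s hs e. specialize (hc s). unfold F in hc. rewrite e, Rminus_0_l, Rabs_Ropp in hc.
    assert (Rabs (s - s0) < d) by (apply Rabs_def1; lra). specialize (hc H). lra. }
  assert (hcos : forall t, 2 * (s0 - d) < t < 2 * (s0 + d) ->
     sin ((phase A1 B1 t - phase A2 B2 t) / 2) * sin ((phase A1 B1 t + phase A2 B2 t) / 2) = 0).
  { intros t ht. pose proof (hdata (t / 2) (- (t / 2))) as h.
    replace (t / 2 - - (t / 2)) with t in h by field.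
    assert (e1 : x1 (t / 2) (- (t / 2)) = x1 (t / 2) (t / 2)) by (unfold x1; now rewrite ea1, eb1).
    assert (e2 : x2 (t / 2) (- (t / 2)) = x1 (t / 2) (t / 2)) by (rewrite moduli_equal; unfold x2; now rewrite ea2, eb2).
    assert (e3 : y1 (t / 2) (- (t / 2)) = 0) by (unfold y1; rewrite ea1, eb1; ring).
    assert (e4 : y2 (t / 2) (- (t / 2)) = 0) by (unfold y2; rewrite ea2, eb2; ring).
    rewrite e1, e2, e3, e4, !Rmult_0_r, !Rminus_0_r in h.
    apply Rmult_eq_reg_r in h; [|apply hnz; lra].
    pose proof (form2 (phase A1 B1 t) (phase A2 B2 t)) as e. lra. }
  assert (dec : forall u v : R, (u = 0 /\ v = 0) \/ (u <> 0 \/ v <> 0)).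
  { intros u v. destruct (Req_dec u 0), (Req_dec v 0); tauto. }
  destruct (dec (A1 - A2) (B1 - B2)) as [h|h1]; [left; lra|].
  destruct (dec (A1 + A2) (B1 + B2)) as [h|h2]; [right; lra|exfalso].
  destruct (sin_trig_nonzero2 ((A1 - A2) / 2) (- ((A1 - A2) / 2)) (- ((B1 - B2) / 2))
    ((A1 + A2) / 2) (- ((A1 + A2) / 2)) (- ((B1 + B2) / 2)) (2 * (s0 - d)) (2 * (s0 + d))) as (t & ht & n1 & n2).
  - lra.
  - destruct h1; [left|right]; lra.
  - destruct h2; [left|right]; lra.
  - specialize (hcos t ht). apply Rmult_integral in hcos.
    destruct hcos as [e|e]; [apply n1|apply n2]; rewrite <- e; f_equal; unfold phase; field.
Qed.

(** With equal or opposite phases, the data say that [cos g (x1 - x2) = sin g (y1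
   - si y2)] with [g] the phase at [s - t]. As the profiles are even, the same
   holds with [g] the phase at [s + t], and the two equations are independent
   for a dense set of angles, unless the phase is zero. *)
Lemma gram_equal (si : R) : si = 1 \/ si = -1 -> A2 = si * A1 -> B2 = si * B1 ->
  forall s t, x1 s t = x2 s t.
Proof.
  intros hsi hA hB.
  assert (hph : forall t, cos (phase A2 B2 t) = cos (phase A1 B1 t) /\ sin (phase A2 B2 t) = si * sin (phase A1 B1 t)).
  { intros t. rewrite hA, hB. destruct hsi as [-> | ->].
    - replace (phase (1 * A1) (1 * B1) t) with (phase A1 B1 t) by (unfold phase; ring). split; ring.
    - replace (phase (-1 * A1) (-1 * B1) t) with (- phase A1 B1 t) by (unfold phase; ring).
      rewrite cos_neg, sin_neg. split; ring. }
  assert (I1 : forall s t, cos (phase A1 B1 (s - t)) * (x1 s t - x2 s t) = sin (phase A1 B1 (s - t)) * (y1 s t - si * y2 s t)).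
  { intros s t. pose proof (hdata s t) as h. destruct (hph (s - t)) as [e1 e2]. rewrite e1, e2 in h. lra. }
  assert (dec : (A1 = 0 /\ B1 = 0) \/ (A1 <> 0 \/ B1 <> 0)).
  { destruct (Req_dec A1 0), (Req_dec B1 0); tauto. }
  destruct dec as [[hA0 hB0]|hAB].
  { intros s t. specialize (I1 s t). rewrite hA0, hB0 in I1.
    replace (phase 0 0 (s - t)) with 0 in I1 by (unfold phase; ring). rewrite cos_0, sin_0 in I1. lra. }
  (* the determinant of the two equations is the sine of the difference of the phases *)
  assert (K : forall u v, sin (2 * B1 * sin v * cos u - 2 * A1 * sin v * sin u) * (x1 u v - x2 u v) = 0).
  { intros u v. pose proof (I1 u v) as i1. pose proof (I1 u (- v)) as i2.
    replace (u - - v) with (u + v) in i2 by ring.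
    assert (e1 : x1 u (- v) = x1 u v) by (unfold x1; now rewrite ea1, eb1).
    assert (e2 : x2 u (- v) = x2 u v) by (unfold x2; now rewrite ea2, eb2).
    assert (e3 : y1 u (- v) = y1 u v) by (unfold y1; now rewrite ea1, eb1).
    assert (e4 : y2 u (- v) = y2 u v) by (unfold y2; now rewrite ea2, eb2).
    rewrite e1, e2, e3, e4 in i2.
    replace (2 * B1 * sin v * cos u - 2 * A1 * sin v * sin u) with (phase A1 B1 (u - v) - phase A1 B1 (u + v))
      by (unfold phase; rewrite cos_plus, cos_minus, sin_plus, sin_minus; ring).
    rewrite sin_minus. set (U := x1 u v - x2 u v) in *.
    transitivity (sin (phase A1 B1 (u - v)) * (cos (phase A1 B1 (u + v)) * U)
      - sin (phase A1 B1 (u + v)) * (cos (phase A1 B1 (u - v)) * U)); [ring|rewrite i1, i2; ring]. }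
  intros s t. apply Rminus_diag_uniq.
  apply (zero_of_dense_zero (fun v => x1 s v - x2 s v) sin).
  - apply cts_minus; apply cts_plus; apply cts_mult; auto using cts_const.
  - intros v hv.
    apply (zero_of_dense_zero (fun u => x1 u v - x2 u v)
      (fun u => sin (2 * B1 * sin v * cos u - 2 * A1 * sin v * sin u))).
    + apply cts_minus; apply cts_plus; apply cts_mult; auto using cts_const.
    + intros w hw. specialize (K w v). apply Rmult_integral in K. tauto.
    + intros a b hab.
      destruct (sin_trig_nonzero 0 (2 * B1 * sin v) (- (2 * A1 * sin v)) a b hab) as [w [hw hs]].
      * destruct hAB as [h|h]; [right|left]; intro e; apply h; apply (Rmult_eq_reg_l (sin v)); lra.
      * exists w. split; [easy|].
        now replace (2 * B1 * sin v * cos w - 2 * A1 * sin v * sin w)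
          with (0 + 2 * B1 * sin v * cos w + - (2 * A1 * sin v) * sin w) by ring.
  - intros a b hab. destruct (sin_trig_nonzero 0 0 1 a b hab) as [w [hw hs]]; [right; lra|].
    exists w. split; [easy|]. intro e. apply hs. rewrite e. replace (0 + 0 * cos w + 1 * 0) with 0 by ring. apply sin_0.
Qed.
End PhaseRetrieval.

Lemma profile_coef k r fr fi tr ti n u v :
  profile k r fr fi tr ti ->
  circ (fun t => u * (fr t * cos (IZR n * t + 0)) + v * (fi t * cos (IZR n * t + 0))) = u * tr n + v * ti n.
Proof.
  intros hp.
  rewrite (circ_lin u v (fun t => fr t * cos (IZR n * t + 0)) (fun t => fi t * cos (IZR n * t + 0))).
  - rewrite (pf_coef_re _ _ _ _ _ _ hp), (pf_coef_im _ _ _ _ _ _ hp), cos_0. ring.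
  - apply cts_mult; [apply hp|apply cts_cos_lin].
  - apply cts_mult; [apply hp|apply cts_cos_lin].
Qed.

(** Two integrations of the real part of [f s conj (f t)] against a cosine give
   [|t_n|^2]. *)
Lemma gram_coef k r fr fi tr ti k' r' fr' fi' tr' ti' n :
  profile k r fr fi tr ti -> profile k' r' fr' fi' tr' ti' ->
  (forall s t, fr s * fr t + fi s * fi t = fr' s * fr' t + fi' s * fi' t) ->
  tr n ^ 2 + ti n ^ 2 = tr' n ^ 2 + ti' n ^ 2.
Proof.
  intros h h' e.
  assert (e1 : forall s, fr s * tr n + fi s * ti n = fr' s * tr' n + fi' s * ti' n).
  { intros s. rewrite <- (profile_coef _ _ _ _ _ _ n _ _ h), <- (profile_coef _ _ _ _ _ _ n _ _ h').
    apply circ_ext. intros t. specialize (e s t).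
    transitivity ((fr s * fr t + fi s * fi t) * cos (IZR n * t + 0)); [ring|rewrite e; ring]. }
  transitivity (tr n * tr n + ti n * ti n); [ring|].
  transitivity (tr' n * tr' n + ti' n * ti' n); [|ring].
  rewrite <- (profile_coef _ _ _ _ _ _ n _ _ h), <- (profile_coef _ _ _ _ _ _ n _ _ h').
  apply circ_ext. intros t. specialize (e1 t).
  transitivity ((fr t * tr n + fi t * ti n) * cos (IZR n * t + 0)); [ring|rewrite e1; ring].
Qed.

Lemma profile_large k r : exists n, (1 <= n)%Z /\ 2 * (k * r) <= IZR n.
Proof.
  exists (up (Rmax 1 (2 * (k * r)))).
  pose proof (archimed (Rmax 1 (2 * (k * r)))) as [h _].
  pose proof (Rmax_l 1 (2 * (k * r))); pose proof (Rmax_r 1 (2 * (k * r))).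
  split; [apply le_IZR|]; lra.
Qed.

Lemma profile_nonzero k r fr fi tr ti : 0 < k -> 0 < r -> profile k r fr fi tr ti ->
  exists s, fr s * fr s + fi s * fi s <> 0.
Proof.
  intros hk hr hp. destruct (profile_large k r) as (n & hn1 & hn).
  destruct (classic (exists s, fr s * fr s + fi s * fi s <> 0)) as [|hno]; [easy|exfalso].
  assert (hz : forall s, fr s = 0 /\ fi s = 0).
  { intros s. destruct (Req_dec (fr s * fr s + fi s * fi s) 0) as [e|e]; [split; nra|].
    exfalso. apply hno. now exists s. }
  pose proof (mode_response_nonzero _ _ _ _ _ hk hr hn1 hn (pf_response _ _ _ _ _ _ hp n)) as h.
  assert (e : tr n * tr n + ti n * ti n = 0); [|nra].
  rewrite <- (profile_coef _ _ _ _ _ _ n _ _ hp).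
  transitivity (circ (fun _ => 0)).
  - apply circ_ext. intros t. destruct (hz t) as [-> ->]. ring.
  - apply (circ_derive (fun _ => 0)); [intros; apply is_derive_Rconst|apply cts_const|easy].
Qed.

Lemma profile_radius k r fr fi tr ti r' fr' fi' tr' ti' :
  0 < k -> 0 < r -> 0 < r' -> profile k r fr fi tr ti -> profile k r' fr' fi' tr' ti' ->
  (forall s t, fr s * fr t + fi s * fi t = fr' s * fr' t + fi' s * fi' t) -> r = r'.
Proof.
  intros hk hr hr' h h' e.
  destruct (Rtotal_order r r') as [hlt|[he|hgt]]; [exfalso|easy|exfalso].
  - destruct (mode_response_radius k r r' hk hr hlt) as [n hn].
    apply (hn n (Z.le_refl n) _ _ _ _ (pf_response _ _ _ _ _ _ h n) (pf_response _ _ _ _ _ _ h' n)).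
    eapply gram_coef; eauto.
  - destruct (mode_response_radius k r' r hk hr' hgt) as [n hn].
    apply (hn n (Z.le_refl n) _ _ _ _ (pf_response _ _ _ _ _ _ h' n) (pf_response _ _ _ _ _ _ h n)).
    symmetry. eapply gram_coef; eauto.
Qed.

Lemma profile_unique k r fr fi tr ti fr' fi' tr' ti' :
  0 < k -> 0 < r -> profile k r fr fi tr ti -> profile k r fr' fi' tr' ti' ->
  forall t, fr' t = fr t /\ fi' t = fi t.
Proof.
  intros hk hr h h' t.
  assert (eT : forall n, tr n = tr' n /\ ti n = ti' n).
  { intros n. apply (mode_response_unique k r n); auto; [apply h|apply h']. }
  split; revert t; apply fourier_eq; try apply h; try apply h'; intros n s.
  - now rewrite (pf_coef_re _ _ _ _ _ _ h), (pf_coef_re _ _ _ _ _ _ h'), (proj1 (eT n)).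
  - now rewrite (pf_coef_im _ _ _ _ _ _ h), (pf_coef_im _ _ _ _ _ _ h'), (proj2 (eT n)).
Qed.

(** Integrating twice, the coefficients would be real multiples of one another,
   against [mode_response_consecutive]. *)
Lemma profile_not_real k r fr fi tr ti : 0 < k -> 0 < r -> profile k r fr fi tr ti ->
  (forall s t, fi s * fr t - fr s * fi t = 0) -> False.
Proof.
  intros hk hr hp e. destruct (profile_large k r) as (n & hn1 & hn).
  apply (mode_response_consecutive k r n _ _ _ _ hk hr hn1 hn (pf_response _ _ _ _ _ _ hp n) (pf_response _ _ _ _ _ _ hp (n + 1)%Z)).
  assert (e1 : forall s, - fi s * tr n + fr s * ti n = 0).
  { intros s. rewrite <- (profile_coef _ _ _ _ _ _ n _ _ hp).
    transitivity (circ (fun _ => 0)).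
    - apply circ_ext. intros t. transitivity (- (fi s * fr t - fr s * fi t) * cos (IZR n * t + 0)); [ring|rewrite e; ring].
    - apply (circ_derive (fun _ => 0)); [intros; apply is_derive_Rconst|apply cts_const|easy]. }
  transitivity (ti n * tr (n + 1)%Z + (- tr n) * ti (n + 1)%Z); [ring|].
  rewrite <- (profile_coef _ _ _ _ _ _ (n + 1) _ _ hp).
  transitivity (circ (fun _ => 0)).
  - apply circ_ext. intros t. transitivity ((- fi t * tr n + fr t * ti n) * cos (IZR (n + 1) * t + 0)); [ring|rewrite e1; ring].
  - apply (circ_derive (fun _ => 0)); [intros; apply is_derive_Rconst|apply cts_const|easy].
Qed.

Lemma total_sq fr fi ka0 ka ph0 ph t :
  total_re fr fi ka0 ka ph0 ph t ^ 2 + total_im fr fi ka0 ka ph0 ph t ^ 2 =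
  let s := t - ph0 in let u := t - ph in
  (fr s * fr s + fi s * fi s) + (fr u * fr u + fi u * fi u) +
  2 * (cos (ka0 - ka) * (fr s * fr u + fi s * fi u) - sin (ka0 - ka) * (fi s * fr u - fr s * fi u)).
Proof.
  cbv zeta. unfold total_re, total_im, superpose. set (s := t - ph0). set (u := t - ph). rewrite cos_minus, sin_minus.
  assert (E : forall x, sin x * sin x + cos x * cos x = 1) by (intro x; exact (sin2_cos2 x)).
  transitivity ((fr s * fr s + fi s * fi s) * (sin ka0 * sin ka0 + cos ka0 * cos ka0)
    + (fr u * fr u + fi u * fi u) * (sin ka * sin ka + cos ka * cos ka)
    + 2 * ((cos ka0 * cos ka + sin ka0 * sin ka) * (fr s * fr u + fi s * fi u)
      - (sin ka0 * cos ka - cos ka0 * sin ka) * (fi s * fr u - fr s * fi u))); [ring|].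
  rewrite !E. ring.
Qed.

Theorem theorem3p1 (k : R) (d0 : R * R) (Z1 Z2 : disk)
    (uinf1 uinf2 : R * R -> R * R -> C)
    (hk : 0 < k) (hd0 : unit_vector d0)
    (hr1 : 0 < radius Z1) (hr2 : 0 < radius Z2)
    (h1 : forall d, unit_vector d ->
       is_far_field_pattern k Z1 d0 d (fun xhat => uinf1 xhat d))
    (h2 : forall d, unit_vector d ->
       is_far_field_pattern k Z2 d0 d (fun xhat => uinf2 xhat d))
    (hdata : forall xhat d, unit_vector xhat -> unit_vector d ->
       Cmod (uinf1 xhat d) = Cmod (uinf2 xhat d)) :
  center Z1 = center Z2 /\ radius Z1 = radius Z2.
Proof.
  destruct (unit_vector_direction d0 hd0) as [ph0 ->].
  destruct (far_field_structure k Z1 ph0 uinf1 hk hr1 h1) as (a1 & b1 & tr1 & ti1 & P1 & F1).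
  destruct (far_field_structure k Z2 ph0 uinf2 hk hr2 h2) as (a2 & b2 & tr2 & ti2 & P2 & F2).
  set (A := fun Z => k * dirdot (center Z) ph0).
  set (B := fun Z => k * (snd (center Z) * cos ph0 - fst (center Z) * sin ph0)).
  assert (hph : forall Z s, k * dirdot (center Z) ph0 - k * dirdot (center Z) (ph0 + s) = phase (A Z) (B Z) s).
  { intros Z s. unfold phase, A, B, dirdot. rewrite cos_plus, sin_plus. ring. }
  assert (hQ : forall s t,
    (a1 s * a1 s + b1 s * b1 s) + (a1 t * a1 t + b1 t * b1 t) +
      2 * (cos (phase (A Z1) (B Z1) (s - t)) * (a1 s * a1 t + b1 s * b1 t) - sin (phase (A Z1) (B Z1) (s - t)) * (b1 s * a1 t - a1 s * b1 t))
    = (a2 s * a2 s + b2 s * b2 s) + (a2 t * a2 t + b2 t * b2 t) +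
      2 * (cos (phase (A Z2) (B Z2) (s - t)) * (a2 s * a2 t + b2 s * b2 t) - sin (phase (A Z2) (B Z2) (s - t)) * (b2 s * a2 t - a2 s * b2 t))).
  { intros s t.
    pose proof (F1 (ph0 + s) (ph0 + (s - t))) as f1. pose proof (F2 (ph0 + s) (ph0 + (s - t))) as f2.
    rewrite total_sq in f1, f2. cbv zeta in f1, f2. rewrite !hph in f1, f2.
    replace (ph0 + s - ph0) with s in f1, f2 by ring.
    replace (ph0 + s - (ph0 + (s - t))) with t in f1, f2 by ring.
    rewrite <- f1, <- f2. now rewrite (hdata _ _ (unit_direction _) (unit_direction _)). }
  (* for s = t, that is d = d0, there is no phase *)
  assert (hN : forall s, a1 s * a1 s + b1 s * b1 s = a2 s * a2 s + b2 s * b2 s).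
  { intros s. specialize (hQ s s). replace (s - s) with 0 in hQ by ring.
    rewrite !phase_0, cos_0, sin_0 in hQ. lra. }
  assert (hI : forall s t,
    cos (phase (A Z1) (B Z1) (s - t)) * (a1 s * a1 t + b1 s * b1 t) - sin (phase (A Z1) (B Z1) (s - t)) * (b1 s * a1 t - a1 s * b1 t)
    = cos (phase (A Z2) (B Z2) (s - t)) * (a2 s * a2 t + b2 s * b2 t) - sin (phase (A Z2) (B Z2) (s - t)) * (b2 s * a2 t - a2 s * b2 t)).
  { intros s t. specialize (hQ s t). pose proof (hN s). pose proof (hN t). lra. }
  destruct (profile_nonzero _ _ _ _ _ _ hk hr1 P1) as [s0 hs0].
  assert (D : (A Z1 = A Z2 /\ B Z1 = B Z2) \/ (A Z1 = - A Z2 /\ B Z1 = - B Z2)).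
  { apply (phases_equal_or_opposite a1 b1 a2 b2 (A Z1) (B Z1) (A Z2) (B Z2)) with (s0 := s0); auto; try apply P1; try apply P2. }
  assert (G : forall s t, a1 s * a1 t + b1 s * b1 t = a2 s * a2 t + b2 s * b2 t).
  { destruct D as [[hA hB]|[hA hB]].
    - apply (gram_equal a1 b1 a2 b2 (A Z1) (B Z1) (A Z2) (B Z2)) with (si := 1); auto; try apply P1; try apply P2; lra.
    - apply (gram_equal a1 b1 a2 b2 (A Z1) (B Z1) (A Z2) (B Z2)) with (si := -1); auto; try apply P1; try apply P2; lra. }
  assert (hr : radius Z1 = radius Z2) by exact (profile_radius _ _ _ _ _ _ _ _ _ _ _ hk hr1 hr2 P1 P2 G).
  split; [|exact hr].
  assert (E : A Z1 = A Z2 /\ B Z1 = B Z2).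
  { destruct D as [|[hA hB]]; [easy|].
    assert (dec : (A Z1 = 0 /\ B Z1 = 0) \/ (A Z1 <> 0 \/ B Z1 <> 0)).
    { destruct (Req_dec (A Z1) 0), (Req_dec (B Z1) 0); tauto. }
    destruct dec as [|hAB]; [lra|exfalso].
    (* the profiles agree, and opposite phases leave no room for an imaginary part *)
    rewrite <- hr in P2.
    pose proof (profile_unique _ _ _ _ _ _ _ _ _ _ hk hr1 P1 P2) as U.
    apply (profile_not_real _ _ _ _ _ _ hk hr1 P1). intros s t.
    replace s with ((s - t) + t) by ring.
    apply (zero_of_dense_zero (fun v => b1 (v + t) * a1 t - a1 (v + t) * b1 t) (fun v => sin (phase (A Z1) (B Z1) v))).
    - assert (T : forall g, cts g -> cts (fun v => g (v + t))).
      { intros g hg. apply (cts_comp (fun v => v + t) g); [apply cts_derive; intros; auto_derive; easy|easy]. }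
      apply cts_minus; apply cts_mult; auto using cts_const; apply T; apply P1.
    - intros v hv. specialize (hI (v + t) t). replace (v + t - t) with v in hI by ring.
      rewrite (proj1 (U (v + t))), (proj2 (U (v + t))), (proj1 (U t)), (proj2 (U t)) in hI.
      replace (phase (A Z2) (B Z2) v) with (- phase (A Z1) (B Z1) v) in hI by (rewrite hA, hB; unfold phase; ring).
      rewrite cos_neg, sin_neg in hI. apply (Rmult_eq_reg_l (sin (phase (A Z1) (B Z1) v))); [lra|easy].
    - now apply sin_phase_dense. }
  destruct E as [eA eB]. unfold A, B, dirdot in eA, eB.
  apply Rmult_eq_reg_l in eA; [|lra]. apply Rmult_eq_reg_l in eB; [|lra].
  pose proof (sin2_cos2 ph0) as e. unfold Rsqr in e.
  destruct (center Z1) as [p q], (center Z2) as [p' q']. simpl in eA, eB.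
  f_equal.
  - transitivity ((p * cos ph0 + q * sin ph0) * cos ph0 - (q * cos ph0 - p * sin ph0) * sin ph0).
    + transitivity (p * (sin ph0 * sin ph0 + cos ph0 * cos ph0)); [rewrite e; ring|ring].
    + rewrite eA, eB. transitivity (p' * (sin ph0 * sin ph0 + cos ph0 * cos ph0)); [ring|rewrite e; ring].
  - transitivity ((p * cos ph0 + q * sin ph0) * sin ph0 + (q * cos ph0 - p * sin ph0) * cos ph0).
    + transitivity (q * (sin ph0 * sin ph0 + cos ph0 * cos ph0)); [rewrite e; ring|ring].
    + rewrite eA, eB. transitivity (q' * (sin ph0 * sin ph0 + cos ph0 * cos ph0)); [ring|rewrite e; ring].
Qed.
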